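(* Let $N=\binom{n}{2}$, let $e_1,\dots,e_N$ be a uniformly random permutation of the edges of $K_n$, and for $0\le m\le N$ let $\mathcal{G}(n,m)=([n],\{e_1,\dots,e_m\})$ (the Erd\H{o}s--R\'enyi random graph process). Let $$M=\min\{m : \mathcal{G}(n,m)\text{ is connected}\}.$$ Then asymptotically almost surely (i.e. with probability tending to $1$ as $n\to\infty$) $$a_f(\mathcal{G}(n,M)) = a_u(\mathcal{G}(n,M)) = 1.$$
   Context: Acquisition numbers: Let $G$ be a graph in which every vertex initially has weight $1$. A unit acquisition move transfers one unit of weight from a vertex $u$ to a neighbouring vertex $v$, provided that immediately prior to the move the weight on $v$ is at least the weight on $u$. A fractional acquisition move transfers an arbitrary positive (possibly non-integer) amount of weight, not exceeding the current weight of $u$, from a vertex $u$ to a neighbouring vertex $v$, provided that immediately prior to the move the weight on $v$ is at least the weight on $u$. An acquisition protocol is a maximal sequence of such moves (until no move of that type remains possible); the set of vertices with positive weight at the end is a residual set. The unit acquisition number $a_u(G)$ (resp. fractional acquisition number $a_f(G)$) is the minimum possible size of a residual set over all acquisition protocols using unit (resp. fractional) acquisition moves. *)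

(* Defs.v *)
From HB Require Import structures.
From Stdlib Require Import Relation_Operators.
From mathcomp Require Import all_boot all_order all_algebra all_fingroup.
From mathcomp Require Import boolp reals.
Set Implicit Arguments. Unset Strict Implicit. Unset Printing Implicit Defensive.
Import Order.TTheory GRing.Theory Num.Theory.
Local Open Scope ring_scope.

Definition transfer_nat (V : finType) (w : V -> nat) (u v : V) (a : nat)
  : V -> nat :=
  fun x => if x == u then (w u - a)%N else if x == v then (w v + a)%N else w x.

Definition transfer_R (R : realType) (V : finType) (w : V -> R) (u v : V)
  (a : R) : V -> R :=
  fun x => if x == u then w u - a else if x == v then w v + a else w x.

Definition unit_move (V : finType) (g : rel V) (w w' : V -> nat) : Prop :=
  exists u v, [/\ g u v, (1 <= w u)%N, (w u <= w v)%N & w' = transfer_nat w u v 1].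

Definition frac_move (R : realType) (V : finType) (g : rel V) (w w' : V -> R)
  : Prop :=
  exists u v a, [/\ g u v, 0 < a, a <= w u, w u <= w v &
                    w' = transfer_R w u v a].

Definition support_nat (V : finType) (w : V -> nat) : {set V} :=
  [set x | (0 < w x)%N].
Definition support_R (R : realType) (V : finType) (w : V -> R) : {set V} :=
  [set x | 0 < w x].

Definition unit_acq_number (V : finType) (g : rel V) (k : nat) : Prop :=
  let reach := clos_refl_trans _ (unit_move g) (fun _ => 1%N) in
  let terminal w := ~ exists w', unit_move g w w' in
  (exists w, [/\ reach w, terminal w & #|support_nat w| = k]) /\
  (forall w, reach w -> terminal w -> (k <= #|support_nat w|)%N).

Definition frac_acq_number (R : realType) (V : finType) (g : rel V) (k : nat)
  : Prop :=
  let reach := clos_refl_trans _ (frac_move g) (fun _ => 1 : R) in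
  let terminal w := ~ exists w', frac_move g w w' in
  (exists w, [/\ reach w, terminal w & #|support_R w| = k]) /\
  (forall w, reach w -> terminal w -> (k <= #|support_R w|)%N).

Definition Kedge (n : nat) := {p : 'I_n * 'I_n | (p.1 < p.2)%N}.

(* a permutation s of the edges gives the ordering e_1, e_2, ..., with
   e_(k+1) = s (enum_val k); the edge e has position enum_rank (s^-1 e).
   G(n,m) = ([n], {e_1,...,e_m}) as an adjacency relation. *)
Definition gnm (n : nat) (s : {perm Kedge n}) (m : nat) : rel 'I_n :=
  fun x y => [exists e : Kedge n,
     ((val e == (x, y)) || (val e == (y, x))) && (enum_rank ((s^-1)%g e) < m)%N].

Definition connected (V : finType) (g : rel V) : bool :=
  [forall x, forall y, connect g x y].

(* M = min { m : G(n,m) connected } (G(n,N) = K_n is connected) *)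
Definition hitting_time (n : nat) (s : {perm Kedge n}) : nat :=
  \big[minn/#|{: Kedge n}|]_(m < #|{: Kedge n}|.+1 | connected (gnm s m)) m.

Definition prob_perm (R : realType) (n : nat) (P : {perm Kedge n} -> Prop) : R :=
  #|[set s : {perm Kedge n} | `[< P s >] ]|%:R / #|{perm Kedge n}|%:R.

(* Main.v *)
(* Unit moves are fractional moves and at least one vertex keeps positive weight, so it
   suffices to gather all the weight at one vertex by unit moves.  This is possible as soon
   as every vertex has a parent of strictly larger weight, up to a root: any unit can then
   be carried to the root along increasing weights.

   With h = floor(ln n), the graph at the hitting time is sandwiched, a.a.s., between
   G(n, 2nh/5) (still disconnected, by the second moment of the number of isolated vertices)
   and G(n, 4nh) (already connected).  The vertices are split into a fixed majority A and a
   minority of size n/10.  Vertices with few neighbours in A or in the minority are rare and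
   far apart, and hang as leaves on other vertices.  Sparsity of small vertex sets turns the
   remaining minimum degree, of order ln n, into expansion: inside A, breadth-first search
   from a root gives a spanning tree of height O(ln n / ln ln n), and by Hall's theorem each
   inner vertex of the tree collects from private neighbours in the minority a weight that
   decreases with its depth.  Only few vertices, those near the root or with a deep
   descendant, need more than a bounded supply, which is what makes Hall's condition hold.
   All the other probabilities are bounded by first moments. *)
Require Import Defs.
From Stdlib Require Import Relation_Operators.
From mathcomp Require Import all_boot all_order all_algebra all_fingroup.
From mathcomp Require Import boolp reals sequences exp.
From mathcomp Require Import zify ring lra.
Set Implicit Arguments. Unset Strict Implicit. Unset Printing Implicit Defensive.
Import Order.TTheory GRing.Theory Num.Theory.

(** * Sending weight to a root, unit by unit *)

(** Supply is the bottleneck. There may be of the order of n / sqrt(ln n) inner vertices, so a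
    demand equal to the height at each of them would exceed the n/10 units of the minority. Around
    the layer where a ball first reaches that many vertices, the layers shrink by a factor q per
    step, both towards the root and away from it. Twenty steps off on either side the count has
    dropped by q^20, of order (ln n)^5; only those vertices and the ancestors of the deep ones are
    measured against the full height, and for all others a window of about 40 levels is enough.

    Since the hitting time is random, low degree is read in the earlier graph and paths between low
    vertices in the later one. A tree with f edges has about n (ln n)^f copies, so the degrees have
    to beat one factor n: two low vertices in A do, since 2 * (9/10) * (4/5) > 1, and so do twenty
    in the minority, while a single one does not. Hence isolated low vertices cannot be avoided and
    have to be leaves, and connectivity provides their parents. *)

Section Flush.
Variables (V : finType) (g : rel V).
Local Notation reach := (clos_refl_trans _ (unit_move g)).

Definition shift_unit (w : V -> nat) (u v : V) : V -> nat :=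
  fun x => w x - (x == u) + (x == v).

Lemma reach_shift_unit (w : V -> nat) (u v : V) :
  u != v -> g u v -> 0 < w u -> w u <= w v -> reach w (shift_unit w u v).
Proof.
move=> uv guv wu wuv; apply: rt_step; exists u, v; split=> //.
apply/funext=> x; rewrite /shift_unit /transfer_nat.
have [->|xu] := eqVneq x u; first by rewrite (negPf uv) addn0.
by have [->|xv] := eqVneq x v; rewrite ?subn0 ?addn0.
Qed.

Variables (r : V) (p : V -> V) (dep : V -> nat).
Hypothesis p_root : p r = r.
Hypothesis p_edge : forall v, v != r -> g v (p v).
Hypothesis p_dep : forall v, v != r -> dep (p v) < dep v.

Lemma parent_neq v : v != r -> v != p v.
Proof. by move=> vr; apply/eqP=> e; have := p_dep vr; rewrite -e ltnn. Qed.

Lemma dep_iter i v : dep (iter i p v) <= dep v.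
Proof.
elim: i => [//|i IH]; rewrite iterS; apply: leq_trans IH.
by have [->|/p_dep/ltnW//] := eqVneq (iter i p v) r; rewrite p_root.
Qed.

(** The parent of [v] only has to match [v], but further up the increase is strict: a unit in
    transit raises the vertex it stands on by one and must still be allowed to move on. *)
Definition flushable (w : V -> nat) (v : V) : Prop :=
  w v <= w (p v) /\
  forall i, iter i p (p v) != r -> w (iter i p (p v)) < w (iter i.+1 p (p v)).

Lemma reach_unit_to_root w v : v != r -> 0 < w v ->
  flushable w v -> reach w (shift_unit w v r).
Proof.
have [k] := ubnP (dep v); elim: k => [//|k IH] in w v * => dk vr wv [w1 w2].
have vp := parent_neq vr.
have step := reach_shift_unit vp (p_edge vr) wv w1.
have [pr|pr] := eqVneq (p v) r; first by rewrite -pr.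
set w' := shift_unit w v (p v) in step.
have dvp := p_dep vr.
have eqw x : dep x < dep (p v) -> w' x = w x.
  move=> dx; rewrite /w' /shift_unit.
  have /negPf -> : x != v by apply: contraTneq dx => ->; rewrite -leqNgt ltnW.
  have /negPf -> : x != p v by apply: contraTneq dx => ->; rewrite ltnn.
  by rewrite subn0 addn0.
have w'p : w' (p v) = (w (p v)).+1.
  by rewrite /w' /shift_unit eq_sym (negPf vp) eqxx subn0 addn1.
have reach' : reach w' (shift_unit w' (p v) r).
  apply: IH => //; first exact: leq_trans dvp dk.
    by rewrite w'p.
  split; first by rewrite w'p eqw ?(w2 0)// p_dep.
  move=> i ir; rewrite !eqw ?(leq_ltn_trans (dep_iter _ _)) ?p_dep//.
  by have := w2 i.+1; rewrite iterSr (iterSr i.+1); apply.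
apply: rt_trans step _.
have -> : shift_unit w v r = shift_unit w' (p v) r; last by [].
apply/funext=> x; rewrite /w' /shift_unit.
have [->|xv] := eqVneq x v; first by rewrite (negPf vp) addn0 subn0.
by case: (eqVneq x (p v)) => _ /=; lia.
Qed.

(** Once a unit has arrived, only [v] has lost and only [r] has gained, which preserves all the
    inequalities, so the next unit can follow. *)
Lemma reach_drain w v : v != r -> flushable w v ->
  reach w (fun x => if x == v then 0 else w x + (x == r) * w v).
Proof.
move=> vr; have [k wk] : {k | w v = k} by exists (w v).
elim: k => [|k IH] in w wk * => fl.
  suff -> : (fun x => if x == v then 0 else w x + (x == r) * w v) = w by apply: rt_refl.
  by apply/funext=> x; case: eqP => [->//|_]; rewrite wk muln0 addn0.
apply: rt_trans (reach_unit_to_root vr _ fl) _; first by rewrite wk.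
have rv : r != v by rewrite eq_sym.
have vv : shift_unit w v r v = k by rewrite /shift_unit eqxx (negPf vr) wk subn1 addn0.
have ge x : x != v -> w x <= shift_unit w v r x.
  by move=> xv; rewrite /shift_unit (negPf xv) subn0 leq_addr.
have eqs x : x != v -> x != r -> w x = shift_unit w v r x.
  by move=> xv xr; rewrite /shift_unit (negPf xv) (negPf xr) subn0 addn0.
have chain i : iter i p (p v) != v.
  have := dep_iter i (p v); have := p_dep vr => d1 d2.
  by apply: contraTneq d2 => ->; rewrite -ltnNge.
suff fl' : flushable (shift_unit w v r) v.
  have := IH _ vv fl'; congr reach.
  apply/funext=> x; rewrite vv; case: eqP => // /eqP xv.
  by rewrite /shift_unit (negPf xv) subn0 wk; case: (x == r); lia.
case: fl => w1 w2; split.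
  by rewrite vv; have := ge _ (chain 0); rewrite /=; lia.
move=> i ir; rewrite -eqs ?chain//.
by apply: leq_trans (w2 _ ir) (ge _ (chain i.+1)).
Qed.

(** Imposed only where the weight is positive: vertices that have given their unit away may sit
    anywhere in the tree. *)
Definition monotone_to_root (w : V -> nat) : Prop :=
  forall v, v != r -> 0 < w v -> w v <= w (p v) /\ (p v != r -> w (p v) < w (p (p v))).

Lemma monotone_flushable w v : monotone_to_root w -> v != r -> 0 < w v -> flushable w v.
Proof.
move=> mw vr wv; have [w1 _] := mw _ vr wv; split=> // i ir.
have pos j : j <= i -> iter j p v != r /\ 0 < w (iter j p v).
  elim: j => [//|j IH] ji.
  have [jr jw] := IH (ltnW ji).
  have [a _] := mw _ jr jw.
  split; last by rewrite iterS; lia.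
  have : iter (i - j) p (iter j.+1 p v) != r.
    by rewrite -iterD addnS subnK ?iterSr // ltnW.
  by apply: contraNneq => ->; elim: (i - j) => [//|m IHm]; rewrite iterS (eqP IHm) p_root.
have [ir' iw] := pos i (leqnn _).
by have [_] := mw _ ir' iw; rewrite -!iterS (iterSr i) (iterSr i.+1); apply.
Qed.

(** A deepest loaded vertex is drained first: it is neither parent nor grandparent of another loaded
    vertex, so the condition survives its loss of weight. *)
Lemma reach_root w : monotone_to_root w ->
  reach w (fun x => if x == r then \sum_v w v else 0).
Proof.
have [k] := ubnP #|[set v | (v != r) && (0 < w v)]|.
elim: k => [//|k IH] in w * => ck mw.
have [v0 | none] := pickP [pred v | (v != r) && (0 < w v)]; last first.
  have z x : x != r -> w x = 0.
    by move=> xr; have := none x; rewrite /= xr /=; case: (w x).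
  suff -> : (fun x => if x == r then \sum_v w v else 0) = w by apply: rt_refl.
  apply/funext=> x; case: eqP => [->|/eqP/z//].
  by rewrite (bigD1 r)//= big1 ?addn0// => i /z.
case/andP=> v0r v0w.
pose P v := (v != r) && (0 < w v).
have Pv0 : P v0 by rewrite /P v0r v0w.
case: (@arg_maxnP _ v0 P dep Pv0) => v /andP[vr wv] vmax.
have dr := reach_drain vr (monotone_flushable mw vr wv).
apply: rt_trans dr _.
set w' := fun x => _.
have rv : (r == v) = false by rewrite eq_sym (negPf vr).
have tot : \sum_x w x = \sum_x w' x.
  rewrite (bigD1 v)//= (bigD1 r) 1?eq_sym// [RHS](bigD1 v)//= [in RHS](bigD1 r) 1?eq_sym//.
  rewrite /w' rv !eqxx mul1n add0n addnA (addnC (w v)); congr (_ + _).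
  by apply: eq_bigr => x /andP[/negPf -> /negPf ->]; rewrite mul0n addn0.
rewrite tot; apply: IH.
  rewrite ltnS in ck; apply: leq_trans ck; apply: proper_card; apply/properP; split.
    apply/subsetP=> x; rewrite !inE /w'; case: (x == v); first by rewrite andbF.
    by case/andP=> /negPf -> ; rewrite mul0n addn0 => ->.
  by exists v; rewrite !inE ?vr ?wv// /w' eqxx andbF.
move=> x xr; rewrite /w'.
case: (eqVneq x v) => [//|xv]; rewrite (negPf xr) mul0n addn0 => wx.
have [a1 a2] := mw _ xr wx.
have dxv : dep x <= dep v by apply: vmax; rewrite /P xr wx.
have px : p x != v.
  by apply: contraTneq dxv => <-; rewrite -ltnNge p_dep.
rewrite (negPf px); split.
  by apply: leq_trans a1 _; rewrite leq_addr.
move=> pxr; rewrite (negPf pxr) mul0n addn0.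
have ppx : p (p x) != v.
  by apply: contraTneq dxv => <-; rewrite -ltnNge (ltn_trans (p_dep pxr)) ?p_dep.
by rewrite (negPf ppx); apply: leq_trans (a2 pxr) _; rewrite leq_addr.
Qed.

End Flush.

(** * First round of moves: suppliers hand over their unit *)

Section Supply.
Variables (V : finType) (g : rel V) (c : V -> option V).
Hypothesis c_edge : forall y a, c y = Some a -> g y a.
Hypothesis c_target : forall y a, c y = Some a -> c a = None.

Definition supplied (x : V) : nat :=
  if c x then 0 else (#|[set y | c y == Some x]|).+1.

(** A target never supplies. Hence a supplier still has weight exactly 1 when it moves, its target
    has at least 1, and the moves are legal in any order. *)
Lemma reach_supplied :
  clos_refl_trans _ (unit_move g) (fun _ => 1) supplied.
Proof.
pose wt (Y : {set V}) (x : V) := if x \in Y then 0 else (#|[set y in Y | c y == Some x]|).+1.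
suff H (Y : {set V}) : (forall y, y \in Y -> c y) ->
    clos_refl_trans _ (unit_move g) (fun _ => 1) (wt Y).
  have -> : supplied = wt [set y | isSome (c y)]; last by apply: H => y; rewrite inE.
  apply/funext=> x; rewrite /supplied /wt inE; case: (c x) => //; congr _.+1.
  by apply: eq_card => y; rewrite !inE; case: eqP => [->|]; rewrite ?andbF.
have [k] := ubnP #|Y|; elim: k Y => [//|k IH] Y cY domY.
have [->|[y yY]] := set_0Vmem Y.
  have -> : wt set0 = (fun _ => 1); last exact: rt_refl.
  apply/funext=> x; rewrite /wt inE; congr _.+1; apply: eq_card0 => y.
  by rewrite !inE.
case cy: (c y) (domY _ yY) => [a|] // _.
have ya : y != a.
  by apply/eqP=> e; have := c_target cy; rewrite -e cy.
have aY : a \notin Y.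
  by apply/negP=> /domY; rewrite (c_target cy).
apply: rt_trans (IH (Y :\ y) _ _) _.
- by rewrite ltnS in cY; apply: leq_trans cY; rewrite [in X in _ < X](cardsD1 y) yY.
- by move=> z /setD1P[_ /domY].
have nsup : forall z, #|[set x in Y :\ y | c x == Some z]| + (a == z) = #|[set x in Y | c x == Some z]|.
  move=> z; rewrite [RHS](cardsD1 y) !inE yY cy /= addnC.
  have -> : (Some a == Some z) = (a == z) by [].
  by congr (_ + _); apply: eq_card => x; rewrite !inE andbA.
have wy : wt (Y :\ y) y = 1.
  rewrite /wt !inE eqxx /=; congr _.+1; apply: eq_card0 => z.
  rewrite !inE; apply/negP=> /andP[/andP[_ zY] /eqP cz].
  by have := c_target cz; rewrite cy.
have wa : 0 < wt (Y :\ y) a by rewrite /wt !inE (negPf aY) andbF.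
have -> : wt Y = shift_unit (wt (Y :\ y)) y a.
  apply/funext=> x; rewrite /shift_unit.
  have [->|xy] := eqVneq x y; first by rewrite wy (negPf ya) /wt yY.
  rewrite subn0 /wt !inE xy /=; case: ifP => xY.
    by case: eqP => // xa; rewrite -xa xY in aY.
  by rewrite -nsup eq_sym addSn.
by apply: reach_shift_unit; rewrite ?wy ?(c_edge cy).
Qed.

End Supply.

(** * Conservation of weight and the value 1 *)

Section Totals.
Variables (V : finType) (g : rel V).

Lemma sum_transfer_nat (w : V -> nat) u v a : u != v -> a <= w u ->
  \sum_x transfer_nat w u v a x = \sum_x w x.
Proof.
move=> uv au; rewrite (bigD1 u)//= (bigD1 v) 1?eq_sym//.
rewrite [RHS](bigD1 u)//= [in RHS](bigD1 v) 1?eq_sym//.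
rewrite /transfer_nat !eqxx eq_sym (negPf uv) !addnA; congr (_ + _); first by lia.
by apply: eq_bigr => x /andP[/negPf -> /negPf ->].
Qed.

Lemma unit_reach_sum w w' : irreflexive g ->
  clos_refl_trans _ (unit_move g) w w' -> \sum_x w' x = \sum_x w x.
Proof.
move=> gi; elim=> // [x y [u [v [guv wu wuv ->]]]|x y z _ e1 _ e2].
  by apply: sum_transfer_nat => //; apply: contraTneq guv => ->; rewrite gi.
by rewrite e2 e1.
Qed.

Local Open Scope ring_scope.

Lemma sum_transfer_R (R : realType) (w : V -> R) u v a : u != v ->
  \sum_x transfer_R w u v a x = \sum_x w x.
Proof.
move=> uv; rewrite (bigD1 u)//= (bigD1 v) 1?eq_sym//.
rewrite [RHS](bigD1 u)//= [in RHS](bigD1 v) 1?eq_sym//.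
rewrite /transfer_R !eqxx eq_sym (negPf uv) !addrA; congr (_ + _).
  by ring.
by apply: eq_bigr => x /andP[/negPf -> /negPf ->].
Qed.

Lemma frac_reach_sum (R : realType) (w w' : V -> R) : irreflexive g ->
  clos_refl_trans _ (frac_move g) w w' -> \sum_x w' x = \sum_x w x.
Proof.
move=> gi; elim=> // [x y [u [v [a [guv wu _ _ ->]]]]|x y z _ e1 _ e2].
  by apply: sum_transfer_R => //; apply: contraTneq guv => ->; rewrite gi.
by rewrite e2 e1.
Qed.

Lemma unit_reach_frac (R : realType) (w w' : V -> nat) :
  clos_refl_trans _ (unit_move g) w w' ->
  clos_refl_trans _ (frac_move g) (fun x => (w x)%:R : R) (fun x => (w' x)%:R).
Proof.
elim=> [x y [u [v [guv wu wuv ->]]]|x|x y z _ e1 _ e2].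
- apply: rt_step; exists u, v, 1; split=> //; rewrite ?ler1n ?ler_nat//.
  apply/funext=> z; rewrite /transfer_R /transfer_nat.
  by case: ifP => _; [rewrite natrB|case: ifP => _; rewrite ?natrD].
- exact: rt_refl.
- exact: rt_trans e1 e2.
Qed.

(** Without loops the total weight is conserved, so no residual set is empty; and a single loaded
    vertex admits no move, which makes the given state terminal. *)
Lemma acq_numbers_one (R : realType) (r : V) : irreflexive g ->
  clos_refl_trans _ (unit_move g) (fun _ => 1%N)
    (fun x => if x == r then #|V| else 0%N) ->
  frac_acq_number R g 1 /\ unit_acq_number g 1.
Proof.
move=> gi reach.
have V0 : (0 < #|V|)%N by apply/card_gt0P; exists r.
split; split.
- exists (fun x => (if x == r then #|V| else 0%N)%:R); split.
  + exact: (unit_reach_frac R reach).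
  + case=> w' [u [v [a [guv a0 au wuv _]]]].
    have supp x : 0 < ((if x == r then #|V| else 0)%N%:R : R) -> x = r.
      by case: eqP => // _; rewrite ltxx.
    have ur := supp _ (lt_le_trans a0 au).
    have vr := supp _ (lt_le_trans a0 (le_trans au wuv)).
    by move: guv; rewrite ur vr gi.
  + rewrite -[RHS](cards1 r); apply: eq_card => x; rewrite !inE ltr0n.
    by case: eqP.
- move=> w /(frac_reach_sum gi) sw _; rewrite card_gt0; apply/eqP=> s0.
  have : \sum_x w x <= 0.
    by apply: sumr_le0 => x _; rewrite leNgt; move/setP/(_ x): s0; rewrite !inE => ->.
  by rewrite sw sumr_const leNgt ltr0n V0.
- exists (fun x => if x == r then #|V| else 0%N); split=> //.
  + case=> w' [u [v [guv a0 wuv _]]]; move: a0 (leq_trans a0 wuv).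
    case: eqP => [ur|//]; case: eqP => [vr|//] _ _.
    by move: guv; rewrite ur vr gi.
  + rewrite -[RHS](cards1 r); apply: eq_card => x; rewrite !inE.
    by case: eqP.
- move=> w /(unit_reach_sum gi) sw _; rewrite card_gt0; apply/eqP=> s0.
  have : (\sum_x w x = 0)%N.
    by apply: big1 => x _; move/setP/(_ x): s0; rewrite !inE; case: (w x).
  by rewrite sw sum1_card => e; rewrite e in V0.
Qed.

End Totals.

(** * Hall's theorem, and its version with demands *)

Section Hall.
Variables (I V : finType).

Definition hall_cond (N : I -> {set V}) : Prop :=
  forall S : {set I}, #|S| <= #|\bigcup_(i in S) N i|.

(* Rado's argument: as long as some [N i] has two elements, one of them can be
   deleted; two obstructions would contradict submodularity of [#|_|]. *)
Lemma hall_matching (N : I -> {set V}) : hall_cond N ->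
  exists f : I -> V, injective f /\ forall i, f i \in N i.
Proof.
have [k] := ubnP (\sum_i #|N i|); elim: k N => [//|k IH] N ck HN.
have [/existsP[i0 big0]|] := boolP [exists i, 1 < #|N i|]; last first.
  rewrite negb_exists => /forallP small.
  have one i : exists y, N i == [set y].
    have := HN [set i]; rewrite cards1 big_set1 => h.
    have /cards1P[y ->] : #|N i| == 1 by rewrite eqn_leq h andbT leqNgt small.
    by exists y.
  have [f fN] : exists f : I -> V, forall i, N i = [set f i].
    by exists (fun i => xchoose (one i)) => i; apply/eqP/(xchooseP (one i)).
  exists f; split=> [i j e|i]; last by rewrite fN inE.
  apply/eqP; apply: contraT => ij.
  have := HN [set i; j]; rewrite bigcup_setU !big_set1.
  by rewrite !fN e setUid cards2 ij cards1.
have [y1 [y2 [y1N y2N y12]]] := card_gt1P big0.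
pose Nd y i := if i == i0 then N i0 :\ y else N i.
have sub y i : Nd y i \subset N i.
  by rewrite /Nd; case: eqP => [->|_] //; apply: subsetDl.
suff [y yN Hy] : exists2 y, y \in N i0 & hall_cond (Nd y).
  case: (IH (Nd y) _ Hy) => [|f [fi fN]].
    rewrite ltnS in ck; apply: leq_trans ck.
    rewrite (bigD1 i0)//= [in X in _ < X](bigD1 i0)//=.
    rewrite /Nd eqxx [in X in _ < X](cardsD1 y) yN add1n addSn ltnS leq_add2l.
    by apply: leq_sum => i /negPf ->.
  by exists f; split=> // i; apply: (subsetP (sub y i)).
have viol y : ~ hall_cond (Nd y) -> exists2 S : {set I}, i0 \in S & #|\bigcup_(i in S) Nd y i| < #|S|.
  move=> nH; have [/existsP[S lS]|no] := boolP [exists S : {set I}, #|\bigcup_(i in S) Nd y i| < #|S|].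
    exists S => //; apply: contraLR lS => i0S; rewrite -leqNgt.
    suff -> : \bigcup_(i in S) Nd y i = \bigcup_(i in S) N i by [].
    by apply: eq_bigr => i iS; rewrite /Nd; case: eqP => // e; rewrite -e iS in i0S.
  case: nH => S; rewrite leqNgt; apply: contra no => lS; apply/existsP; by exists S.
have dec y : hall_cond (Nd y) \/ ~ hall_cond (Nd y).
  have [a|a] := boolP [forall S : {set I}, #|S| <= #|\bigcup_(i in S) Nd y i|].
    by left=> S; move/forallP/(_ S): a.
  by right=> h; move/negP: a; apply; apply/forallP.
case: (dec y1) => [h|/viol[S1 i1 v1]]; first by exists y1.
case: (dec y2) => [h|/viol[S2 i2 v2]]; first by exists y2.
exfalso; set U1 := \bigcup_(i in S1) _ in v1; set U2 := \bigcup_(i in S2) _ in v2.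
(* The two deletions concern different elements, so every element of [N i0] survives in one of the
   two unions. *)
have cU : #|S1 :|: S2| <= #|U1 :|: U2|.
  apply: leq_trans (HN _) _; apply/subset_leq_card/bigcupsP => i iS.
  apply/subsetP=> y yi; rewrite inE.
  have [ii|ii] := eqVneq i i0; last first.
    move: iS; rewrite inE => /orP[iS|iS]; apply/orP; [left|right];
      by apply/bigcupP; exists i; rewrite // /Nd (negPf ii).
  rewrite ii in yi; have [yy|yy] := eqVneq y y1.
    apply/orP; right; apply/bigcupP; exists i0; rewrite // /Nd eqxx !inE yi andbT.
    by rewrite yy y12.
  by apply/orP; left; apply/bigcupP; exists i0; rewrite // /Nd eqxx !inE yi yy.
(* Away from [i0] nothing was deleted. Giving up [i0] costs one, less than the two gained from the
   strict inequalities [v1] and [v2]. *)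
have cI : #|(S1 :&: S2) :\ i0| <= #|U1 :&: U2|.
  apply: leq_trans (HN _) _; apply/subset_leq_card/bigcupsP => i.
  rewrite !inE => /and3P[ii iS1 iS2].
  apply/subsetP=> y yi; rewrite inE; apply/andP; split; apply/bigcupP; exists i => //;
    by rewrite /Nd (negPf ii).
have := cardsUI S1 S2; have := cardsUI U1 U2.
have := cardsD1 i0 (S1 :&: S2); rewrite inE i1 i2 /=.
move: v1 v2 cU cI; rewrite -/U1 -/U2; lia.
Qed.

End Hall.

(** Hall's theorem for [d a] copies of each [a]. The matching is read backwards, from suppliers to
    targets, which makes the groups of suppliers disjoint by construction. *)
Lemma hall_demand (V : finType) (N : V -> {set V}) (d : V -> nat) (I : {set V}) :
  (forall S : {set V}, S \subset I -> \sum_(a in S) d a <= #|\bigcup_(a in S) N a|) ->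
  exists c : V -> option V,
    (forall y a, c y = Some a -> a \in I /\ y \in N a) /\
    forall a, a \in I -> #|[set y | c y == Some a]| = d a.
Proof.
move=> H; pose K := \max_a d a.
pose P (x : V * 'I_K) := (x.1 \in I) && (x.2 < d x.1).
pose J : finType := {x | P x}.
have fiber a : a \in I -> #|[set i : J | (val i).1 == a]| = d a.
  move=> aI; have dK : d a <= K by exact: leq_bigmax.
  rewrite -[RHS]card_ord.
  have ok (j : 'I_(d a)) : P (a, widen_ord dK j) by rewrite /P /= aI ltn_ord.
  pose e (j : 'I_(d a)) : J := exist (fun x => P x) (a, widen_ord dK j) (ok j).
  have ei : injective e by move=> j j' /(congr1 (fun x => nat_of_ord (val x).2)) /= /val_inj.
  rewrite -cardsT -(card_imset _ ei); apply: eq_card => i; rewrite !inE.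
  apply/eqP/imsetP => [ia|[j _ ->]//].
  have /andP[_ lt] := valP i; rewrite ia in lt.
  exists (Ordinal lt); rewrite ?inE//; apply: val_inj.
  by rewrite /= [LHS]surjective_pairing ia; congr pair; apply: val_inj.
have [|f [fi fN]] := @hall_matching J V (fun i => N (val i).1).
  move=> S; pose A := [set (val i).1 | i : J in S].
  have AI : A \subset I by apply/subsetP=> a /imsetP[i _ ->]; have /andP[] := valP i.
  have -> : \bigcup_(i in S) N (val i).1 = \bigcup_(a in A) N a.
    by rewrite [RHS]big_imset_idem //; apply: setUid.
  apply: leq_trans (H _ AI).
  rewrite -sum1_card (partition_big (fun i : J => (val i).1) (mem A)) /=; last first.
    by move=> i iS; apply/imsetP; exists i.
  apply: leq_sum => a aA; rewrite -(fiber a (subsetP AI _ aA)) sum1_card.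
  by apply/subset_leq_card/subsetP => i; rewrite !inE => /andP[].
exists (fun y => omap (fun i => (val i).1) [pick i | f i == y]); split.
  move=> y a; case: pickP => //= i /eqP <- [<-]; split; last exact: fN.
  by have /andP[] := valP i.
move=> a aI; rewrite -(fiber a aI) -(card_imset _ fi); apply: eq_card => y.
rewrite !inE; apply/eqP/imsetP => [|[i]].
  by case: pickP => //= i /eqP <- [e]; exists i; rewrite // inE e.
rewrite inE => /eqP ia ->; case: pickP => [j /eqP /fi ->|/(_ i)]; rewrite ?eqxx//=.
by rewrite ia.
Qed.

Lemma acq_tree (R : realType) (V : finType) (g : rel V) (r : V) (p : V -> V)
    (dep : V -> nat) (c : V -> option V) :
  irreflexive g -> p r = r ->
  (forall v, v != r -> g v (p v)) -> (forall v, v != r -> dep (p v) < dep v) ->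
  (forall y a, c y = Some a -> g y a) -> (forall y a, c y = Some a -> c a = None) ->
  monotone_to_root r p (supplied c) ->
  frac_acq_number R g 1 /\ unit_acq_number g 1.
Proof.
move=> gi pr pe pd ce ct mono; apply: (@acq_numbers_one _ _ R r) => //.
have rs := reach_supplied ce ct.
have := reach_root pr pe pd mono; rewrite (unit_reach_sum gi rs) sum1_card.
exact: rt_trans.
Qed.

Section Least.
(** The value is [m] when no [i < m] satisfies [P]; the depth function of the tree relies on this
    default. *)
Definition least (P : pred nat) (m : nat) : nat := find P (iota 0 m).

Lemma least_le (P : pred nat) m : least P m <= m.
Proof. by rewrite -[leqRHS](size_iota 0) find_size. Qed.

Lemma least_min (P : pred nat) m i : i < least P m -> ~~ P i.
Proof.
move=> im; have := before_find 0 im; rewrite nth_iota ?add0n => [->//|].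
exact: leq_trans im (least_le _ _).
Qed.

Lemma least_P (P : pred nat) m i : i < m -> P i -> P (least P m).
Proof.
move=> im Pi; have hP : has P (iota 0 m) by apply/hasP; exists i; rewrite // mem_iota add0n.
have := nth_find 0 hP; rewrite nth_iota ?add0n//.
by move: hP; rewrite has_find size_iota.
Qed.

Lemma least_leP (P : pred nat) m i : P i -> least P m <= i.
Proof. by move=> Pi; rewrite leqNgt; apply/negP=> /least_min; rewrite Pi. Qed.
End Least.

Lemma subset_between (T : finType) (A B : {set T}) k :
  A \subset B -> #|A| <= k <= #|B| -> exists C : {set T}, [/\ A \subset C, C \subset B & #|C| = k].
Proof.
move=> AB /andP[Ak kB].
have [m] := ubnP (k - #|A|); elim: m A AB Ak => [//|m IH] A AB Ak dm.
have [e|lt] := leqP k #|A|; first by exists A; split=> //; apply/eqP; rewrite eqn_leq Ak.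
have /properP[_ [x xB xA]] : A \proper B by rewrite properEcard AB (leq_trans lt kB).
have cxA : #|x |: A| = #|A|.+1 by rewrite cardsU1 xA.
have [|||C [C1 C2 C3]] := IH (x |: A); rewrite ?cxA//.
- by rewrite subUset sub1set xB.
- by lia.
by exists C; split=> //; apply: subset_trans C1; apply: subsetUr.
Qed.

(** * Target weights decreasing with the depth *)

Section Weights.
Variables (V : finType) (r : V) (O : {set V}) (p : V -> V) (dep : V -> nat).
Variables (d1 d2 Lm : nat).
Hypothesis rO : r \in O.
Hypothesis pO : forall v, v \in O -> p v \in O.
Hypothesis p_root : p r = r.
Hypothesis dep_root : dep r = 0.
Hypothesis p_dep : forall v, v \in O -> v != r -> dep (p v) < dep v.
Hypothesis depL : forall v, v \in O -> dep v <= Lm.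
Hypothesis d2L : d2 <= Lm.
Hypothesis d12 : d1 <= d2.

Definition deep : {set V} := [set v in O | d2 < dep v].
(* Ancestor-closed set of the vertices that are close to the root or have a deep
   descendant. *)
Definition exceptional : {set V} :=
  [set v in O | dep v <= d1] :|: \bigcup_(i < (d2 - d1).+2) [set iter i p v | v in deep].

(** Two reference depths: the full height [Lm] only where it cannot be avoided, [d2] elsewhere. The
    2 keeps every weight on [O] above the single unit of a vertex that receives nothing. *)
Definition weight (v : V) : nat := (if v \in exceptional then Lm else d2).+2 - dep v.

Lemma iter_dep i v : v \in O -> iter i p v \in O /\ dep (iter i p v) <= dep v - i.
Proof.
move=> vO; elim: i => [|i [iO IH]]; first by rewrite subn0.
rewrite iterS; split; first exact: pO.
have [->|ir] := eqVneq (iter i p v) r; first by rewrite p_root dep_root.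
by have := p_dep iO ir; lia.
Qed.

Lemma card_exceptional :
  #|exceptional| <= #|[set v in O | dep v <= d1]| + (d2 - d1).+2 * #|deep|.
Proof.
apply: leq_trans (leq_card_setU _ _) _; rewrite leq_add2l.
apply: leq_trans (_ : \sum_(i < (d2 - d1).+2) #|deep| <= _); last by rewrite sum_nat_const card_ord.
elim/big_ind2: _ => [|A m B k Am Bk|i _]; first by rewrite cards0.
  by apply: leq_trans (leq_card_setU _ _) _; apply: leq_add.
exact: leq_imset_card.
Qed.

(** A bounded number of ancestors per deep vertex suffices for closure. After the last one counted,
    either the parent of the deep vertex is deep too and covers the next ancestor, or that parent
    has depth at most [d2] and the next ancestor has depth at most [d1]. *)
Lemma exceptional_parent v : v \in exceptional -> p v \in exceptional.
Proof.
rewrite !inE => /orP[/andP[vO vd]|/bigcupP[i _ /imsetP[u uD ->]]].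
  apply/orP; left; rewrite pO//=.
  have [->|vr] := eqVneq v r; first by rewrite p_root dep_root.
  by apply: leq_trans vd; apply/ltnW/p_dep.
have uO : u \in O by move: uD; rewrite inE => /andP[].
have [lti|gei] := ltnP i.+1 (d2 - d1).+2.
  apply/orP; right; apply/bigcupP; exists (Ordinal lti) => //.
  by apply/imsetP; exists u.
rewrite -iterS iterSr.
have [pD|pD] := boolP (p u \in deep).
  apply/orP; right; apply/bigcupP; exists i => //.
  by apply/imsetP; exists (p u).
apply/orP; left.
have [iO id] := iter_dep i (pO uO); rewrite iO /=.
have : dep (p u) <= d2 by move: pD; rewrite inE pO //= -leqNgt.
by move: (ltn_ord i); lia.
Qed.

Lemma weight_parent v : v \in O -> v != r -> weight v < weight (p v).
Proof.
move=> vO vr; rewrite /weight; have d := p_dep vO vr.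
have := exceptional_parent (v := v); have := depL vO.
have [vE dL /(_ isT) ->|vE dL _] := boolP (v \in exceptional); first by lia.
have dv : dep v <= d2.
  rewrite leqNgt; apply: contra vE => dv; rewrite inE; apply/orP; right.
  by apply/bigcupP; exists ord0 => //; apply/imsetP; exists v; rewrite // inE vO.
by case: ifP => _; lia.
Qed.

Lemma weight_ge2 v : v \in O -> 2 <= weight v.
Proof.
move=> vO; rewrite /weight; have := depL vO.
have [vE|vE] := boolP (v \in exceptional); first by lia.
have : dep v <= d2.
  rewrite leqNgt; apply: contra vE => dv; rewrite inE; apply/orP; right.
  by apply/bigcupP; exists ord0 => //; apply/imsetP; exists v; rewrite // inE vO.
by lia.
Qed.

(** One unit is the vertex's own and the rest is its demand. A vertex that is not exceptional has
    depth beyond [d1], so only the window from [d1] to [d2] counts. *)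
Lemma weight_le v : v \in O ->
  weight v - 1 <= (d2 - d1) + (v \in exceptional) * Lm.+1.
Proof.
move=> vO; rewrite /weight; case: ifP => vE; first by lia.
have : d1 < dep v.
  by move: vE; rewrite inE => /negbT; rewrite negb_or inE vO /= -ltnNge => /andP[].
by lia.
Qed.

End Weights.

(** * A shallow tree in an expanding graph *)

Section Core.
Variables (V : finType) (g0 : rel V).
Hypothesis g0_sym : symmetric g0.

Definition nbrs (S : {set V}) : {set V} := [set x | [exists y, (y \in S) && g0 y x]].

Lemma nbrsP (S : {set V}) x : reflect (exists2 y, y \in S & g0 y x) (x \in nbrs S).
Proof.
rewrite inE; apply: (iffP existsP) => [[y /andP[]]|[y yS gy]]; exists y => //.
by rewrite yS.
Qed.

Lemma nbrsS (S T : {set V}) : S \subset T -> nbrs S \subset nbrs T.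
Proof.
by move=> /subsetP ST; apply/subsetP=> x /nbrsP[y /ST yT gy]; apply/nbrsP; exists y.
Qed.

Lemma nbrs_bigcup (S T : {set V}) : \bigcup_(a in S) (nbrs [set a] :&: T) = nbrs S :&: T.
Proof.
apply/setP=> x; rewrite inE; apply/bigcupP/andP => [[a aS]|[/nbrsP[a aS ga] xT]].
  rewrite inE => /andP[/nbrsP[b]]; rewrite inE => /eqP -> ga ->; split=> //.
  by apply/nbrsP; exists a.
by exists a; rewrite // inE xT andbT; apply/nbrsP; exists a; rewrite ?inE.
Qed.

Variables (A0 O : {set V}) (q n2 Rm : nat) (r : V).
Hypothesis A0O : A0 \subset O.
Hypothesis rA0 : r \in A0.
Hypothesis q_gt1 : 1 < q.
Hypothesis n2_gt1 : 1 < n2.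
Hypothesis qRm : n2 < q ^ Rm.
Hypothesis expand : forall S : {set V}, S \subset O ->
  #|S :|: (nbrs S :&: A0)| <= n2 -> q * #|S| <= #|S :|: (nbrs S :&: A0)|.
Hypothesis joined : forall X Z : {set V}, [disjoint X & Z] ->
  n2 <= #|X| -> n2 <= #|Z| -> exists2 x, x \in X & exists2 z, z \in Z & g0 x z.

Definition grow (S : {set V}) : {set V} := S :|: (nbrs S :&: A0).

Lemma grow_sub S i j : i <= j -> iter i grow S \subset iter j grow S.
Proof.
move=> ij; rewrite -(subnK ij) iterD; elim: (j - i) => [//|k IH].
by rewrite iterS; apply: subset_trans IH (subsetUl _ _).
Qed.

Lemma grow_A0 (S : {set V}) i : S \subset A0 -> iter i grow S \subset A0.
Proof.
by move=> SA; elim: i => [//|i IH]; rewrite iterS subUset IH subsetIr.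
Qed.

Definition ball i := iter i grow [set r].

Lemma ball_A0 i : ball i \subset A0.
Proof. by apply: grow_A0; rewrite sub1set. Qed.

Lemma ball_grow i : #|ball i.+1| <= n2 -> q * #|ball i| <= #|ball i.+1|.
Proof.
by rewrite /ball iterS => h; apply: expand => //; apply: subset_trans A0O; apply: ball_A0.
Qed.

Lemma ball_pow i j : #|ball (i + j)| <= n2 -> #|ball i| * q ^ j <= #|ball (i + j)|.
Proof.
elim: j => [|j IH]; first by rewrite addn0 muln1.
rewrite addnS => h; apply: leq_trans (ball_grow h).
rewrite expnSr mulnA mulnC leq_mul2l; apply/orP; right; apply: IH.
by apply: leq_trans h; apply/subset_leq_card/grow_sub.
Qed.

Lemma ball_large : exists2 R, 0 < R <= Rm &
  n2 <= #|ball R| /\ #|ball R.-1| < n2.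
Proof.
have ex : exists i, n2 <= #|ball i|.
  exists Rm; apply: contraT; rewrite -ltnNge => lt.
  have := @ball_pow 0 Rm; rewrite add0n cards1 mul1n => /(_ (ltnW lt)) le.
  by move: (leq_trans qRm le); rewrite ltnNge ltnW.
case: (ex_minnP ex) => R R1 R2; exists R.
  apply/andP; split.
    by case: R R1 {R2} => //; rewrite cards1 leqNgt n2_gt1.
  apply: R2; apply: contraT; rewrite -ltnNge => lt.
  have := @ball_pow 0 Rm; rewrite add0n cards1 mul1n => /(_ (ltnW lt)) le.
  by move: (leq_trans qRm le); rewrite ltnNge ltnW.
split=> //; rewrite ltnNge; apply/negP=> /R2.
by case: R R1 {R2} => [|R _ /=]; [rewrite cards1 leqNgt n2_gt1 | rewrite ltnn].
Qed.

(* The tree: BFS balls around [r] inside [A0] up to a set [C] of [n2] vertices, then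
   layers around [C]; the set [far j] of the vertices beyond layer [j] shrinks geometrically. *)
Lemma core_tree : exists (p : V -> V) (dep : V -> nat) (R : nat) (C : {set V}) (far : nat -> {set V}),
  [/\ 0 < R <= Rm, #|C| = n2, C \subset A0 & r \in C] /\
  [/\ p r = r, dep r = 0, forall v, v \in O -> p v \in A0,
      forall v, v \in O -> v != r -> g0 v (p v) /\ dep (p v) < dep v
    & forall v, v \in O -> dep v <= R + Rm.+1] /\
  [/\ forall v, v \in O -> v \notin far 0 -> p v \in C,
      forall j v, v \in O -> R.+1 + j < dep v -> v \in far j,
      forall i v, v \in O -> i < R -> dep v <= i -> v \in ball i
    & forall j, #|far j| * q ^ j <= n2] /\
  forall j, #|ball (R.-1 - j)| * q ^ minn j R.-1 <= n2.
Proof.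
have [R R0 [R1 R2]] := ball_large.
(* Containing [ball R.-1] keeps the search parents of vertices of [C] inside [C]; the exact size
   [n2] caps the number of inner vertices even if [ball R] is much larger. *)
have [C [C1 C2 C3]] : exists C : {set V}, [/\ ball R.-1 \subset C, C \subset ball R & #|C| = n2].
  by apply: subset_between; [apply: grow_sub; apply: leq_pred | rewrite ltnW].
have CA0 : C \subset A0 by apply: subset_trans C2 (ball_A0 _).
pose K j := iter j grow C.
pose far j := O :\: (C :|: nbrs (K j)).
have farS i j : i <= j -> far j \subset far i.
  by move=> ij; apply/setDS/setUS/nbrsS/grow_sub.
have KA0 j : K j \subset A0 by exact: grow_A0.
have far0 : #|far 0| <= n2.
  rewrite leqNgt; apply/negP=> lt.
  have [|||x xC [z]] := @joined C (far 0); rewrite ?C3 ?(ltnW lt)//.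
    by apply/pred0P=> x; rewrite !inE; case: (x \in C).
  rewrite in_setD in_setU negb_or => /andP[/andP[_ /negP zN] _] gxz; apply: zN.
  by apply/nbrsP; exists x.
(* Expansion is applied to the vertices not yet reached: a vertex of [A0] adjacent to [far j.+1]
   lies outside [K j.+1], hence in [far j]. *)
have far_expand j : q * #|far j.+1| <= #|far j|.
  have sub : far j.+1 :|: (nbrs (far j.+1) :&: A0) \subset far j.
    rewrite subUset farS//=; apply/subsetP=> x; rewrite in_setI => /andP[/nbrsP[y yf gyx] xA].
    have xK : x \notin K j.+1.
      apply/negP=> xK; move: yf; rewrite in_setD => /andP[/negP yf _]; apply: yf.
      by rewrite in_setU; apply/orP; right; apply/nbrsP; exists x; rewrite // g0_sym.
    rewrite in_setD in_setU (subsetP A0O _ xA) andbT negb_or; apply/andP; split; apply: contra xK.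
      by apply/subsetP; apply: (@grow_sub C 0 j.+1).
    by move=> xN; rewrite /K iterS inE; apply/orP; right; rewrite inE xN xA.
  have farn : #|far j| <= n2 by apply: leq_trans far0; apply/subset_leq_card/farS.
  apply: leq_trans (subset_leq_card sub); apply: expand.
    by apply/subsetP=> x; rewrite inE => /andP[].
  exact: leq_trans (subset_leq_card sub) farn.
have far_pow j : #|far j| * q ^ j <= n2.
  elim: j => [|j IH]; first by rewrite muln1.
  by apply: leq_trans IH; rewrite expnS mulnA leq_mul2r mulnC far_expand orbT.
have far_Rm : far Rm = set0.
  apply/eqP; rewrite -cards_eq0 -leqn0 leqNgt; apply/negP=> pos.
  by have := far_pow Rm; apply/negP; rewrite -ltnNge; apply: leq_trans qRm _; apply: leq_pmull.
(* Both defaults of [least] are correct values, since [C] lies in [ball R] and [far Rm] is empty.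
   The offset [R.+1] places everything outside [C] deeper than all of [C]. *)
pose dep v := if v \in C then least (fun i => v \in ball i) R
              else R.+1 + least (fun j => v \notin far j) Rm.
have depC v : v \in C -> dep v <= R by rewrite /dep => ->; apply: least_le.
have depC_ball v : v \in C -> v \in ball (dep v).
  move=> vC; have vR : v \in ball R by apply: (subsetP C2).
  rewrite /dep vC; set l := least _ _.
  have [lt|ge] := ltnP l R; last first.
    by have -> : l = R by apply/eqP; rewrite eqn_leq least_le.
  have [//|vl] := boolP (v \in ball l).
  have : has (fun i => v \in ball i) (iota 0 R).
    by rewrite has_find size_iota.
  case/hasP => i; rewrite mem_iota add0n => /andP[_ iR] vi.
  by have := @least_P (fun i => v \in ball i) R i iR vi; rewrite -/l (negPf vl).
have depC_min v i : v \in C -> v \in ball i -> dep v <= i.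
  by move=> vC vi; rewrite /dep vC; apply: (@least_leP (fun i => v \in ball i)).
have dep_far v : v \in O -> v \notin C -> v \notin far (dep v - R.+1).
  move=> vO vC; rewrite /dep (negPf vC) addKn; set l := least _ _.
  have [lt|ge] := ltnP l Rm; last first.
    by have -> : l = Rm; [apply/eqP; rewrite eqn_leq least_le | rewrite far_Rm inE].
  have [//|vl] := boolP (v \notin far l).
  have : has (fun j => v \notin far j) (iota 0 Rm) by rewrite has_find size_iota.
  case/hasP => i; rewrite mem_iota add0n => /andP[_ iR] vi.
  by have := @least_P (fun j => v \notin far j) Rm i iR vi; rewrite -/l (negPf vl).
have K_far j u : u \in K j -> u \notin C -> exists2 i, j = i.+1 & u \notin far i.
  move=> + uC; elim: j => [uK|j IH]; first by rewrite uK in uC.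
  rewrite /K iterS in_setU => /orP[/IH[i -> uf]|].
    by exists i.+1 => //; apply: contra uf; apply/subsetP/farS.
  by rewrite in_setI => /andP[uN _]; exists j => //; rewrite in_setD in_setU uN orbT.
have par v : exists u, v \in O -> v != r ->
    [/\ u \in A0, g0 v u, dep u < dep v & v \notin far 0 -> u \in C].
  have [vO|] := boolP (v \in O); last by exists r.
  have [->|vr] := eqVneq v r; first by exists r.
  have [vC|vC] := boolP (v \in C).
    have vb := depC_ball _ vC.
    case e : (dep v) => [|d]; first by rewrite e inE (negPf vr) in vb.
    rewrite e /ball iterS in_setU in vb.
    case/orP: vb => [vb|]; first by have := depC_min _ _ vC vb; rewrite e ltnn.
    rewrite in_setI => /andP[/nbrsP[u ub guv] vA].
    have uC : u \in C.
      apply: (subsetP C1); apply: (subsetP (grow_sub _ (_ : d <= R.-1))) ub.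
      by rewrite -ltnS prednK -?e ?depC//; case/andP: R0.
    exists u => _ _; split=> //; first exact: (subsetP CA0).
      by rewrite g0_sym.
    by rewrite ltnS; apply: depC_min.
  have := dep_far _ vO vC; set j := dep v - R.+1.
  rewrite in_setD in_setU vO andbT negbK (negPf vC) /= => /nbrsP[u uK guv].
  have uA : u \in A0 by apply: (subsetP (KA0 j)).
  have dv : dep v = R.+1 + j by rewrite /j /dep (negPf vC) addKn.
  exists u => _ _; rewrite g0_sym guv dv; split=> //.
    have [uC|uC] := boolP (u \in C).
      by apply: leq_trans (leq_addr _ _); rewrite ltnS depC.
    have [i -> uf] := K_far _ _ uK uC.
    rewrite /dep (negPf uC) ltn_add2l ltnS; exact: (@least_leP (fun j => u \notin far j)).
  move=> v0; have j0 : j = 0.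
    by apply/eqP; rewrite -leqn0 /j /dep (negPf vC) addKn; apply: (@least_leP (fun j => v \notin far j)).
  by move: uK; rewrite j0.
have [p0 p0P] := fin_all_exists par.
pose p v := if v == r then r else p0 v.
have rC : r \in C by apply: (subsetP C1); apply: (subsetP (@grow_sub _ 0 _ (leq0n _))); rewrite inE.
exists p, dep, R, C, far; split; first by [].
split.
  split.
  - by rewrite /p eqxx.
  - by apply/eqP; rewrite -leqn0; apply: depC_min; rewrite // inE.
  - move=> v vO; rewrite /p; case: eqP => // /eqP vr.
    by have [] := p0P v vO vr.
  - move=> v vO vr; rewrite /p (negPf vr).
    by have [] := p0P v vO vr.
  - move=> v vO; have [vC|vC] := boolP (v \in C); first by have := depC _ vC; lia.
    by rewrite /dep (negPf vC) addSnnS leq_add2l ltnS least_le.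
split; last first.
  move=> j; have [jR|Rj] := leqP j R.-1.
    have := @ball_pow (R.-1 - j) j; rewrite subnK// => h.
    by apply: leq_trans (h (ltnW R2)) (ltnW R2).
  have -> : R.-1 - j = 0 by lia.
  have := @ball_pow 0 R.-1; rewrite add0n => h.
  by apply: leq_trans (h (ltnW R2)) (ltnW R2).
split=> //.
- move=> v vO vf; rewrite /p; case: eqP => // /eqP vr.
  by have [_ _ _] := p0P v vO vr; apply.
- move=> j v vO; have [vC|vC] := boolP (v \in C).
    by have := depC _ vC => ? ?; exfalso; lia.
  rewrite {1}/dep (negPf vC) ltn_add2l => /least_min.
  by rewrite negbK.
- move=> i v vO iR; have [vC|vC] := boolP (v \in C).
    by move=> di; apply: (subsetP (grow_sub _ di)); apply: depC_ball.
  by rewrite /dep (negPf vC) => ?; exfalso; lia.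
Qed.

End Core.

(** * From expansion to acquisition number 1 *)

Section CoreAcquisition.
Variables (R : realType) (V : finType) (g0 g : rel V).
Variables (A0 Y L0 : {set V}) (f : V -> V) (q n2 n3 Rm j0 : nat) (r : V).
Hypothesis g_irr : irreflexive g.
Hypothesis g0_sym : symmetric g0.
Hypothesis g0g : forall x y, g0 x y -> g x y.
Hypothesis A0L0 : A0 \subset ~: L0.
Hypothesis A0Y : [disjoint A0 & Y].
Hypothesis fP : forall l, l \in L0 -> [/\ f l \notin L0, f l \notin Y & g l (f l)].
Hypothesis rA0 : r \in A0.
Hypothesis q_gt1 : 1 < q.
Hypothesis n2_gt1 : 1 < n2.
Hypothesis qRm : n2 < q ^ Rm.
Hypothesis j0Rm : j0 <= Rm.
Hypothesis qj0 : q ^ j0 <= n2.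
Hypothesis n3_large : (2 * Rm + 2) * ((2 * j0 + 5) * n2) <= n3 * q ^ j0.
Hypothesis expandA : forall S : {set V}, S \subset ~: L0 ->
  #|S :|: (nbrs g0 S :&: A0)| <= n2 -> q * #|S| <= #|S :|: (nbrs g0 S :&: A0)|.
Hypothesis joined : forall X Z : {set V}, [disjoint X & Z] ->
  n2 <= #|X| -> n2 <= #|Z| -> exists2 x, x \in X & exists2 z, z \in Z & g0 x z.
Hypothesis expand_small : forall S : {set V}, S \subset A0 -> #|S| <= n3 ->
  (2 * j0 + 2 + (2 * Rm + 2)) * #|S| <= #|nbrs g0 S :&: Y|.
Hypothesis expand_mid : forall S : {set V}, S \subset A0 -> (2 * j0 + 4) * #|S| <= n2 ->
  (2 * j0 + 3) * #|S| <= #|nbrs g0 S :&: Y|.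
Hypothesis expand_large : forall S : {set V}, S \subset A0 -> n2 < (2 * j0 + 4) * #|S| ->
  (2 * j0 + 2) * (2 * n2) + n3 <= #|nbrs g0 S :&: Y|.

Lemma core_acquisition : frac_acq_number R g 1 /\ unit_acq_number g 1.
Proof.
have [p0 [dep [Rb [C [far [[R0 cC CA0 rC] [tree [layers balls]]]]]]]] :=
  core_tree g0_sym A0L0 rA0 q_gt1 n2_gt1 qRm expandA joined.
case: tree => p0r depr p0A p0P depL; case: layers => parC far_deep ball_dep far_pow.
(* [d1] and [d2] lie [j0] levels on either side of the boundary of [C], where the layers have shrunk
   by [q ^ j0]. [Lm] bounds all depths because [Rb <= Rm]. *)
pose O := ~: L0; pose d1 := Rb.-1 - j0; pose d2 := Rb.+1 + j0; pose Lm := 2 * Rm + 1.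
have rO : r \in O := subsetP A0L0 _ rA0.
have p0O v : v \in O -> p0 v \in O by move=> /p0A /(subsetP A0L0).
have p0d v : v \in O -> v != r -> dep (p0 v) < dep v by move=> vO /(p0P v vO)[].
have depLm v : v \in O -> dep v <= Lm by move=> /depL; rewrite /Lm; lia.
have d2Lm : d2 <= Lm by rewrite /d2 /Lm; lia.
have d21 : d2 - d1 <= 2 * j0 + 2 by rewrite /d2 /d1; lia.
have d12 : d1 <= d2 by rewrite /d1 /d2; lia.
pose Ex := exceptional O p0 dep d1 d2; pose W := weight O p0 dep d1 d2 Lm.
have W_parent v : v \in O -> v != r -> W v < W (p0 v).
  exact: (weight_parent rO p0O p0r depr p0d depLm d2Lm d12).
have W2 v : v \in O -> 2 <= W v by exact: (weight_ge2 _ rO depr depLm d2Lm d12).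
have W_le v : v \in O -> W v - 1 <= (2 * j0 + 2) + (v \in Ex) * (2 * Rm + 2).
  move=> vO; apply: leq_trans (weight_le _ rO depr d2Lm d12 vO) _; apply: leq_add => //.
  by rewrite leq_mul2l /Lm; apply/orP; right; lia.
have cEx : (2 * Rm + 2) * #|Ex| <= n3.
  have cE : #|Ex| <= #|[set v in O | dep v <= d1]| + (2 * j0 + 4) * #|deep O dep d2|.
    apply: leq_trans (card_exceptional _ _ _ _ _) _.
    by rewrite leq_add2l leq_mul2r; apply/orP; right; lia.
  have cB : #|[set v in O | dep v <= d1]| <= #|ball g0 A0 r d1|.
    apply/subset_leq_card/subsetP => v; rewrite inE => /andP[vO vd].
    by apply: ball_dep => //; rewrite /d1; lia.
  have cD : #|deep O dep d2| <= #|far j0|.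
    by apply/subset_leq_card/subsetP => v; rewrite inE => /andP[vO]; apply: far_deep.
  have cBq : #|ball g0 A0 r d1| * q ^ j0 <= n2.
    have [jR|Rj] := leqP j0 Rb.-1.
      by have := balls j0; rewrite (minn_idPl jR).
    (* Here the subtraction truncates and the ball is the root alone; [qj0] replaces the growth of
       the balls. *)
    by rewrite /d1; have -> : Rb.-1 - j0 = 0 by [lia]; rewrite cards1 mul1n.
  have cDq := far_pow j0.
  have q0 : 0 < q ^ j0 by rewrite expn_gt0 (ltnW q_gt1).
  rewrite -(leq_pmul2r q0); apply: leq_trans n3_large.
  rewrite -mulnA leq_mul2l; apply/orP; right.
  apply: leq_trans (_ : (#|ball g0 A0 r d1| + (2 * j0 + 4) * #|far j0|) * q ^ j0 <= _).
    by rewrite leq_mul2r; apply/orP; right; nia.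
  by rewrite mulnDl -mulnA; nia.
pose I := [set p0 v | v in O].
have IA0 : I \subset A0 by apply/subsetP=> _ /imsetP[v vO ->]; apply: p0A.
have IO v : v \in I -> v \in O by move=> /(subsetP IA0) /(subsetP A0L0).
(* Vertices next to [C] have their parent in [C], and each of the at most [n2] others adds at most
   one parent. *)
have cI : #|I| <= 2 * n2.
  apply: leq_trans (_ : #|C :|: [set p0 v | v in far 0]| <= _).
    apply/subset_leq_card/subsetP => _ /imsetP[v vO ->]; rewrite inE.
    have [vf|vf] := boolP (v \in far 0); last by rewrite parC.
    by apply/orP; right; apply/imsetP; exists v.
  apply: leq_trans (leq_card_setU _ _) _; rewrite cC mul2n -addnn leq_add2l.
  by apply: leq_trans (leq_imset_card _ _) _; have := far_pow 0; rewrite muln1.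
have [|c [cP cI']] := @hall_demand V (fun a => nbrs g0 [set a] :&: Y) (fun a => W a - 1) I.
  move=> S SI; rewrite nbrs_bigcup.
  have SA0 := subset_trans SI IA0.
  have le : \sum_(a in S) (W a - 1) <= (2 * j0 + 2) * #|S| + (2 * Rm + 2) * #|S :&: Ex|.
    apply: leq_trans (_ : \sum_(a in S) (2 * j0 + 2 + (a \in Ex) * (2 * Rm + 2)) <= _).
      by apply: leq_sum => a /(subsetP SI) /IO /W_le.
    rewrite big_split /= sum_nat_const mulnC leq_add2l -big_distrl /= mulnC leq_mul2l.
    apply/orP; right; rewrite -sum1_card big_mkcond /= [leqRHS]big_mkcond /=.
    by apply: leq_sum => a _; rewrite in_setI; case: (a \in S); case: (a \in Ex).
  apply: leq_trans le _.
  have le1 : #|S :&: Ex| <= #|S| by apply/subset_leq_card/subsetIl.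
  have le2 : #|S :&: Ex| <= #|Ex| by apply/subset_leq_card/subsetIr.
  (* Three ranges. A small [S] may be exceptional throughout and needs the strongest expansion.
     Beyond [n3] the exceptional demand is less than one unit per vertex of [S]. A large [S] sees
     almost all of [Y], more than the total demand. *)
  have [s3|s3] := leqP #|S| n3.
    apply: leq_trans (expand_small SA0 s3).
    by rewrite [leqRHS]mulnDl leq_add2l leq_mul2l le1 orbT.
  have le3 : (2 * Rm + 2) * #|S :&: Ex| <= n3.
    by apply: leq_trans cEx; rewrite leq_mul2l le2 orbT.
  have [s2|s2] := leqP ((2 * j0 + 4) * #|S|) n2.
    apply: leq_trans (expand_mid SA0 s2).
    apply: leq_trans (_ : (2 * j0 + 2) * #|S| + #|S| <= _); last by rewrite -mulSnr -addnS.
    by rewrite leq_add2l; apply: leq_trans le3 (ltnW s3).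
  apply: leq_trans (expand_large SA0 s2); apply: leq_add => //.
  rewrite leq_mul2l; apply/orP; right.
  exact: leq_trans (subset_leq_card SI) cI.
have cN a : a \notin Y -> c a = None.
  by move=> aY; case e: (c a) => [b|//]; have [_] := cP _ _ e; rewrite inE (negPf aY) andbF.
have A0Y' a : a \in A0 -> a \notin Y by move=> aA; rewrite (disjointFr A0Y aA).
have supI a : a \in I -> supplied c a = W a.
  move=> aI; rewrite /supplied cN ?A0Y' ?(subsetP IA0)//= cI'//.
  by have := W2 a (IO _ aI); lia.
have supN a : a \notin I -> supplied c a <= 1.
  move=> aI; rewrite /supplied; case: (c a) => //=.
  rewrite ltnS leqn0 cards_eq0; apply/eqP/setP=> y; rewrite !inE.
  by apply/negP=> /eqP /cP[]; rewrite (negPf aI).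
have supY a : a \notin Y -> 0 < supplied c a by move=> aY; rewrite /supplied cN.
pose p v := if v \in L0 then f v else p0 v.
have OL v : (v \in O) = (v \notin L0) by rewrite inE.
have p0I v : v \in O -> p0 v \in I by move=> vO; apply/imsetP; exists v.
have le_parent v : v \in O -> v != r -> supplied c v < supplied c (p0 v).
  move=> vO vr; rewrite (supI _ (p0I _ vO)).
  have [vI|vI] := boolP (v \in I); first by rewrite supI// W_parent.
  by apply: leq_ltn_trans (supN _ vI) (W2 _ (p0O _ vO)).
apply: (@acq_tree R V g r p (fun v => if v \in L0 then (dep (f v)).+1 else dep v) c) => //.
- by rewrite /p -[_ \in _]negbK -OL rO.
- move=> v vr; rewrite /p; case: ifP => vL; first by have [] := fP vL.
  by apply: g0g; have [] := p0P v _ vr; rewrite // OL vL.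
- move=> v vr; rewrite /p; have [vL|vL] := boolP (v \in L0).
    by have [/negPf -> _ _] := fP vL.
  have vO : v \in O by rewrite OL vL.
  by have := p0O _ vO; rewrite OL => /negPf ->; apply: p0d.
- move=> y a /cP[_]; rewrite inE => /andP[/nbrsP[b]]; rewrite inE => /eqP -> gay _.
  by apply: g0g; rewrite g0_sym.
- by move=> y a /cP[aI _]; apply: cN; apply/A0Y'/(subsetP IA0).
(* A vertex of [L0] weighs at most 1, and its parent has kept its own unit because it lies outside
   [Y]. Inside the tree, parents strictly outweigh their children. *)
move=> v vr v0; rewrite /p; case: ifP => vL.
  have [fL fY _] := fP vL.
  have vI : v \notin I by apply: contraL vL => /IO; rewrite OL.
  split; first exact: leq_trans (supN _ vI) (supY _ fY).
  by move=> fr; rewrite (negPf fL); apply: le_parent; rewrite ?OL.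
have vO : v \in O by rewrite OL vL.
split; first by apply/ltnW/le_parent.
move=> pr; have pO := p0O _ vO.
by move: (pO); rewrite OL => /negPf ->; apply: le_parent.
Qed.

End CoreAcquisition.

(** * Expansion from sparsity and minimum degree *)

Section Structure.
Variables (R : realType) (V : finType) (g0 g : rel V) (A : {set V}).
Variables (D d q s n1 n2 n3 n4 Rm j0 : nat).

(** For a simple graph, twice the number of edges spanned by [S]. *)
Definition volume (S : {set V}) : nat := \sum_(v in S) #|nbrs g0 [set v] :&: S|.

Definition low_degree (Q : {set V}) : {set V} := [set v | #|nbrs g0 [set v] :&: Q| < D].

Let L0 := low_degree A.
Let L1 := low_degree (~: A).

Hypothesis g_sym : symmetric g.
Hypothesis g_irr : irreflexive g.
Hypothesis g_conn : Defs.connected g.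
Hypothesis g0_sym : symmetric g0.
Hypothesis g0g : forall x y, g0 x y -> g x y.
Hypothesis low_indep : forall l l', l \in L0 -> l' \in L0 -> ~~ g l l'.
Hypothesis few_low : forall v, #|nbrs g0 [set v] :&: L0| < 20 /\ #|nbrs g0 [set v] :&: L1| < 20.
Hypothesis low_far : forall l1 x1 v x2 l2, uniq [:: l1; x1; v; x2; l2] ->
  l1 \in L0 -> l2 \in L0 -> g l1 x1 -> g x1 v -> g v x2 -> g x2 l2 -> False.
Hypothesis sparse_small : forall S : {set V}, #|S| <= n1 -> volume S <= 8 * #|S|.
Hypothesis sparse_mid : forall S : {set V}, #|S| <= n2 -> volume S <= s * #|S|.
Hypothesis joined_mid : forall X Z : {set V}, [disjoint X & Z] ->
  n2 <= #|X| -> n2 <= #|Z| -> exists2 x, x \in X & exists2 z, z \in Z & g0 x z.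
Hypothesis joined_large : forall X Z : {set V}, [disjoint X & Z] ->
  n2 < (2 * j0 + 4) * #|X| -> n4 <= #|Z| -> exists2 x, x \in X & exists2 z, z \in Z & g0 x z.
Hypothesis dD : d + 40 <= D.
Hypothesis qd : q * s <= d.
Hypothesis s_gt0 : 0 < s.
Hypothesis dRm : 8 * (2 * j0 + 2 * Rm + 5) <= d.
Hypothesis n31 : (2 * j0 + 2 * Rm + 5) * n3 <= n1.
Hypothesis qj : 2 * j0 + 4 <= q.
Hypothesis n2_gt1 : 1 < n2.
Hypothesis qRm : n2 < q ^ Rm.
Hypothesis j0Rm : j0 <= Rm.
Hypothesis qj0 : q ^ j0 <= n2.
Hypothesis n3_large : (2 * Rm + 2) * ((2 * j0 + 5) * n2) <= n3 * q ^ j0.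
Hypothesis A'_large : 2 * n2 + n4 + (2 * j0 + 2) * (2 * n2) + n3 <= #|~: A|.

(** The candidates for inner vertices: they have many neighbours in [A] and can also draw on the
    minority. A vertex of [L1] outside [L0] still hangs from [A0], as a leaf. *)
Let A0 := A :\: (L0 :|: L1).

(** The [d] neighbours in [Q] of each vertex of [S] all fall in [T]. If [T] spans few edges per
    vertex, it must therefore be much larger than [S]: this is how sparsity yields expansion. *)
Lemma volume_ge (S Q T : {set V}) : (forall v, v \in S -> d <= #|nbrs g0 [set v] :&: Q|) ->
  T = S :|: (nbrs g0 S :&: Q) -> d * #|S| <= volume T.
Proof.
move=> dS eT.
have ST : S \subset T by rewrite eT subsetUl.
rewrite /volume (big_setID S) /= (setIidPr ST).
apply: leq_trans (leq_addr _ _); rewrite mulnC -sum_nat_const.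
apply: leq_sum => v vS; apply: leq_trans (dS _ vS) _.
apply/subset_leq_card/subsetP => x; rewrite in_setI => /andP[xv xQ].
rewrite in_setI xv eT in_setU in_setI xQ andbT; apply/orP; right.
by apply: (subsetP (nbrsS _ _)) xv; rewrite sub1set.
Qed.

(** An independent set of [2 * n2] vertices would contain two disjoint unjoined sets of size
    [n2]. *)
Lemma card_low_degree : #|L0| < 2 * n2.
Proof.
rewrite ltnNge; apply/negP=> big.
have [S [_ SL cS]] : exists S : {set V}, [/\ set0 \subset S, S \subset L0 & #|S| = n2].
  by apply: subset_between; rewrite ?sub0set ?cards0//=; lia.
have [||| x xS [z]] := @joined_mid S (L0 :\: S); rewrite ?cS//.
- by apply/pred0P=> x; rewrite !inE; case: (x \in S).
- by rewrite cardsD (setIidPr SL) cS; lia.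
rewrite inE => /andP[_ zL] gxz.
by move: (low_indep (subsetP SL _ xS) zL); rewrite (g0g gxz).
Qed.

(** The margin 40 between [d] and [D] absorbs the fewer than 20 neighbours in each of [L0] and
    [L1]. *)
Lemma degree_A0 v : v \notin L0 -> d <= #|nbrs g0 [set v] :&: A0|.
Proof.
rewrite inE -leqNgt => Dv; have [f0 f1] := few_low v.
have -> : nbrs g0 [set v] :&: A0 = (nbrs g0 [set v] :&: A) :\: (nbrs g0 [set v] :&: (L0 :|: L1)).
  by apply/setP=> x; rewrite !in_setI !in_setD !in_setI; case: (x \in nbrs _ _); rewrite ?andbF.
rewrite cardsD; set X := nbrs _ _ in Dv f0 f1 *.
have : #|(X :&: A) :&: (X :&: (L0 :|: L1))| <= #|X :&: L0| + #|X :&: L1|.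
  apply: leq_trans (leq_card_setU _ _); rewrite -setIUr; exact/subset_leq_card/subsetIr.
by lia.
Qed.

Lemma structure_acquisition : frac_acq_number R g 1 /\ unit_acq_number g 1.
Proof.
have cL0 := card_low_degree.
have q_gt1 : 1 < q by lia.
have d_gt0 : 0 < d by lia.
have [v0 v0L] : exists v, v \notin L0.
  have : 0 < #|~: L0|.
    have := cardsC L0; have := cardsC A; have := max_card (mem (~: A)).
    have : 2 * n2 <= #|~: A| by lia.
    by lia.
  by case/card_gt0P=> v; rewrite inE => vL; exists v.
have [r rA0] : exists r, r \in A0.
  have : 0 < #|nbrs g0 [set v0] :&: A0| by apply: leq_trans (degree_A0 v0L).
  by case/card_gt0P=> r; rewrite inE => /andP[_]; exists r.
have A0L0 : A0 \subset ~: L0.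
  by apply/subsetP=> x; rewrite in_setD in_setC in_setU negb_or => /andP[/andP[]].
(* Connectivity enters here: a low vertex has a neighbour in [g], though possibly none in [g0]. *)
have ex_f l : exists x, l \in L0 -> g l x.
  have [lL|] := boolP (l \in L0); last by exists r.
  have lr : l != r by apply: contraTneq lL => ->; move/subsetP/(_ _ rA0): A0L0; rewrite in_setC.
  have /connectP[[|x p] /=] : connect g l r by move/forallP/(_ l)/forallP/(_ r): g_conn.
    by move=> _ e; rewrite e eqxx in lr.
  by move=> /andP[glx _] _; exists x.
have [f0 f0P] := fin_all_exists ex_f.
have fL l : l \in L0 -> f0 l \notin L0.
  by move=> lL; apply/negP=> /(low_indep lL); rewrite f0P.
(* The parents of low vertices must keep their own unit, so they are withheld from the suppliers. *)
pose X := [set f0 l | l in L0]; pose Y := ~: A :\: X.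
have A0Y : [disjoint A0 & Y].
  by apply/pred0P=> x; rewrite /= !inE; case: (x \in A); rewrite ?andbF.
have degY a : a \in A0 -> d <= #|nbrs g0 [set a] :&: Y|.
  move=> aA; have [aL0 aL1] : a \notin L0 /\ a \notin L1.
    by move: aA; rewrite in_setD in_setU negb_or => /andP[/andP[]].
  have -> : nbrs g0 [set a] :&: Y = (nbrs g0 [set a] :&: ~: A) :\: (nbrs g0 [set a] :&: X).
    by apply/setP=> x; rewrite !in_setI !in_setD !in_setI; case: (x \in nbrs _ _); rewrite ?andbF.
  rewrite cardsD.
  (* Two neighbours of [a] in [X] would complete a path of length four between two low vertices,
     against [low_far]. *)
  have le1 : #|nbrs g0 [set a] :&: X| <= 1.
    rewrite leqNgt; apply/negP=> /card_gt1P[x1 [x2 []]].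
    rewrite !in_setI => /andP[n1a /imsetP[l1 l1L e1]] /andP[n2a /imsetP[l2 l2L e2]] x12.
    have ga x : x \in nbrs g0 [set a] -> g a x.
      by case/nbrsP=> b; rewrite inE => /eqP ->; apply: g0g.
    have ne x y : g x y -> x != y by apply: contraTneq => ->; rewrite g_irr.
    have neL x y : x \in L0 -> y \notin L0 -> x != y by move=> xL; apply: contraNneq => <-.
    apply: (low_far (l1 := l1) (x1 := x1) (v := a) (x2 := x2) (l2 := l2)) => //.
    - have x1L : x1 \notin L0 by rewrite e1 fL.
      have x2L : x2 \notin L0 by rewrite e2 fL.
      have l12 : l1 != l2 by apply: contraNneq x12 => e; rewrite e1 e2 e.
      have [q1 q2 q3] : [/\ l1 != x1, l1 != a & l1 != x2] by split; apply: neL.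
      have [q4 q5 q6] : [/\ x1 != l2, a != l2 & x2 != l2] by split; rewrite eq_sym; apply: neL.
      have q7 : x1 != a by rewrite eq_sym; apply/ne/ga.
      have q8 : a != x2 by apply/ne/ga.
      by rewrite /= !inE !negb_or q1 q2 q3 l12 q7 x12 q4 q8 q5 q6.
    - by rewrite e1 f0P.
    - by rewrite g_sym ga.
    - by rewrite ga.
    - by rewrite g_sym e2 f0P.
  have : #|nbrs g0 [set a] :&: ~: A :&: (nbrs g0 [set a] :&: X)| <= 1.
    by apply: leq_trans le1; apply/subset_leq_card/subsetIr.
  by move: aL1; rewrite inE -leqNgt; lia.
apply: (@core_acquisition R V g0 g A0 Y L0 f0 q n2 n3 Rm j0 r) => //.
- move=> l lL; split; rewrite ?fL ?f0P//.
  by rewrite inE negb_and negbK; apply/orP; left; apply/imsetP; exists l.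
- move=> S SL small; have := sparse_mid small.
  have := @volume_ge S A0 _ _ erefl => /(_ _)/leq_trans h /(h _) {h}.
  have dS v : v \in S -> d <= #|nbrs g0 [set v] :&: A0|.
    by move=> /(subsetP SL); rewrite in_setC; apply: degree_A0.
  move=> /(_ dS) le; rewrite -(leq_pmul2l s_gt0); apply: leq_trans le.
  by rewrite mulnA (mulnC s) leq_mul2r qd orbT.
- move=> S SA small; set T := nbrs g0 S :&: Y.
  have dS v : v \in S -> d <= #|nbrs g0 [set v] :&: Y| by move=> /(subsetP SA); apply: degY.
  have vol := volume_ge dS erefl; rewrite -/T in vol.
  have cU : #|S :|: T| <= #|S| + #|T| by apply: leq_card_setU.
  (* The factor is one more than required, to make up for [S] itself. If it were missed, [S :|: T]
     would be small enough for [sparse_small], against the volume forced by the degrees. *)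
  have [big|lt] := leqP ((2 * j0 + 2 * Rm + 5) * #|S|) #|S :|: T|; first by lia.
  have U1 : #|S :|: T| <= n1.
    apply: leq_trans (ltnW lt) _; apply: leq_trans n31.
    by rewrite leq_mul2l small orbT.
  have := leq_trans vol (sparse_small U1).
  have : 8 * (2 * j0 + 2 * Rm + 5) * #|S| <= d * #|S| by rewrite leq_mul2r dRm orbT.
  by lia.
- move=> S SA small; set T := nbrs g0 S :&: Y.
  have dS v : v \in S -> d <= #|nbrs g0 [set v] :&: Y| by move=> /(subsetP SA); apply: degY.
  have vol := volume_ge dS erefl; rewrite -/T in vol.
  have cU : #|S :|: T| <= #|S| + #|T| by apply: leq_card_setU.
  have [big|lt] := leqP ((2 * j0 + 4) * #|S|) #|S :|: T|; first by lia.
  have := leq_trans vol (sparse_mid (leq_trans (ltnW lt) small)) => le.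
  have : q * s * #|S| <= s * #|S :|: T|.
    by apply: leq_trans le; rewrite leq_mul2r qd orbT.
  rewrite (mulnC q) -mulnA leq_pmul2l// => le2.
  have : (2 * j0 + 4) * #|S| <= q * #|S| by rewrite leq_mul2r qj orbT.
  by lia.
- move=> S SA large.
  (* Vertices of [Y] without a neighbour in [S] form a set not joined to [S]; the withheld vertices
     are at most as many as the low ones. *)
  have lt : #|Y :\: nbrs g0 S| < n4.
    rewrite ltnNge; apply/negP=> n4le.
    have [|||x xS [z]] := @joined_large S (Y :\: nbrs g0 S) => //.
      apply/pred0P=> x; rewrite /=; apply/negP=> /andP[xS].
      by rewrite in_setD => /andP[_]; rewrite (disjointFr A0Y (subsetP SA _ xS)).
    rewrite in_setD => /andP[/negP zN _] gxz; apply: zN.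
    by apply/nbrsP; exists x.
  have cX : #|X| <= #|L0| by apply: leq_imset_card.
  have : #|~: A| <= #|Y| + #|X|.
    by rewrite -(cardsID X (~: A)) addnC leq_add2l; apply/subset_leq_card/subsetIr.
  have := cardsID (nbrs g0 S) Y; rewrite (setIC Y).
  by lia.
Qed.

End Structure.

(** * Choice of parameters *)

Section Numerics.
Local Set Default Proof Using "All".
Variables (K M c Q h t n : nat).
Hypothesis eK : K = 128 * 200.
Hypothesis eM : M = 1000 * 1000.
Hypothesis ec : c = 3200.
Hypothesis QK : 4 ^ (2 * K) <= Q.
Hypothesis Qc : 360 * 16 ^ 4 * c ^ 16 <= Q.
Hypothesis tQ : 1600 * Q <= t.
Hypothesis th : t ^ 4 <= h.
Hypothesis ht : h < t.+1 ^ 4.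
Hypothesis hn : 2 ^ h <= n.
Hypothesis nh : n < 4 ^ h.+1.

(** [h] stands for the integer part of ln n and [t] for that of the fourth root of [h]. Then [n2] is
    about 4n / sqrt(h), just large enough for two sets of this size to be joined; [q] is at most the
    degree [h %/ 800] divided by the sparsity [2 * t ^ 3]; and [n1] exceeds [n3] by a factor of
    about [h], which leaves room for the expansion of the smallest sets. *)
Local Notation q := (t %/ 1600).
Local Notation Rm := (h %/ K).
Local Notation n2 := ((4 * n) %/ t ^ 2).
Local Notation n3 := (n %/ h ^ 3).
Local Notation n1 := (n %/ h ^ 2).

Lemma num_Q : 360 <= Q.
Proof.
apply: leq_trans Qc; rewrite -mulnA leq_pmulr// muln_gt0 !expn_gt0/=.
by rewrite ec.
Qed.

Lemma num_q : Q <= q.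
Proof. by rewrite leq_divRL// mulnC. Qed.

Lemma num_t : 2000 <= t.
Proof. have := num_Q; lia. Qed.

Lemma num_tq : t <= c * q.
Proof.
have := ltn_ceil t (isT : 0 < 1600).
have := num_q; have := num_Q; rewrite ec; lia.
Qed.

Lemma num_h : M <= h.
Proof.
rewrite eM; apply: leq_trans th; have t0 := num_t.
apply: leq_trans (_ : t ^ 2 <= _); last by rewrite leq_exp2l //; lia.
by rewrite expnS expn1; apply: leq_mul; lia.
Qed.

Lemma num_ht : h <= 16 * t ^ 4.
Proof.
apply: leq_trans (ltnW ht) _; rewrite -[16]/(2 ^ 4) -expnMn leq_exp2r//.
by have := num_t; lia.
Qed.

Lemma num_tn : t ^ 22 <= n.
Proof.
apply: leq_trans hn; apply: leq_trans (_ : 2 ^ (t * 22) <= _).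
  by rewrite expnM leq_exp2r//; apply/ltnW/ltn_expl.
rewrite leq_exp2l//; apply: leq_trans th; rewrite expnS leq_mul2l; apply/orP; right.
have t0 := num_t; apply: leq_trans (_ : t ^ 1 <= _); last by rewrite leq_exp2l//; lia.
rewrite expn1; lia.
Qed.

(** The origin of [j0 = 20]: sixteen powers of [q] match [h ^ 4] up to a constant, and the other
    four absorb that constant. [h ^ 4] comes from a demand of order [h] per exceptional vertex
    measured against [n3], about n / h^3. *)
Lemma num_hq : 360 * h ^ 4 <= q ^ 20.
Proof.
have hh : h ^ 4 <= 16 ^ 4 * (c ^ 16 * q ^ 16).
  rewrite -expnMn [(c * q) ^ _](expnM _ 4 4) -expnMn leq_exp2r//.
  by apply: leq_trans num_ht _; rewrite leq_mul2l leq_exp2r// num_tq orbT.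
have -> : q ^ 20 = q ^ 4 * q ^ 16 by rewrite -expnD.
apply: leq_trans (_ : 360 * 16 ^ 4 * c ^ 16 * q ^ 16 <= _).
  by move: hh; move: (16 ^ 4) (c ^ 16) (q ^ 16) => x y z hh; rewrite -!mulnA leq_mul2l hh orbT.
rewrite leq_mul2r; apply/orP; right.
apply: leq_trans Qc _; apply: leq_trans num_q _.
by rewrite -{1}(expn1 q) leq_pexp2l//; apply: leq_trans num_q; apply: leq_trans num_Q.
Qed.

Lemma num_hn : 2 * h ^ 4 <= n.
Proof.
apply: leq_trans num_tn; apply: leq_trans (_ : 360 * h ^ 4 <= _).
  by rewrite leq_mul2r orbT.
apply: leq_trans num_hq _; apply: leq_trans (_ : t ^ 20 <= _).
  by rewrite leq_exp2r// leq_div.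
by rewrite leq_exp2l//; have := num_t; lia.
Qed.

Lemma num_n2le : n2 * t ^ 2 <= 4 * n.
Proof. exact: leq_trunc_div. Qed.

Lemma num_n2small : n2 * 2000 <= n.
Proof.
rewrite -(leq_pmul2l (isT : 0 < 4)); apply: leq_trans num_n2le; have t0 := num_t.
rewrite mulnCA leq_mul2l; apply/orP; right.
by rewrite expnS expn1; apply: leq_mul => //; lia.
Qed.

Lemma num_n2large : 39 * n <= 10 * (n2 * t ^ 2).
Proof.
have t0 := num_t.
have := ltn_ceil (4 * n) (_ : 0 < t ^ 2); rewrite expn_gt0 (leq_trans _ t0)// => /(_ isT); rewrite mulSn.
have : 10 * t ^ 2 <= n.
  apply: leq_trans num_tn; rewrite (expnD t 20 2) leq_mul2r; apply/orP; right.
  apply: leq_trans (_ : t ^ 1 <= _); first by rewrite expn1; lia.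
  by rewrite leq_exp2l//; lia.
lia.
Qed.

Lemma num_joined a b : n2 <= a -> n2 <= b -> 10 * n ^ 2 <= a * b * h.
Proof.
move=> na nb; apply: leq_trans (_ : n2 * n2 * t ^ 4 <= _); last first.
  by apply: leq_mul => //; apply: leq_mul.
rewrite -[n2 * n2]/(n2 ^ 2) (expnM t 2 2) -expnMn.
have := num_n2large; set m := n2 * _ => le.
have : (39 * n) ^ 2 <= (10 * m) ^ 2 by rewrite leq_exp2r.
rewrite !expnMn; set x := n ^ 2; set y := m ^ 2; rewrite !expnS !expn0; lia.
Qed.

Lemma num_joined_large a b : n2 < (2 * 20 + 4) * a -> n %/ 20 < b ->
  10 * n ^ 2 <= a * b * h.
Proof.
move=> na nb.
have b1 : n <= 20 * b by have := ltn_ceil n (isT : 0 < 20); lia.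
have a1 : n <= 44 * (a * t ^ 2).
  have := num_n2large => le.
  have : n2 * t ^ 2 <= (44 * a) * t ^ 2 by rewrite leq_mul2r ltnW ?orbT.
  lia.
have t0 := num_t.
have : n * n <= 44 * (a * t ^ 2) * (20 * b) by apply: leq_mul.
have tt : 8800 * t ^ 2 <= h.
  apply: leq_trans th; rewrite (expnD t 2 2) leq_mul2r; apply/orP; right.
  by rewrite expnS expn1; apply: leq_trans (_ : 94 * 94 <= _) => //; apply: leq_mul; lia.
rewrite -[n ^ 2]/(n * n) => le.
apply: leq_trans (_ : a * b * (8800 * t ^ 2) <= _); last by rewrite leq_mul2l tt orbT.
by rewrite (_ : a * b * (8800 * t ^ 2) = 10 * (44 * (a * t ^ 2) * (20 * b))) ?leq_mul2l ?le ?orbT//; ring.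
Qed.

Lemma num_h_gt0 : 0 < h.
Proof. have := num_h; rewrite eM; lia. Qed.

Lemma num_t_gt0 : 0 < t.
Proof. exact: leq_trans num_t. Qed.

Lemma num_d : h %/ 800 + 40 <= h %/ 400.
Proof. have := num_h; lia. Qed.

Lemma num_qd : q * (2 * t ^ 3) <= h %/ 800.
Proof.
rewrite leq_divRL//; apply: leq_trans th; rewrite (expnS t 3).
rewrite (_ : q * (2 * t ^ 3) * 800 = q * 1600 * t ^ 3); last by ring.
by rewrite leq_mul2r leq_trunc_div orbT.
Qed.

Lemma num_RmK : Rm * K <= h. Proof. exact: leq_trunc_div. Qed.

Lemma num_dRm : 8 * (2 * 20 + 2 * Rm + 5) <= h %/ 800.
Proof.
rewrite leq_divRL//; have := num_RmK; have := num_h; rewrite eK; lia.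
Qed.

Lemma num_n31 : (2 * 20 + 2 * Rm + 5) * n3 <= n1.
Proof.
have h0 := num_h.
rewrite leq_divRL ?expn_gt0 ?num_h_gt0//.
apply: leq_trans (leq_trunc_div n (h ^ 3)); rewrite (expnS h 2).
rewrite (mulnC _ n3) -mulnA leq_mul2l leq_mul2r.
by apply/orP; right; apply/orP; right; have := num_dRm; have := leq_div h 800; lia.
Qed.

Lemma num_n3_large : (2 * Rm + 2) * ((2 * 20 + 5) * n2) <= n3 * q ^ 20.
Proof.
have h0 := num_h; have t0 := num_t.
have n3l : n <= 2 * (n3 * h ^ 3).
  have := ltn_ceil n (_ : 0 < h ^ 3); rewrite expn_gt0 num_h_gt0 => /(_ isT); rewrite mulSn.
  have : 2 * h ^ 3 <= n.
    apply: leq_trans num_hn; rewrite leq_mul2l leq_exp2l//=; lia.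
  lia.
have Rh : 2 * Rm + 2 <= h by have := num_dRm; have := leq_div h 800; lia.
have pos : 0 < 2 * h ^ 3 * t ^ 2 by rewrite muln_gt0 muln_gt0 /= !expn_gt0 num_h_gt0 num_t_gt0.
rewrite -(leq_pmul2r pos).
apply: leq_trans (_ : n * (q ^ 20 * t ^ 2) <= _); last first.
  rewrite (_ : n3 * q ^ 20 * (2 * h ^ 3 * t ^ 2) = 2 * (n3 * h ^ 3) * (q ^ 20 * t ^ 2)); last by ring.
  by rewrite leq_mul2r n3l orbT.
apply: leq_trans (_ : n * (360 * h ^ 4) <= _); last first.
  rewrite leq_mul2l; apply/orP; right; apply: leq_trans num_hq _.
  by rewrite leq_pmulr// expn_gt0; lia.
rewrite (_ : (2 * Rm + 2) * ((2 * 20 + 5) * n2) * (2 * h ^ 3 * t ^ 2)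
   = 90 * (h ^ 3 * ((2 * Rm + 2) * (n2 * t ^ 2)))); last by ring.
rewrite (_ : n * (360 * h ^ 4) = 90 * (h ^ 3 * (h * (4 * n)))); last by ring.
rewrite !leq_mul2l; apply/orP; right; apply/orP; right.
by apply: leq_mul => //; apply: num_n2le.
Qed.

(** By [QK] every step gains at least [4 ^ (2 * K)], so [h %/ K] steps already outgrow [n]. A height
    that is a small fraction of [h] is all that the degree has to pay for. *)
Lemma num_qRm : n2 < q ^ Rm.
Proof.
apply: leq_ltn_trans (_ : n2 <= n) _.
  by apply: leq_trans num_n2small; rewrite leq_pmulr.
apply: leq_trans nh _; have h0 := num_h.
have qK : 4 ^ (2 * K) <= q by apply: leq_trans QK num_q.
apply: leq_trans (_ : (4 ^ (2 * K)) ^ Rm <= _).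
  rewrite -expnM leq_exp2l//.
  have := ltn_ceil h (_ : 0 < K); rewrite eK => /(_ isT); lia.
by have [->//|R0] := posnP Rm; rewrite leq_exp2r.
Qed.

Lemma num_qj0 : q ^ 20 <= n2.
Proof.
have t0 := num_t.
rewrite leq_divRL ?expn_gt0 ?num_t_gt0//.
apply: leq_trans (_ : t ^ 20 * t ^ 2 <= _).
  by rewrite leq_mul2r leq_exp2r// leq_div orbT.
by rewrite -expnD; apply: leq_trans num_tn _; rewrite leq_pmull.
Qed.

Lemma num_j0Rm : 20 <= Rm.
Proof. by rewrite leq_divRL eK//; have := num_h; lia. Qed.

Lemma num_A' a : n <= 10 * a.+1 ->
  2 * n2 + (n %/ 20).+1 + (2 * 20 + 2) * (2 * n2) + n3 <= a.
Proof.
have h0 := num_h; have := num_n2small; have := num_hn => hn4 n2s na.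
have n3s : n3 * 1000 <= n.
  apply: leq_trans (leq_trunc_div n (h ^ 3)); rewrite leq_mul2l.
  apply/orP; right; apply: leq_trans (_ : h ^ 1 <= _); first by rewrite expn1; lia.
  by rewrite leq_exp2l//; lia.
have : h <= n.
  apply: leq_trans hn4; rewrite -{1}(expn1 h); apply: leq_trans (leq_pmull _ _) => //.
  by rewrite leq_exp2l//; lia.
lia.
Qed.

End Numerics.

(** The deterministic half of the proof, with every parameter expressed through [n], [h] and [t].
    The bounds by powers of 2 and 4 are integer substitutes for e^h <= n < e^(h+1). *)
Definition acquisition_threshold (T : nat) : Prop := forall (R : realType) (V : finType)
    (g0 g : rel V) (A : {set V}) (h t n : nat),
  T <= t -> t ^ 4 <= h -> h < t.+1 ^ 4 -> 2 ^ h <= n -> n < 4 ^ h.+1 ->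
  #|V| = n -> n <= 10 * #|~: A|.+1 ->
  symmetric g -> irreflexive g -> Defs.connected g -> symmetric g0 -> (forall x y, g0 x y -> g x y) ->
  (forall l l', l \in low_degree g0 (h %/ 400) A -> l' \in low_degree g0 (h %/ 400) A -> ~~ g l l') ->
  (forall Q v, Q \in [:: A; ~: A] -> #|nbrs g0 [set v] :&: low_degree g0 (h %/ 400) Q| < 20) ->
  (forall l1 x1 v x2 l2, uniq [:: l1; x1; v; x2; l2] ->
     l1 \in low_degree g0 (h %/ 400) A -> l2 \in low_degree g0 (h %/ 400) A ->
     g l1 x1 -> g x1 v -> g v x2 -> g x2 l2 -> False) ->
  (forall S : {set V}, #|S| * h ^ 2 <= n -> volume g0 S <= 8 * #|S|) ->
  (forall S : {set V}, #|S| * t ^ 2 <= 4 * n -> volume g0 S <= (2 * t ^ 3) * #|S|) ->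
  (forall X Z : {set V}, [disjoint X & Z] -> 10 * n ^ 2 <= #|X| * #|Z| * h ->
     exists2 x, x \in X & exists2 z, z \in Z & g0 x z) ->
  frac_acq_number R g 1 /\ unit_acq_number g 1.

Lemma sparse_graph_acquisition : exists T : nat, acquisition_threshold T.
Proof.
have [K eK] : {K | K = 128 * 200} by exists (128 * 200).
have [M eM] : {M | M = 1000 * 1000} by exists (1000 * 1000).
have [c ec] : {c | c = 3200} by exists 3200.
have [Q [QK Qc]] : {Q | 4 ^ (2 * K) <= Q /\ 360 * 16 ^ 4 * c ^ 16 <= Q}.
  by exists (4 ^ (2 * K) + 360 * 16 ^ 4 * c ^ 16); split; [apply: leq_addr|apply: leq_addl].
exists (1600 * Q) => R V g0 g A h t n tQ th ht hn nh cV cA g_sym g_irr g_conn g0_sym g0g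
  indep few far small mid joined.
have h0 := num_h eK eM ec QK Qc tQ th ht hn nh; have t0 := num_t eK eM ec QK Qc tQ th ht hn nh.
have hp := num_h_gt0 eK eM ec QK Qc tQ th ht hn nh; have tp := num_t_gt0 eK eM ec QK Qc tQ th ht hn nh.
have q0 : 360 <= t %/ 1600 by rewrite leq_divRL//; lia.
apply: (@structure_acquisition R V g0 g A (h %/ 400) (h %/ 800) (t %/ 1600) (2 * t ^ 3)
  (n %/ h ^ 2) ((4 * n) %/ t ^ 2) (n %/ h ^ 3) (n %/ 20).+1 (h %/ K) 20).
- exact: g_sym.
- exact: g_irr.
- exact: g_conn.
- exact: g0_sym.
- exact: g0g.
- exact: indep.
- by move=> v; split; apply: few; rewrite !inE eqxx ?orbT.
- exact: far.
- by move=> S; rewrite leq_divRL ?expn_gt0 ?hp//; apply: small.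
- by move=> S; rewrite leq_divRL ?expn_gt0 ?tp//; apply: mid.
- by move=> X Z dXZ cX cZ; apply: joined dXZ _; apply: num_joined eK eM ec QK Qc tQ th ht hn nh _ _ cX cZ.
- by move=> X Z dXZ cX cZ; apply: joined dXZ _;
    apply: num_joined_large eK eM ec QK Qc tQ th ht hn nh _ _ cX cZ.
- exact: num_d eK eM ec QK Qc tQ th ht hn nh.
- exact: num_qd eK eM ec QK Qc tQ th ht hn nh.
- by rewrite muln_gt0 expn_gt0 tp.
- exact: num_dRm eK eM ec QK Qc tQ th ht hn nh.
- exact: num_n31 eK eM ec QK Qc tQ th ht hn nh.
- by apply: leq_trans q0.
- apply: leq_trans (num_qj0 eK eM ec QK Qc tQ th ht hn nh); apply: leq_trans (_ : (t %/ 1600) ^ 1 <= _).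
    by rewrite expn1; apply: leq_trans q0.
  by rewrite leq_pexp2l//; apply: leq_trans q0.
- exact: num_qRm eK eM ec QK Qc tQ th ht hn nh.
- exact: num_j0Rm eK eM ec QK Qc tQ th ht hn nh.
- exact: num_qj0 eK eM ec QK Qc tQ th ht hn nh.
- exact: num_n3_large eK eM ec QK Qc tQ th ht hn nh.
- exact: num_A' eK eM ec QK Qc tQ th ht hn nh _ cA.
Qed.

Local Open Scope ring_scope.

(** * Uniform permutations *)

Lemma ffact_ratio_le (R : realType) (p m a : nat) : (p <= m)%N -> (a <= m)%N ->
  (p ^_ a)%:R / (m ^_ a)%:R <= (p%:R / m%:R) ^+ a :> R.
Proof.
move=> pm; elim: a => [|a IH] am; first by rewrite divr1.
have m0 : (0 < m)%N by apply: leq_trans am.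
rewrite !ffactnSr !natrM invfM mulrACA exprSr ler_pM//.
- by rewrite divr_ge0 ?ler0n.
- by rewrite divr_ge0 ?ler0n.
- exact: IH (ltnW am).
rewrite ler_pdivrMr ?ltr0n ?subn_gt0// mulrAC ler_pdivlMr ?ltr0n//.
by rewrite -!natrM ler_nat; nia.
Qed.

Section RandomPermutation.
Variables (R : realType) (T : finType).
Local Notation N := #|T|.

Definition Pr (b : pred {perm T}) : R := #|[set s | b s]|%:R / (N`!)%:R.

Lemma card_perms : #|{perm T}| = N`!.
Proof.
rewrite -(cardsT T) -card_perm; apply: eq_card => s.
by rewrite [RHS]inE; apply/esym/subsetP => x _; rewrite inE.
Qed.

Lemma factR_gt0 m : 0 < (m`!)%:R :> R. Proof. by rewrite ltr0n fact_gt0. Qed.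

Lemma Pr_le (b b' : pred {perm T}) : (forall s, b s -> b' s) -> Pr b <= Pr b'.
Proof.
move=> bb; rewrite ler_pM2r ?invr_gt0 ?factR_gt0// ler_nat.
by apply/subset_leq_card/subsetP => s; rewrite !inE; apply: bb.
Qed.

Lemma Pr_compl (b : pred {perm T}) : Pr b = 1 - Pr (fun s => ~~ b s).
Proof.
have : Pr b + Pr (fun s => ~~ b s) = 1.
  rewrite -mulrDl -natrD.
  have -> : (#|[set s | b s]| + #|[set s | ~~ b s]|)%N = N`!.
    by rewrite -card_perms -(cardsC [set s | b s]); congr (_ + _)%N; apply: eq_card => s; rewrite !inE.
  by rewrite divff// gt_eqF// factR_gt0.
by move=> <-; rewrite addrK.
Qed.

Lemma Pr_sum (I : finType) (P : pred I) (B : I -> pred {perm T}) (b : pred {perm T}) :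
  (forall s, b s -> exists2 i, P i & B i s) -> Pr b <= \sum_(i | P i) Pr (B i).
Proof.
move=> bB; rewrite -mulr_suml ler_pM2r ?invr_gt0 ?factR_gt0// -natr_sum ler_nat.
apply: leq_trans (_ : (#|\bigcup_(i | P i) [set s | B i s]| <= _)%N).
  apply/subset_leq_card/subsetP => s; rewrite inE => /bB[i Pi Bi].
  by apply/bigcupP; exists i; rewrite ?inE.
elim/big_ind2: _ => [|A m C k Am Ck|i _]; rewrite ?cards0//.
exact: leq_trans (leq_card_setU _ _) (leq_add Am Ck).
Qed.

Lemma Pr_or (b1 b2 : pred {perm T}) : Pr (fun s => b1 s || b2 s) <= Pr b1 + Pr b2.
Proof.
have := @Pr_sum bool predT (fun i => if i then b1 else b2) (fun s => b1 s || b2 s).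
rewrite big_bool /=; apply => s /orP[]; [exists true|exists false] => //.
Qed.

(** The process reads positions of edges through the inverse of [s], the counting lemmas work with
    [s]; inversion preserves the uniform law. *)
Lemma Pr_inv (b : pred {perm T}) : Pr (fun s => b (s^-1)%g) = Pr b.
Proof.
congr (_%:R / _); rewrite -(card_imset [set s | b s] (@invg_inj _)).
apply: eq_card => s; rewrite inE; apply/idP/imsetP => [bs|[u]].
  by exists (s^-1)%g; rewrite ?inE// invgK.
by rewrite inE => bu ->; rewrite invgK.
Qed.

(** Composition with the inverse of one such permutation maps all of them into the pointwise
    stabiliser of [A]. *)
Lemma card_perm_agree (A : {set T}) (g : T -> T) :
  (#|[set s : {perm T} | [forall x in A, s x == g x]]| <= (N - #|A|)`!)%N.
Proof.
have [->|[s0]] := set_0Vmem [set s : {perm T} | [forall x in A, s x == g x]].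
  by rewrite cards0.
rewrite inE => /forall_inP s0A.
have -> : (N - #|A|)%N = #|~: A| by rewrite -(cardsC A) addKn.
rewrite -card_perm.
rewrite -(card_imset _ (mulIg (s0^-1)%g)); apply/subset_leq_card/subsetP => _ /imsetP[s + ->].
rewrite inE => /forall_inP sA; rewrite unfold_in; apply/subsetP=> x; rewrite !inE permM.
by apply: contraNN => xA; rewrite (eqP (sA _ xA)) -(eqP (s0A _ xA)) permK.
Qed.

(** A substitute for independence. Expanding the product of sums yields all maps on [A], injective
    or not, and each is the restriction of at most (N - |A|)! permutations. *)
Lemma sum_prod_perm_le (A : {set T}) (F : T -> T -> R) : (forall x y, 0 <= F x y) ->
  \sum_(s : {perm T}) \prod_(x in A) F x (s x) <=
  ((N - #|A|)`!)%:R * \prod_(x in A) \sum_y F x y.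
Proof.
move=> F0; pose G x y := if x \in A then F x y else (y == x)%:R.
have G0 x y : 0 <= G x y by rewrite /G; case: ifP => // _; rewrite ler0n.
have -> : \prod_(x in A) \sum_y F x y = \prod_x \sum_y G x y.
  rewrite [RHS](bigID (mem A)) /= [X in _ * X]big1 ?mulr1; last first.
    move=> x /negPf xA; under eq_bigr do rewrite /G xA.
    by rewrite (bigD1 x)//= eqxx big1 ?addr0// => y /negPf ->.
  by apply: eq_bigr => x xA; apply: eq_bigr => y _; rewrite /G xA.
rewrite bigA_distr_bigA /=.
pose rho (s : {perm T}) := [ffun x => if x \in A then s x else x].
rewrite (partition_big rho predT)//= mulr_sumr; apply: ler_sum => g _.
have [gA|] := boolP [forall x, (x \notin A) ==> (g x == x)]; last first.
  rewrite negb_forall => /existsP[x]; rewrite negb_imply => /andP[xA gx].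
  rewrite big1 => [|s /eqP e]; last first.
    by move: gx; rewrite -e ffunE (negPf xA) eqxx.
  by rewrite mulr_ge0 ?ler0n ?prodr_ge0.
have eqG : \prod_x G x (g x) = \prod_(x in A) F x (g x).
  rewrite (bigID (mem A)) /= [X in _ * X]big1 ?mulr1 => [|x xA].
    by apply: eq_bigr => x xA; rewrite /G xA.
  rewrite /G (negPf xA); have := forallP gA x; rewrite xA /= => /eqP ->.
  by rewrite eqxx.
rewrite eqG [leLHS](eq_bigr (fun _ => \prod_(x in A) F x (g x))); last first.
  by move=> s /= /eqP e; apply: eq_bigr => x xA; rewrite -e ffunE xA.
rewrite sumr_const -[leLHS]mulr_natl ler_wpM2r ?prodr_ge0// ler_nat.
apply: leq_trans (card_perm_agree A g); apply/subset_leq_card/subsetP => s.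
move=> sg; have /eqP <- : rho s == g := sg.
by rewrite inE; apply/forall_inP => x xA; rewrite ffunE xA.
Qed.

(** Markov's inequality; the factors of the falling factorial of N are all at least N - c. *)
Lemma Pr_prod_le (A : {set T}) (F : T -> T -> R) (b : pred {perm T}) (C : R) (c : nat) :
  (forall x y, 0 <= F x y) -> 0 <= C -> (#|A| <= c < N)%N ->
  (forall s, b s -> 1 <= C * \prod_(x in A) F x (s x)) ->
  Pr b <= C * \prod_(x in A) ((\sum_y F x y) / (N - c)%:R).
Proof.
move=> F0 C0 /andP[Ac cN] bF.
have AN : (#|A| <= N)%N by apply: leq_trans Ac (ltnW cN).
have cN0 : 0 < (N - c)%:R :> R by rewrite ltr0n subn_gt0.
rewrite prodf_div prodr_const mulrA ler_pdivrMr ?factR_gt0//.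
have : #|[set s | b s]|%:R <= C * (((N - #|A|)`!)%:R * \prod_(x in A) \sum_y F x y).
  apply: le_trans (_ : \sum_(s : {perm T}) C * \prod_(x in A) F x (s x) <= _); last first.
    by rewrite -mulr_sumr ler_wpM2l// sum_prod_perm_le.
  rewrite -sum1_card natr_sum big_mkcond /=; apply: ler_sum => s _.
  by rewrite inE; case: ifP => [/bF//|_]; rewrite mulr_ge0// prodr_ge0.
move=> le; apply: le_trans le _; rewrite -!mulrA ler_wpM2l//.
rewrite mulrC ler_wpM2l//; first by apply: prodr_ge0 => x _; apply: sumr_ge0.
rewrite mulrC ler_pdivlMr ?exprn_gt0// -natrX -natrM ler_nat.
rewrite -(ffact_fact AN) mulnC leq_mul2r; apply/orP; right.
elim: #|A| Ac {AN} => [//|a IH] ac; rewrite expnSr ffactnSr.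
by apply: leq_mul; [apply: IH; apply: ltnW | apply: leq_sub2l; apply: ltnW].
Qed.

(** Only upper bounds are proved directly, for the event and for its complement. They add up to the
    number of all permutations, so both are exact. *)
Lemma card_perm_in (A P : {set T}) :
  #|[set s : {perm T} | [forall x in A, s x \in P]]| = (#|P| ^_ #|A| * (N - #|A|)`!)%N.
Proof.
have AN : (#|A| <= N)%N by apply: max_card.
pose xs : #|A|.-tuple T := enum_tuple A.
have xsA x : (x \in xs) = (x \in A) by rewrite mem_enum.
have le (D : pred (#|A|.-tuple T)) :
  (#|[set s : {perm T} | D (map_tuple s xs)]| <=
   #|[set ys : #|A|.-tuple T | uniq ys & D ys]| * (N - #|A|)`!)%N.
  rewrite -sum1_card (partition_big (fun s : {perm T} => map_tuple s xs)
    (mem [set ys : #|A|.-tuple T | uniq ys & D ys])) /=; last first.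
    move=> s; rewrite !inE => -> ; rewrite andbT map_inj_uniq ?enum_uniq//.
    exact: perm_inj.
  rewrite -sum_nat_const; apply: leq_sum => ys _.
  pose g x := nth x ys (index x xs).
  rewrite sum1_card; apply: leq_trans (card_perm_agree A g).
  apply/subset_leq_card/subsetP => s /andP[_ /eqP eys].
  rewrite inE; apply/forall_inP => x xA; rewrite /g -eys /= (nth_map x) ?nth_index ?xsA//.
  by rewrite index_mem xsA.
pose D (ys : #|A|.-tuple T) := all (mem P) ys.
have cD : #|[set ys : #|A|.-tuple T | uniq ys & D ys]| = (#|P| ^_ #|A|)%N.
  by rewrite -(card_uniq_tuples _ (mem P)); apply: eq_card => ys; rewrite !inE andbC.
have cT : #|[set ys : #|A|.-tuple T | uniq ys]| = (N ^_ #|A|)%N.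
  rewrite -(card_uniq_tuples _ predT); apply: eq_card => ys; rewrite !inE.
  by rewrite (_ : all _ _)//; apply/allP.
have cN : #|[set ys : #|A|.-tuple T | uniq ys & ~~ D ys]| = (N ^_ #|A| - #|P| ^_ #|A|)%N.
  rewrite -cT -cD -[in RHS](cardsID [set ys | D ys] [set ys : #|A|.-tuple T | uniq ys]).
  have -> : [set ys : #|A|.-tuple T | uniq ys] :&: [set ys | D ys] =
            [set ys : #|A|.-tuple T | uniq ys & D ys] by apply/setP=> ys; rewrite !inE.
  by rewrite addKn; apply: eq_card => ys; rewrite !inE andbC.
have eD s : D (map_tuple s xs) = [forall x in A, s x \in P].
  rewrite /D all_map; apply/allP/forall_inP => H x xA; apply: H; rewrite ?xsA//.
  by rewrite -xsA.
have := le D; have := le (fun ys => ~~ D ys); rewrite cD cN.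
have -> : [set s : {perm T} | D (map_tuple s xs)] = [set s : {perm T} | [forall x in A, s x \in P]].
  by apply/setP=> s; rewrite !inE eD.
have -> : [set s : {perm T} | ~~ D (map_tuple s xs)] = ~: [set s : {perm T} | [forall x in A, s x \in P]].
  by apply/setP=> s; rewrite !inE eD.
have := cardsC [set s : {perm T} | [forall x in A, s x \in P]].
rewrite card_perms -(ffact_fact AN) mulnBl => eN lC lD.
apply/eqP; rewrite eqn_leq lD /=.
have PN : (#|P| ^_ #|A| * (N - #|A|)`! <= N ^_ #|A| * (N - #|A|)`!)%N.
  rewrite leq_mul2r -cD -cT; apply/orP; right.
  by apply/subset_leq_card/subsetP => ys; rewrite !inE => /andP[].
by rewrite -(leq_add2r #|~: [set s : {perm T} | [forall x in A, s x \in P]]|) eN -leq_subRL.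
Qed.

Lemma Pr_in (A P : {set T}) :
  Pr (fun s => [forall x in A, s x \in P]) = (#|P| ^_ #|A|)%:R / (N ^_ #|A|)%:R.
Proof.
have AN : (#|A| <= N)%N by apply: max_card.
rewrite /Pr card_perm_in -(ffact_fact AN) !natrM invfM mulrACA divff ?mulr1//.
by rewrite gt_eqF// factR_gt0.
Qed.

Lemma Pr_in_le (A P : {set T}) :
  Pr (fun s => [forall x in A, s x \in P]) <= (#|P|%:R / N%:R) ^+ #|A|.
Proof. by rewrite Pr_in ffact_ratio_le// max_card. Qed.

(* Exponential Markov inequality with parameter [z] for the number of elements of [W]
   that are sent into [P0]. *)
Lemma Pr_few_in_le (U W P0 P1 : {set T}) (k c : nat) (z : R) :
  [disjoint U & W] -> (#|U| + #|W| <= c < N)%N -> 0 < z -> z <= 1 ->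
  Pr (fun s => [forall x in U, s x \in P1] && (#|[set x in W | s x \in P0]| <= k)%N) <=
  z ^- k * ((#|P1|%:R / (N - c)%:R) ^+ #|U| *
            ((z * #|P0|%:R + (N - #|P0|)%:R) / (N - c)%:R) ^+ #|W|).
Proof.
move=> dUW cN z0 z1.
pose F x y : R := if x \in U then (y \in P1)%:R else if y \in P0 then z else 1.
have cUW : #|U :|: W| = (#|U| + #|W|)%N by rewrite cardsU disjoint_setI0// cards0 subn0.
have UWprod (f : T -> R) : \prod_(x in U :|: W) f x = \prod_(x in U) f x * \prod_(x in W) f x.
  by rewrite -bigU//=; apply: eq_bigl => x; rewrite inE.
have WU x : x \in W -> (x \in U) = false by move=> xW; rewrite (disjointFl dUW xW).
apply: le_trans (@Pr_prod_le (U :|: W) F _ (z ^- k) c _ _ _ _) _.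
- by move=> x y; rewrite /F; case: ifP => _; [rewrite ler0n|case: ifP => // _; apply: ltW].
- by rewrite invr_ge0 exprn_ge0// ltW.
- by rewrite cUW.
- move=> s /andP[/forall_inP sU sW]; rewrite UWprod [X in _ * (X * _)]big1 ?mul1r; last first.
    by move=> x xU; rewrite /F xU sU.
  rewrite ler_pdivlMl ?exprn_gt0// mulr1.
  apply: le_trans (_ : z ^+ #|[set x in W | s x \in P0]| <= _).
    by apply: ler_wiXn2l => //; apply: ltW.
  rewrite -prodr_const [leRHS](big_setID [set x in W | s x \in P0]) /=.
  rewrite [X in _ * X]big1 ?mulr1 => [|x].
    have -> : W :&: [set x in W | s x \in P0] = [set x in W | s x \in P0].
      by apply/setP=> x; rewrite !inE andbA andbb.
    apply: ler_prod => x; rewrite inE => /andP[xW xP].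
    by rewrite /F WU// xP lexx ltW.
  by rewrite !inE => /andP[+ xW]; rewrite xW /= => xP; rewrite /F WU// (negPf xP).
rewrite UWprod ler_wpM2l ?invr_ge0 ?exprn_ge0 ?(ltW z0)//.
rewrite le_eqVlt; apply/orP; left; apply/eqP; congr (_ * _).
  rewrite -prodr_const; apply: eq_bigr => x xU; congr (_ / _).
  under eq_bigr do rewrite /F xU.
  by rewrite -natr_sum -sum1_card [in RHS]big_mkcond.
rewrite -prodr_const; apply: eq_bigr => x xW; congr (_ / _).
under eq_bigr do rewrite /F WU//.
rewrite (bigID (mem P0)) /= (eq_bigr (fun _ => z)) => [|y ->//].
rewrite [X in _ + X](eq_bigr (fun _ => 1)) => [|y /negPf ->//].
rewrite !sumr_const; congr (_ + _%:R); first by rewrite mulr_natr.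
by rewrite -(cardC (mem P0)) addKn.
Qed.

End RandomPermutation.

(** * The random graph process *)

Section GraphEncoding.
Variable n : nat.
Local Notation T := (Kedge n).
Local Open Scope nat_scope.

Definition ends (e : T) : {set 'I_n} := [set (val e).1; (val e).2].

Lemma ends_lt (e : T) : ((val e).1 < (val e).2)%N.
Proof. exact: (valP e). Qed.

Lemma ends_ne (e : T) : (val e).1 != (val e).2.
Proof. by apply/eqP=> eq12; have := ends_lt e; rewrite eq12 ltnn. Qed.

Lemma endsE (e : T) x y :
  (ends e == [set x; y]) = (val e == (x, y)) || (val e == (y, x)).
Proof.
have ne := ends_ne e; rewrite /ends; case: (val e) ne => a b /= ne.
apply/eqP/orP => [eq|[/eqP[-> ->]//|/eqP[-> ->]]]; last by rewrite setUC.
have : a \in [set x; y] by rewrite -eq !inE eqxx.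
have : b \in [set x; y] by rewrite -eq !inE eqxx orbT.
rewrite !inE => /orP[] /eqP eb /orP[] /eqP ea; subst a b.
- by rewrite eqxx in ne.
- by right.
- by left.
- by rewrite eqxx in ne.
Qed.

Lemma ends_inj : injective ends.
Proof.
move=> e e' /eqP; rewrite [ends e']/ends endsE => /orP[]/eqP h; apply: val_inj.
  by rewrite [LHS]h -surjective_pairing.
by have := ends_lt e; rewrite h /= ltnNge ltnW// ends_lt.
Qed.

Lemma card_ends e : #|ends e| = 2.
Proof. by rewrite cards2 ends_ne. Qed.

Lemma ends_onto (A : {set 'I_n}) : #|A| = 2 -> exists e, ends e = A.
Proof.
move=> /eqP/cards2P[x [y [xy ->]]].
wlog lt : x y xy / (x < y)%N.
  move=> H; have [/H|/H|/val_inj e] := ltngtP x y; first exact.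
    by rewrite eq_sym setUC; apply.
  by rewrite e eqxx in xy.
by exists (exist (fun p : 'I_n * 'I_n => p.1 < p.2) (x, y) lt).
Qed.

Definition edges_of (P : {set {set 'I_n}}) : {set T} := [set e | ends e \in P].

Lemma card_edges_of (P : {set {set 'I_n}}) : (forall A, A \in P -> #|A| = 2) -> #|edges_of P| = #|P|.
Proof.
move=> P2; rewrite -(card_imset _ ends_inj); apply: eq_card => A.
apply/imsetP/idP => [[e + ->]|AP]; first by rewrite inE.
by have [e eA] := ends_onto (P2 _ AP); exists e; rewrite // inE eA.
Qed.

Lemma card_Kedge : #|{: T}| = 'C(n, 2).
Proof.
rewrite -[in RHS](card_ord n) -[RHS]card_draws -card_edges_of; last by move=> A; rewrite inE => /eqP.
by rewrite -cardsT; apply: eq_card => e; rewrite !inE card_ends eqxx.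
Qed.

Definition inside (S : {set 'I_n}) : {set T} := [set e | ends e \subset S].

Lemma card_inside (S : {set 'I_n}) : #|inside S| = 'C(#|S|, 2).
Proof.
rewrite -[RHS]cards_draws -card_edges_of; last by move=> A; rewrite inE => /andP[_ /eqP].
by apply: eq_card => e; rewrite !inE card_ends eqxx andbT.
Qed.

Definition between (X Z : {set 'I_n}) : {set T} :=
  edges_of [set [set p.1; p.2] | p in setX X Z].

Lemma disjoint_neq (X Z : {set 'I_n}) x z : [disjoint X & Z] -> x \in X -> z \in Z -> x != z.
Proof. by move=> dXZ xX zZ; apply/eqP=> e; have := disjointFr dXZ xX; rewrite e zZ. Qed.

Lemma mem_between (X Z : {set 'I_n}) e :
  reflect (exists x z, [/\ x \in X, z \in Z & ends e = [set x; z]]) (e \in between X Z).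
Proof.
rewrite inE; apply: (iffP imsetP) => [[[x z]]|[x [z [xX zZ ->]]]].
  by rewrite inE => /andP[xX zZ] ->; exists x, z.
by exists (x, z); rewrite // inE xX zZ.
Qed.

Lemma card_between (X Z : {set 'I_n}) : [disjoint X & Z] -> #|between X Z| = #|X| * #|Z|.
Proof.
move=> dXZ; rewrite card_edges_of => [|A /imsetP[[x z]]]; last first.
  by rewrite inE => /andP[/= xX zZ] ->; rewrite cards2 (disjoint_neq dXZ xX zZ).
rewrite card_in_imset ?cardsX// => -[x z] [x' z']; rewrite !inE /= => /andP[xX zZ] /andP[x'X z'Z] e.
have ex : x = x'.
  have : x \in [set x'; z'] by rewrite -e !inE eqxx.
  by rewrite !inE (negPf (disjoint_neq dXZ xX z'Z)) orbF => /eqP.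
have ez : z = z'.
  have : z \in [set x'; z'] by rewrite -e !inE eqxx orbT.
  by rewrite !inE eq_sym (negPf (disjoint_neq dXZ x'X zZ)) => /eqP.
by rewrite ex ez.
Qed.

Definition first (m : nat) : {set T} := [set y | (enum_rank y < m)%N].

Lemma card_first m : m <= #|{: T}| -> #|first m| = m.
Proof.
move=> mN; rewrite -[RHS]card_ord.
pose e (i : 'I_m) : T := enum_val (widen_ord mN i).
have ei : injective e by move=> i j /enum_val_inj /(congr1 val) /= /val_inj.
rewrite -[in RHS]cardsT -(card_imset _ ei); apply: eq_card => y; rewrite inE.
apply/idP/imsetP => [ym|[i _ ->]]; last by rewrite /e enum_valK /=.
by exists (Ordinal ym); rewrite ?inE//; rewrite /e -[LHS]enum_rankK; congr enum_val; apply: val_inj.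
Qed.

Lemma card_first_le m : #|first m| <= m.
Proof.
have [mN|Nm] := leqP m #|{: T}|; first by rewrite card_first.
by apply: leq_trans (max_card _) (ltnW Nm).
Qed.

Definition early (s : {perm T}) (m : nat) : {set T} := [set e | (s^-1)%g e \in first m].

Lemma mem_early (s : {perm T}) m e : (e \in early s m) = ((s^-1)%g e \in first m).
Proof. by rewrite [LHS]inE. Qed.

Lemma early_mono (s : {perm T}) m m' : m <= m' -> early s m \subset early s m'.
Proof.
by move=> mm; apply/subsetP=> e; rewrite !inE => /leq_trans; apply.
Qed.

Lemma gnmP (s : {perm T}) m x y :
  reflect (exists2 e, ends e = [set x; y] & e \in early s m) (gnm s m x y).
Proof.
apply: (iffP existsP) => [[e /andP[]]|[e /eqP]].
  by rewrite -endsE => /eqP exy em; exists e; rewrite // !inE.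
by rewrite endsE !inE => exy em; exists e; rewrite exy.
Qed.

Lemma gnm_sym (s : {perm T}) m : symmetric (gnm s m).
Proof. by move=> x y; apply/gnmP/gnmP => -[e ee em]; exists e; rewrite // setUC. Qed.

Lemma gnm_irr (s : {perm T}) m : irreflexive (gnm s m).
Proof.
by move=> x; apply/gnmP=> -[e ee _]; have := card_ends e; rewrite ee setUid cards1.
Qed.

Lemma gnm_mono (s : {perm T}) m m' : m <= m' -> forall x y, gnm s m x y -> gnm s m' x y.
Proof.
by move=> mm x y /gnmP[e ee em]; apply/gnmP; exists e => //; apply: (subsetP (early_mono _ mm)).
Qed.

Lemma early_gnm (s : {perm T}) m e x y : ends e = [set x; y] -> (e \in early s m) = gnm s m x y.
Proof.
move=> ee; apply/idP/gnmP => [em|[e' ee' em]]; first by exists e.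
by have -> : e = e' by apply: ends_inj; rewrite ee.
Qed.

Lemma gnm_complete (s : {perm T}) x y : x != y -> gnm s #|{: T}| x y.
Proof.
move=> xy; have [|e ee] := @ends_onto [set x; y]; first by rewrite cards2 xy.
by rewrite -(early_gnm _ _ ee) !inE.
Qed.

Lemma connected_mono (s : {perm T}) m m' : m <= m' -> Defs.connected (gnm s m) -> Defs.connected (gnm s m').
Proof.
move=> mm /forallP c; apply/forallP=> x; apply/forallP=> y.
have := forallP (c x) y; apply: connect_sub => a b gab.
exact/connect1/(gnm_mono mm).
Qed.

Lemma connected_complete (s : {perm T}) : Defs.connected (gnm s #|{: T}|).
Proof.
apply/forallP=> x; apply/forallP=> y.
by have [->|xy] := eqVneq x y; [apply: connect0 | apply/connect1/gnm_complete].
Qed.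

Lemma connected_hitting_time (s : {perm T}) : Defs.connected (gnm s (hitting_time s)).
Proof.
rewrite /hitting_time; elim/big_ind: _ => [|a b ca cb|//].
  exact: connected_complete.
by rewrite /minn; case: ifP.
Qed.

Lemma hitting_time_le (s : {perm T}) m : m <= #|{: T}| -> Defs.connected (gnm s m) -> hitting_time s <= m.
Proof.
move=> mN cm; rewrite /hitting_time.
pose i : 'I_#|{: T}|.+1 := Ordinal (mN : m < #|{: T}|.+1).
elim: (index_enum _) (mem_index_enum i) => [//|a l IH]; rewrite inE big_cons.
move=> /orP[/eqP <-|/IH le]; first by rewrite cm geq_minl.
by case: ifP => // _; apply: leq_trans (geq_minr _ _) le.
Qed.

(** Double counting: an ordered pair of adjacent vertices of [S] determines the incidence of its
    first vertex with the joining edge, and an edge has two incidences. *)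
Lemma volume_inside (s : {perm T}) m (S : {set 'I_n}) : volume (gnm s m) S <= 2 * #|inside S :&: early s m|.
Proof.
set E := _ :&: _; rewrite /volume.
pose Inc := [set p : 'I_n * T | (p.2 \in E) && (p.1 \in ends p.2)].
have -> : 2 * #|E| = #|Inc|.
  rewrite -[RHS]sum1_card (partition_big (fun p => p.2) (mem E)) /=; last by move=> p; rewrite inE => /andP[].
  rewrite mulnC -sum_nat_const; apply: eq_bigr => e eE.
  have inj : injective (fun x : 'I_n => (x, e)) by move=> x y [].
  rewrite -(card_ends e) -(card_imset _ inj) -sum1_card; apply: eq_bigl => -[x e'].
  rewrite inE /=; apply/imsetP/andP => [[x' x'e [-> ->]]|[/andP[_ xe] /eqP <-]].
    by rewrite eqxx x'e; split=> //; rewrite eE.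
  by exists x.
pose Dir := [set p : 'I_n * 'I_n | [&& p.1 \in S, p.2 \in S & gnm s m p.1 p.2]].
have -> : \sum_(v in S) #|nbrs (gnm s m) [set v] :&: S| = #|Dir|.
  rewrite -[RHS]sum1_card (partition_big (fun p => p.1) (mem S)) /=; last by move=> p; rewrite inE => /and3P[].
  apply: eq_bigr => v vS.
  have inj : injective (fun x : 'I_n => (v, x)) by move=> x y [].
  rewrite -(card_imset _ inj) -sum1_card; apply: eq_bigl => -[a b].
  rewrite inE /=; apply/imsetP/andP => [[x + [-> ->]]|[/and3P[_ bS gab] /eqP eav]].
    rewrite inE => /andP[/nbrsP[y]]; rewrite inE => /eqP -> gvx xS.
    by rewrite vS xS gvx eqxx.
  exists b; last by rewrite eav.
  by rewrite inE bS andbT; apply/nbrsP; exists v; rewrite ?inE -?eav.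
pose dflt p := [pick e | ends e == [set p.1; p.2] :> {set 'I_n}].
have [->|[p0 p0D]] := set_0Vmem Dir; first by rewrite cards0.
have [e0 _ _] : exists2 e, ends e = [set p0.1; p0.2] & e \in early s m.
  by apply/gnmP; move: p0D; rewrite inE => /and3P[].
pose F p := (p.1, odflt e0 (dflt p)).
have FP p : p \in Dir -> ends (F p).2 = [set p.1; p.2].
  rewrite inE => /and3P[_ _ /gnmP[e ee _]]; rewrite /F /dflt /=.
  by case: pickP => [e' /eqP//|/(_ e)]; rewrite ee eqxx.
rewrite -(card_in_imset (f := F)) => [|p p' pD p'D e].
  apply/subset_leq_card/subsetP => _ /imsetP[p pD ->].
  have ep := FP _ pD; move: pD; rewrite inE => /and3P[p1 p2 gp].
  rewrite inE ep set21 andbT inE (early_gnm _ _ ep) gp andbT inE ep.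
  by apply/subsetP=> x; rewrite !inE => /orP[]/eqP ->.
have e1 : p.1 = p'.1 by case: e.
have : [set p.1; p.2] = [set p'.1; p'.2] by rewrite -!FP// e.
have ne : p.1 != p.2.
  by apply: contraTneq pD => e12; rewrite inE e12 gnm_irr !andbF.
move=> /setP/(_ p.2); rewrite !inE eqxx orbT -e1 eq_sym (negPf ne) /= => /esym/eqP e2.
by case: p p' e1 e2 {pD p'D e ne} => [a b] [a' b'] /= -> ->.
Qed.

End GraphEncoding.

(** * Bounds on binomial coefficients *)

Section Binomials.
Local Open Scope nat_scope.

Lemma ffact_le_exp a b : a ^_ b <= a ^ b.
Proof.
elim: b => [//|b IH]; rewrite ffactnSr expnSr.
by apply: leq_mul IH (leq_subr _ _).
Qed.

Lemma exp_le_ffact b c : b ^ c <= (b + c) ^_ c.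
Proof.
elim: c => [//|c IH]; rewrite expnS addnS ffactnS /=.
by apply: leq_mul => //; rewrite -addnS leq_addr.
Qed.

Lemma bin_le_exp2 a b : 'C(a, b) <= 2 ^ a.
Proof.
elim: a b => [|a IH] [|b]; rewrite ?bin0 ?expn_gt0//.
by rewrite binS expnS mul2n -addnn leq_add.
Qed.

Lemma expbb_le b : b ^ b <= 4 ^ b * b`!.
Proof.
apply: leq_trans (exp_le_ffact b b) _; rewrite -bin_ffact leq_mul2r.
apply/orP; right; apply: leq_trans (bin_le_exp2 _ _) _.
by rewrite addnn -mul2n expnM.
Qed.

(** The usual bound (ea/b)^b with 4 in place of e, because b^b is at most C(2b, b) b! and C(2b, b)
    is at most 4^b. *)
Lemma bin_le_exp a b : 'C(a, b) * b ^ b <= (4 * a) ^ b.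
Proof.
apply: leq_trans (_ : 'C(a, b) * (4 ^ b * b`!) <= _).
  by rewrite leq_mul2l expbb_le orbT.
by rewrite mulnCA bin_ffact expnMn leq_mul2l ffact_le_exp orbT.
Qed.

End Binomials.

(** * Prescribed and forbidden edges; dense vertex sets *)

Section RandomGraph.
Variables (R : realType) (n : nat).
Local Notation T := (Kedge n).
Local Notation N := #|{: Kedge n}|.
Local Notation Pr := (@Pr R T).

Lemma bin_leR a b : (0 < b)%N -> ('C(a, b))%:R <= (4 * a%:R / b%:R) ^+ b :> R.
Proof.
move=> b0; rewrite expr_div_n ler_pdivlMr ?exprn_gt0 ?ltr0n//.
by rewrite -(natrM _ 4) -!natrX -natrM ler_nat bin_le_exp.
Qed.

Lemma Pr_sub_early (U : {set T}) m : Pr (fun s => U \subset early s m) <= (m%:R / N%:R) ^+ #|U|.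
Proof.
have -> : Pr (fun s => U \subset early s m) = Pr (fun s => [forall x in U, (s^-1)%g x \in first n m]).
  congr (_%:R / _); apply: eq_card => s; rewrite !inE.
  by apply/subsetP/forall_inP => H x /H; rewrite mem_early.
rewrite (Pr_inv R (fun s : {perm T} => [forall x in U, s x \in first n m])).
apply: le_trans (Pr_in_le _ _ _) _; apply: lerXn2r; rewrite ?nnegrE ?divr_ge0 ?ler0n//.
by rewrite ler_wpM2r ?invr_ge0 ?ler0n// ler_nat card_first_le.
Qed.

Lemma Pr_disjoint_early (W : {set T}) m : (m <= N)%N ->
  Pr (fun s => [disjoint W & early s m]) = ((N - m) ^_ #|W|)%:R / (N ^_ #|W|)%:R.
Proof.
move=> mN.
have -> : Pr (fun s => [disjoint W & early s m]) = Pr (fun s => [forall x in W, (s^-1)%g x \in ~: first n m]).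
  congr (_%:R / _); apply: eq_card => s; rewrite !inE.
  rewrite disjoints_subset; apply/subsetP/forall_inP => H x /H; by rewrite !in_setC mem_early.
rewrite (Pr_inv R (fun s : {perm T} => [forall x in W, s x \in ~: first n m])) Pr_in.
by have -> : #|~: first n m| = (N - m)%N by rewrite -(cardsC (first n m)) card_first// addKn.
Qed.

Lemma Pr_disjoint_early_le (W : {set T}) m : (m <= N)%N ->
  Pr (fun s => [disjoint W & early s m]) <= expR (- (#|W|%:R * (m%:R / N%:R))).
Proof.
move=> mN; rewrite Pr_disjoint_early//.
apply: le_trans (ffact_ratio_le _ _ _) _; rewrite ?leq_subr ?max_card//.
rewrite -mulrN [X in expR X]mulrC expRM_natr; apply: lerXn2r; rewrite ?nnegrE ?divr_ge0 ?ler0n ?expR_ge0//.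
have [N0|N0] := posnP N; first by rewrite N0 invr0 !mulr0 oppr0 expR0.
apply: le_trans (expR_ge1Dx _); rewrite natrB// mulrBl divff// gt_eqF// ltr0n//.
Qed.

Lemma Pr_few_early (U W : {set T}) m0 m1 k c (z : R) :
  [disjoint U & W] -> (#|U| + #|W| <= c < N)%N -> (m0 <= N)%N -> 0 < z -> z <= 1 ->
  Pr (fun s => (U \subset early s m1) && (#|W :&: early s m0| <= k)%N) <=
  z ^- k * ((m1%:R / (N - c)%:R) ^+ #|U| * ((z * m0%:R + (N - m0)%:R) / (N - c)%:R) ^+ #|W|).
Proof.
move=> dUW cN m0N z0 z1.
have -> : Pr (fun s => (U \subset early s m1) && (#|W :&: early s m0| <= k)%N) =
  Pr (fun s => [forall x in U, (s^-1)%g x \in first n m1] &&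
      (#|[set x in W | (s^-1)%g x \in first n m0]| <= k)%N).
  congr (_%:R / _); apply: eq_card => s; rewrite !inE; congr (_ && _).
    by apply/subsetP/forall_inP => H x /H; rewrite mem_early.
  by congr (_ <= _)%N; apply: eq_card => x; rewrite in_setI mem_early inE.
rewrite (Pr_inv R (fun s : {perm T} => [forall x in U, s x \in first n m1] &&
      (#|[set x in W | s x \in first n m0]| <= k)%N)).
apply: le_trans (Pr_few_in_le _ _ _ dUW cN z0 z1) _.
rewrite (card_first m0N); apply: ler_wpM2l; first by rewrite invr_ge0 exprn_ge0// ltW.
apply: ler_wpM2r; first by rewrite exprn_ge0// divr_ge0 ?ler0n// addr_ge0 ?ler0n// mulr_ge0 ?ler0n// ltW.
apply: lerXn2r; rewrite ?nnegrE ?divr_ge0 ?ler0n//.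
by rewrite ler_wpM2r ?invr_ge0 ?ler0n// ler_nat card_first_le.
Qed.

Lemma sum_sets_card (f : nat -> R) (K : nat) :
  \sum_(S : {set 'I_n} | (0 < #|S| <= K)%N) f #|S| =
  \sum_(1 <= k < K.+1) ('C(n, k))%:R * f k.
Proof.
have -> : \sum_(S : {set 'I_n} | (0 < #|S| <= K)%N) f #|S| =
   \sum_(1 <= k < K.+1) \sum_(S : {set 'I_n} | #|S| == k) f #|S|.
  under [RHS]eq_bigr do rewrite big_mkcond.
  rewrite exchange_big big_mkcond /=; apply: eq_bigr => S _.
  case: ifP => cS.
    rewrite (bigD1_seq #|S|) ?iota_uniq ?mem_index_iota//= eqxx big1 ?addr0// => k.
    by rewrite eq_sym => /negPf ->.
  rewrite big_nat big1// => k kK; case: eqP => // e.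
  by move: cS; rewrite e kK.
apply: eq_bigr => k _; rewrite (eq_bigr (fun _ => f k)) => [|S /eqP ->//].
rewrite sumr_const -[LHS]mulr_natl; congr (_%:R * _).
by rewrite -[in RHS](card_ord n) -card_draws; apply: eq_card => S; rewrite inE.
Qed.

Lemma geometric_le (y : R) K : 0 <= y -> y <= 2^-1 -> \sum_(1 <= k < K.+1) y ^+ k <= 2 * y.
Proof.
move=> y0 y2; suff H : \sum_(1 <= k < K.+1) y ^+ k <= 2 * y - 2 * y ^+ K.+1.
  by apply: le_trans H _; rewrite gerBl mulr_ge0// exprn_ge0.
elim: K => [|K IH]; first by rewrite big_geq// expr1 subrr.
rewrite big_nat_recr//=; apply: le_trans (lerD IH (lexx _)) _.
rewrite [in leRHS]exprSr; set p := y ^+ K.+1.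
have p0 : 0 <= p by apply: exprn_ge0.
have : p * y <= p * 2^-1 by rewrite ler_wpM2l.
by lra.
Qed.

(* Union bound over the vertex sets of size [k] and over the [r k] edges they span. *)
Lemma Pr_dense_set (r K m : nat) (a y : R) :
  (0 < r)%N -> 0 <= a -> m%:R / N%:R <= a / n%:R -> (0 < n)%N ->
  (forall k, (0 < k <= K)%N -> (4 * n%:R / k%:R) * (2 * k%:R * a / (r%:R * n%:R)) ^+ r <= y) ->
  0 <= y -> y <= 2^-1 ->
  Pr (fun s => [exists S : {set 'I_n}, (0 < #|S| <= K)%N &&
        (2 * (r * #|S|) < volume (gnm s m) S)%N]) <= 2 * y.
Proof.
move=> r0 a0 ma n0 yP y0 y2.
apply: le_trans (_ : \sum_(S : {set 'I_n} | (0 < #|S| <= K)%N)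
   ((2 * #|S|%:R * a / (r%:R * n%:R)) ^+ r) ^+ #|S| <= _).
  apply: le_trans (Pr_sum R (I := {set 'I_n}) (P := fun S => (0 < #|S| <= K)%N)
    (B := fun S s => (r * #|S| <= #|inside S :&: early s m|)%N) _) _.
    move=> s /existsP[S /andP[cS vS]]; exists S => //.
    by have := leq_trans vS (volume_inside _ _ _); rewrite ltn_pmul2l// => /ltnW.
  apply: ler_sum => S /andP[S0 SK]; set k := #|S|.
  apply: le_trans (Pr_sum R (I := {set T}) (P := fun U => (U \subset inside S) && (#|U| == r * k)%N)
    (B := fun U s => U \subset early s m) _) _.
    move=> s big.
    have [U [_ UI cU]] : exists U : {set T},
        [/\ set0 \subset U, U \subset inside S :&: early s m & #|U| = (r * k)%N].
      by apply: subset_between; rewrite ?sub0set ?cards0.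
    by exists U; [rewrite cU eqxx andbT; apply: subset_trans UI (subsetIl _ _) | apply: subset_trans UI (subsetIr _ _)].
  apply: le_trans (_ : \sum_(U : {set T} | (U \subset inside S) && (#|U| == r * k)%N) (a / n%:R) ^+ (r * k) <= _).
    apply: ler_sum => U /andP[_ /eqP cU]; apply: le_trans (Pr_sub_early _ _) _.
    by rewrite cU; apply: lerXn2r; rewrite ?nnegrE ?divr_ge0 ?ler0n.
  rewrite sumr_const -[leLHS]mulr_natl.
  have -> : #|[pred U : {set T} | (U \subset inside S) && (#|U| == r * k)%N]| = 'C('C(k, 2), r * k).
    by rewrite -(card_inside S) -cards_draws; apply: eq_card => U; rewrite !inE.
  have rk0 : (0 < r * k)%N by rewrite muln_gt0 r0.
  apply: le_trans (ler_wpM2r _ (bin_leR _ rk0)) _; first by rewrite exprn_ge0// divr_ge0// ler0n.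
  rewrite -exprMn -exprM; apply: lerXn2r; rewrite ?nnegrE.
  - by rewrite !mulr_ge0 ?invr_ge0 ?ler0n.
  - by rewrite !mulr_ge0 ?invr_ge0 ?mulr_ge0 ?ler0n.
  have k0 : 0 < k%:R :> R by rewrite ltr0n.
  have c2 : 2 * ('C(k, 2))%:R <= k%:R ^+ 2 :> R.
    rewrite -natrX -natrM ler_nat bin2 -[leqRHS]/(k * k)%N; nia.
  rewrite [leRHS](_ : _ = 2 * k%:R ^+ 2 * (a / ((r * k)%:R * n%:R))); last first.
    by rewrite natrM; field; rewrite !gt_eqF ?ltr0n//.
  rewrite [leLHS](_ : _ = 2 * (2 * ('C(k, 2))%:R) * (a / ((r * k)%:R * n%:R))); last first.
    by rewrite natrM; field; rewrite !gt_eqF ?ltr0n//.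
  by rewrite ler_wpM2r ?ler_wpM2l ?divr_ge0 ?mulr_ge0 ?ler0n.
rewrite (sum_sets_card (fun k => ((2 * k%:R * a / (r%:R * n%:R)) ^+ r) ^+ k)).
apply: le_trans (geometric_le K y0 y2); rewrite !big_nat; apply: ler_sum => k /andP[k0 kK].
set b := _ ^+ r; have b0 : 0 <= b by rewrite exprn_ge0// !mulr_ge0 ?invr_ge0 ?mulr_ge0 ?ler0n.
apply: le_trans (ler_wpM2r _ (bin_leR _ k0)) _; first exact: exprn_ge0.
rewrite -exprMn; apply: lerXn2r; rewrite ?nnegrE//.
  by rewrite !mulr_ge0 ?invr_ge0 ?ler0n.
by apply: yP; rewrite k0.
Qed.

End RandomGraph.

(** * Cuts, unjoined pairs of sets, and low-degree patterns *)

Section RandomGraphEvents.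
Variables (R : realType) (n : nat).
Local Notation T := (Kedge n).
Local Notation N := #|{: Kedge n}|.
Local Notation Pr := (@Pr R T).

Lemma sum_sets_exp (x : R) : \sum_(S : {set 'I_n} | (0 < #|S| <= n)%N) x ^+ #|S| = (1 + x) ^+ n - 1.
Proof.
rewrite (sum_sets_card _ (fun k => x ^+ k)) exprDn big_ord_recl /= bin0 expr0 mulr1 expr1n mulr1n.
rewrite addrAC subrr add0r big_add1 /= big_mkord; apply: eq_bigr => i _.
by rewrite /bump /= add1n expr1n mul1r mulr_natl.
Qed.

Lemma not_connected_cut (g : rel 'I_n) : symmetric g -> ~~ Defs.connected g ->
  exists S : {set 'I_n}, [/\ (0 < #|S|)%N, (2 * #|S| <= n)%N &
    forall x y, x \in S -> y \notin S -> ~~ g x y].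
Proof.
move=> g_sym; rewrite negb_forall => /existsP[x]; rewrite negb_forall => /existsP[y nxy].
pose A : {set 'I_n} := [set z : 'I_n | connect g x z].
have Ax : x \in A by rewrite inE connect0.
have Ay : y \in ~: A by rewrite !inE.
have cut u v : u \in A -> v \notin A -> ~~ g u v.
  rewrite !inE => xu; apply: contra => guv.
  exact: connect_trans xu (connect1 guv).
have cA : (#|A| + #|~: A| = n)%N by rewrite cardsC card_ord.
have [le|gt] := leqP (2 * #|A|)%N n.
  by exists A; split=> //; apply/card_gt0P; exists x.
exists (~: A); split; [by apply/card_gt0P; exists y | lia |].
by move=> u v; rewrite !in_setC negbK => uA vA; rewrite g_sym; apply: cut.
Qed.

(** A cut with smaller side [S] has at least |S| n / 2 edges. The union bound over all [S] is then a
    binomial sum. *)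
Lemma Pr_disconnected m : (m <= N)%N ->
  Pr (fun s => ~~ Defs.connected (gnm s m)) <=
  expR (n%:R * expR (- (n%:R / 2 * (m%:R / N%:R)))) - 1.
Proof.
move=> mN; set rho := expR (- _).
apply: le_trans (_ : (1 + rho) ^+ n - 1 <= _); last first.
  rewrite lerB// mulrC expRM_natr; apply: lerXn2r; rewrite ?nnegrE ?expR_ge0 ?addr_ge0 ?expR_ge0//.
  exact: expR_ge1Dx.
rewrite -sum_sets_exp.
apply: le_trans (Pr_sum R (I := {set 'I_n}) (P := fun S => (0 < #|S|)%N && (2 * #|S| <= n)%N)
  (B := fun S s => [disjoint between S (~: S) & early s m]) _) _.
  move=> s /(not_connected_cut (gnm_sym s m))[S [S0 Sn cut]]; exists S; first by rewrite S0.
  apply/pred0P=> e /=; apply/negP=> /andP[/mem_between[x [y [xS yS ee]]] em].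
  have := cut x y xS; rewrite -in_setC => /(_ yS) /negP; apply.
  by apply/gnmP; exists e.
apply: le_trans (_ : \sum_(S : {set 'I_n} | (0 < #|S|)%N && (2 * #|S| <= n)%N) rho ^+ #|S| <= _).
  apply: ler_sum => S /andP[S0 Sn]; apply: le_trans (Pr_disjoint_early_le R _ mN) _.
  rewrite card_between; last by apply/pred0P=> x; rewrite /= !inE andbN.
  rewrite /rho -expRM_natr ler_expR mulNr lerN2 mulrAC ler_wpM2r ?divr_ge0 ?ler0n//.
  have cC : #|~: S| = (n - #|S|)%N by have := cardsC S; rewrite card_ord; lia.
  have Sn' : (#|S| <= n)%N by lia.
  rewrite cC natrM mulrC ler_wpM2l ?ler0n// natrB//.
  have : 2 * #|S|%:R <= n%:R :> R by rewrite -natrM ler_nat.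
  by lra.
rewrite big_mkcond [leRHS]big_mkcond /=; apply: ler_sum => S _.
case: ifP => [/andP[-> Sn]|_]; last by case: ifP => // _; rewrite exprn_ge0 ?expR_ge0.
by rewrite (leq_trans _ Sn)// leq_pmull.
Qed.

Lemma Pr_unjoined m L : (m <= N)%N ->
  Pr (fun s => [exists X : {set 'I_n}, [exists Z : {set 'I_n},
     [&& [disjoint X & Z], (L <= #|X| * #|Z|)%N & [disjoint between X Z & early s m]]]]) <=
  4 ^+ n * expR (- (L%:R * (m%:R / N%:R))).
Proof.
move=> mN.
apply: le_trans (Pr_sum R (I := ({set 'I_n} * {set 'I_n})%type)
  (P := fun p => [disjoint p.1 & p.2] && (L <= #|p.1| * #|p.2|)%N)
  (B := fun p s => [disjoint between p.1 p.2 & early s m]) _) _.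
  by move=> s /existsP[X /existsP[Z /and3P[dXZ le no]]]; exists (X, Z); rewrite /= ?dXZ.
apply: le_trans (_ : \sum_(p : {set 'I_n} * {set 'I_n}) expR (- (L%:R * (m%:R / N%:R))) <= _).
  rewrite big_mkcond; apply: ler_sum => -[X Z] _ /=; case: ifP => [/andP[dXZ le]|_]; last exact: expR_ge0.
  apply: le_trans (Pr_disjoint_early_le R _ mN) _; rewrite card_between// ler_expR lerN2.
  by rewrite ler_wpM2r ?divr_ge0 ?ler0n// ler_nat.
rewrite sumr_const -[leLHS]mulr_natl ler_wpM2r ?expR_ge0//.
rewrite -natrX ler_nat card_prod -cardsT -powersetT card_powerset cardsT card_ord.
by rewrite -expnMn.
Qed.

Lemma card_edges_of_le (P : {set {set 'I_n}}) : (#|edges_of P| <= #|P|)%N.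
Proof.
rewrite -(card_imset _ (@ends_inj n)); apply/subset_leq_card/subsetP => _ /imsetP[e + ->].
by rewrite inE.
Qed.

Lemma between_early_degree (s : {perm T}) m (Sp Q : {set 'I_n}) :
  (#|between Sp (Q :\: Sp) :&: early s m| <= \sum_(u in Sp) #|nbrs (gnm s m) [set u] :&: Q|)%N.
Proof.
pose E u := edges_of [set [set u; z] | z in nbrs (gnm s m) [set u] :&: Q].
apply: leq_trans (_ : (#|\bigcup_(u in Sp) E u| <= _)%N).
  apply/subset_leq_card/subsetP => e; rewrite inE => /andP[/mem_between[u [z [uS]]]].
  rewrite inE => /andP[_ zQ] ee em; apply/bigcupP; exists u => //; rewrite inE.
  apply/imsetP; exists z => //; rewrite inE zQ andbT; apply/nbrsP; exists u; first by rewrite inE.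
  by apply/gnmP; exists e.
elim/big_rec2: _ => [|u k A _ le]; first by rewrite cards0.
apply: leq_trans (leq_card_setU _ _) (leq_add _ le).
exact: leq_trans (card_edges_of_le _) (leq_imset_card _ _).
Qed.

(* [U] is a set of edges of the later graph, [Sp] a set of vertices that have few
   neighbours in [Q] in the earlier graph. *)
Lemma Pr_low_pattern (U : {set T}) (Sp Q : {set 'I_n}) m0 m1 D c w (z : R) :
  (#|U| + #|Sp| * #|Q| <= c < N)%N -> (m0 <= N)%N -> 0 < z -> z <= 1 ->
  (w + #|U| + #|Sp| * #|Sp| <= #|Sp| * #|Q|)%N ->
  z * m0%:R + (N - m0)%:R <= (N - c)%:R :> R ->
  Pr (fun s => (U \subset early s m1) && (Sp \subset low_degree (gnm s m0) D Q)) <=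
  z ^- (#|Sp| * D) * ((m1%:R / (N - c)%:R) ^+ #|U| *
     ((z * m0%:R + (N - m0)%:R) / (N - c)%:R) ^+ w).
Proof.
move=> cN m0N z0 z1 wle base.
(* Edges inside [Sp] would be counted from both ends, and edges of [U] are already required to be
   present; leaving both out costs at most |Sp|^2 + |U| edges. *)
pose W := between Sp (Q :\: Sp) :\: U.
have dS : [disjoint Sp & Q :\: Sp].
  by apply/pred0P=> x; rewrite /= !inE; case: (x \in Sp).
have cW : (w <= #|W| <= #|Sp| * #|Q|)%N.
  rewrite /W cardsD card_between//.
  have : (#|between Sp (Q :\: Sp) :&: U| <= #|U|)%N by apply/subset_leq_card/subsetIr.
  have : (#|Q :\: Sp| + #|Sp| >= #|Q|)%N.
    by rewrite cardsD; have := subset_leq_card (subsetIr Q Sp); lia.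
  have : (#|Q :\: Sp| <= #|Q|)%N by apply/subset_leq_card/subsetDl.
  by nia.
case/andP: cW => wW WQ.
have dUW : [disjoint U & W] by apply/pred0P=> x; rewrite /= !inE; case: (x \in U).
have cN' : (#|U| + #|W| <= c < N)%N.
  by case/andP: cN => c1 ->; rewrite andbT; apply: leq_trans c1; rewrite leq_add2l.
apply: le_trans (Pr_le R (b' := fun s => (U \subset early s m1) && (#|W :&: early s m0| <= #|Sp| * D)%N) _) _.
  move=> s /andP[-> /subsetP low] /=.
  apply: leq_trans (_ : #|between Sp (Q :\: Sp) :&: early s m0| <= _)%N.
    by apply/subset_leq_card/setSI/subsetDl.
  apply: leq_trans (between_early_degree _ _ _ _) _.
  by rewrite -sum_nat_const; apply: leq_sum => u /low; rewrite inE => /ltnW.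
apply: le_trans (Pr_few_early _ _ dUW cN' m0N z0 z1) _.
apply: ler_wpM2l; first by rewrite invr_ge0 exprn_ge0// ltW.
apply: ler_wpM2l; first by rewrite exprn_ge0// divr_ge0 ?ler0n.
apply: ler_wiXn2l => //.
  by rewrite divr_ge0 ?ler0n// addr_ge0 ?ler0n// mulr_ge0 ?ler0n// ltW.
rewrite ler_pdivrMr ?mul1r//.
by rewrite ltr0n subn_gt0; case/andP: cN.
Qed.

End RandomGraphEvents.

(** * Isolated vertices *)

Section SecondMoment.
Variables (R : realType) (n : nat).
Local Notation T := (Kedge n).
Local Notation N := #|{: Kedge n}|.
Local Notation Pr := (@Pr R T).

Definition star (v : 'I_n) : {set T} := between [set v] (~: [set v]).

Lemma mem_star v e : (e \in star v) = (v \in ends e).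
Proof.
apply/mem_between/idP => [[x [z []]]|]; first by rewrite inE => /eqP -> _ ->; rewrite !inE eqxx.
have ne := ends_ne e; rewrite /ends !inE => /orP[]/eqP ->.
  by exists (val e).1, (val e).2; split; rewrite ?inE// eq_sym.
by exists (val e).2, (val e).1; split; rewrite ?inE// setUC.
Qed.

Lemma card_star v : #|star v| = n.-1.
Proof.
rewrite card_between; last by apply/pred0P=> x; rewrite /= !inE andbN.
by rewrite cards1 mul1n cardsCs setCK cards1 card_ord subn1.
Qed.

Lemma card_star2 u v : u != v -> #|star u :|: star v| = (n.-1 + n.-1).-1.
Proof.
move=> uv; rewrite cardsU !card_star.
have [|e ee] := @ends_onto n [set u; v]; first by rewrite cards2 uv.
suff -> : star u :&: star v = [set e] by rewrite cards1 subn1.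
apply/setP=> e'; rewrite in_setI !mem_star in_set1.
apply/andP/eqP => [[ue ve]|->]; last by rewrite ee !inE !eqxx orbT.
apply: ends_inj; rewrite ee; apply/esym/eqP; rewrite eqEcard card_ends cards2 uv leqnn andbT.
by rewrite subUset !sub1set ue ve.
Qed.

Definition isolated (s : {perm T}) m v := [disjoint star v & early s m].

Lemma connected_not_isolated s m v : (1 < n)%N -> Defs.connected (gnm s m) -> ~~ isolated s m v.
Proof.
move=> n1 /forallP/(_ v)/forallP c.
have [u uv] : exists u, u != v.
  have : (0 < #|~: [set v]|)%N by have := cardsC [set v]; rewrite cards1 card_ord; lia.
  by case/card_gt0P=> u; rewrite !inE => uv; exists u.
have /connectP[[|x p] /=] := c u; first by move=> _ e; rewrite e eqxx in uv.
move=> /andP[/gnmP[e ee em] _] _; apply/pred0Pn; exists e.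
by rewrite /= mem_star ee em in_set2 eqxx.
Qed.

Lemma ffact_split K a b : (K ^_ (a + b) = K ^_ a * (K - a) ^_ b)%N.
Proof.
elim: b => [|b IH]; first by rewrite addn0 muln1.
by rewrite addnS !ffactnSr IH -mulnA subnDA.
Qed.

Lemma ffact_cross K M a b : (K <= M)%N ->
  ((K - b) ^_ a * M ^_ a <= K ^_ a * (M - b) ^_ a)%N.
Proof.
move=> KM; elim: a => [//|a IH]; rewrite !ffactnSr.
rewrite mulnACA [leqRHS]mulnACA; apply: leq_mul => //.
by nia.
Qed.

(** Two stars of [w] edges share one edge, hence [(w + w).-1]. Drawing without replacement
    correlates absences negatively, which is [ffact_cross]; the shared edge accounts for the last
    factor. *)
Lemma ffact_second_moment K M w : (K <= M)%N -> (0 < w)%N -> (2 * w <= K)%N ->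
  (K ^_ (w + w).-1)%:R / (M ^_ (w + w).-1)%:R <=
  ((K ^_ w)%:R / (M ^_ w)%:R) ^+ 2 * ((M - w.-1)%:R / (K - w.-1)%:R) :> R.
Proof.
move=> KM w0 wK; have -> : (w + w).-1 = (w + w.-1)%N by lia.
have pos L a : (w + w <= L)%N -> (a <= w + w)%N -> 0 < (L ^_ a)%:R :> R.
  by move=> wL aw; rewrite ltr0n ffact_gt0; lia.
have posK : 0 < (K - w.-1)%:R :> R by rewrite ltr0n; lia.
have wM : (w + w <= M)%N by lia.
have wK' : (w + w <= K)%N by lia.
rewrite ler_pdivrMr; last by apply: pos => //; lia.
have posMw := pos M w wM (leq_addr _ _).
rewrite [leRHS](_ : _ = ((K ^_ w)%:R ^+ 2 * ((M - w.-1)%:R * (M ^_ (w + w.-1))%:R)) /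
   ((M ^_ w)%:R ^+ 2 * (K - w.-1)%:R)); last by field; rewrite !gt_eqF.
rewrite ler_pdivlMr ?mulr_gt0 ?exprn_gt0//.
rewrite -!natrX -!natrM ler_nat !ffact_split.
have e L : (L ^_ w = L ^_ w.-1 * (L - w.-1))%N by rewrite -{1}(prednK w0) ffactnSr.
have := ffact_cross w.-1 w KM.
rewrite !e -[((_ * _) ^ 2)%N]/((_ * _) * (_ * _))%N -[((K ^_ w.-1 * _) ^ 2)%N]/((_ * _) * (_ * _))%N.
set k1 := (K ^_ w.-1)%N; set k2 := (K - w.-1)%N; set k3 := ((K - w) ^_ w.-1)%N.
set l1 := (M ^_ w.-1)%N; set l2 := (M - w.-1)%N; set l3 := ((M - w) ^_ w.-1)%N => le.
have -> : (k1 * k2 * k3 * (l1 * l2 * (l1 * l2) * k2) = (k1 * k2 * k2 * l1 * l2 * l2) * (k3 * l1))%N by ring.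
have -> : (k1 * k2 * (k1 * k2) * (l2 * (l1 * l2 * l3)) = (k1 * k2 * k2 * l1 * l2 * l2) * (k1 * l3))%N by ring.
by rewrite leq_mul2l le orbT.
Qed.

Lemma ffact_ratio_ge K M w : (K <= M)%N -> (w < K)%N ->
  expR (- (w%:R * ((M - K)%:R / (K - w)%:R))) <= (K ^_ w)%:R / (M ^_ w)%:R :> R.
Proof.
move=> KM wK.
have Kw : 0 < (K - w)%:R :> R by rewrite ltr0n subn_gt0.
have H a : (a <= w)%N -> expR (- (a%:R * ((M - K)%:R / (K - w)%:R))) <= (K ^_ a)%:R / (M ^_ a)%:R :> R.
  elim: a => [|a IH] aw; first by rewrite mul0r oppr0 expR0 !ffactn0 divr1.
  rewrite !ffactnSr !natrM invfM mulrACA -natr1 mulrDl mul1r opprD expRD.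
  apply: ler_pM; rewrite ?expR_ge0 ?IH//; first exact: ltnW.
  have Ka : 0 < (K - a)%:R :> R by rewrite ltr0n; lia.
  have Ma : 0 < (M - a)%:R :> R by rewrite ltr0n; lia.
  rewrite expRN -[leRHS]invrK lef_pV2 ?posrE ?invr_gt0 ?divr_gt0 ?expR_gt0//.
  rewrite invf_div; apply: le_trans (expR_ge1Dx _).
  rewrite ler_pdivrMr// mulrDl mul1r.
  have -> : (M - a)%:R = (K - a)%:R + (M - K)%:R :> R by rewrite -natrD; congr _%:R; lia.
  rewrite lerD2l mulrAC -mulrA ler_peMr ?ler0n//.
  by rewrite ler_pdivlMr// mul1r ler_nat; lia.
exact: H.
Qed.

Lemma Pr_E (b : pred {perm T}) : Pr b = (\sum_(s : {perm T}) (b s)%:R) / (N`!)%:R.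
Proof.
rewrite /Pr -sum1_card natr_sum big_mkcond /=; congr (_ / _).
by apply: eq_bigr => s _; rewrite inE; case: (b s).
Qed.

(* Chebyshev's inequality for the number of isolated vertices. *)
Lemma Pr_connected_early m : (1 < n)%N -> (m <= N)%N -> (2 * n <= N - m)%N ->
  Pr (fun s => Defs.connected (gnm s m)) <=
  expR (n%:R * (m%:R / (N - m - n)%:R)) / n%:R + m%:R / (N - m - n)%:R.
Proof.
move=> n1 mN nK; set w := n.-1; set K := (N - m)%N in nK *.
pose p1 : R := (K ^_ w)%:R / (N ^_ w)%:R.
pose p2 : R := (K ^_ (w + w).-1)%:R / (N ^_ (w + w).-1)%:R.
have w0 : (0 < w)%N by rewrite /w; lia.
have wn : (w <= n)%N by rewrite /w; lia.
have KN : (K <= N)%N by rewrite /K leq_subr.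
have F0 : 0 < (N`!)%:R :> R by exact: factR_gt0.
have n0 : 0 < n%:R :> R by rewrite ltr0n; lia.
have p10 : 0 < p1.
  by rewrite divr_gt0// ltr0n ffact_gt0; lia.
have E1 v : (\sum_(s : {perm T}) (isolated s m v)%:R) = p1 * (N`!)%:R :> R.
  have := Pr_disjoint_early R (star v) mN; rewrite card_star -/p1 Pr_E => /esym ->.
  by rewrite mulfVK// gt_eqF.
have E2 u v : u != v -> (\sum_(s : {perm T}) (isolated s m u && isolated s m v)%:R) = p2 * (N`!)%:R :> R.
  move=> uv; have := Pr_disjoint_early R (star u :|: star v) mN; rewrite card_star2// -/p2 Pr_E.
  have -> : \sum_(s : {perm T}) [disjoint star u :|: star v & early s m]%:R =
            \sum_(s : {perm T}) (isolated s m u && isolated s m v)%:R :> R.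
    by apply: eq_bigr => s _; rewrite /isolated !disjoints_subset subUset.
  by move=> /esym ->; rewrite mulfVK// gt_eqF.
pose X (s : {perm T}) : R := \sum_v (isolated s m v)%:R.
pose mu := n%:R * p1.
have SX : \sum_s X s = mu * (N`!)%:R.
  rewrite exchange_big /= (eq_bigr _ (fun v _ => E1 v)) sumr_const card_ord -[LHS]mulr_natl.
  by rewrite mulrA.
have SX2 : \sum_s X s ^+ 2 = (mu + (n%:R ^+ 2 - n%:R) * p2) * (N`!)%:R.
  transitivity (\sum_u \sum_v \sum_(s : {perm T}) (isolated s m u && isolated s m v)%:R : R).
    rewrite [RHS](eq_bigr (fun u => \sum_(s : {perm T}) \sum_v (isolated s m u && isolated s m v)%:R)); last first.
      by move=> u _; rewrite exchange_big.
    rewrite [RHS]exchange_big /=; apply: eq_bigr => s _; rewrite expr2 /X mulr_suml.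
    apply: eq_bigr => u _; rewrite mulr_sumr; apply: eq_bigr => v _.
    by rewrite -natrM mulnb.
  rewrite (eq_bigr (fun _ => (p1 + (n%:R - 1) * p2) * (N`!)%:R)); last first.
    move=> u _; rewrite (bigD1 u)//= [X in _ + X](eq_bigr (fun _ => p2 * (N`!)%:R)); last first.
      by move=> v vu; rewrite E2// eq_sym.
    rewrite [X in X + _](eq_bigr (fun s => (isolated s m u)%:R)) => [|s _]; last by rewrite andbb.
    rewrite E1 sumr_const -[X in _ + X]mulr_natl mulrDl; congr (_ + _).
    rewrite mulrA; congr (_ * _ * _).
    have -> : #|[pred v | v != u]| = n.-1.
      by transitivity #|predC1 u|; [apply: eq_card | rewrite cardC1 card_ord].
    by rewrite -subn1 natrB//; lia.
  rewrite sumr_const card_ord -[LHS]mulr_natl /mu; ring.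
(* On a connected graph [X] vanishes, so the squared deviation equals [mu ^+ 2]. *)
have cheb : Pr (fun s => Defs.connected (gnm s m)) * (N`!)%:R * mu ^+ 2 <=
    \sum_s (X s - mu) ^+ 2.
  rewrite Pr_E mulfVK ?gt_eqF// mulr_suml; apply: ler_sum => s _.
  have [c|] := boolP (Defs.connected _); last by rewrite mul0r sqr_ge0.
  have -> : X s = 0.
    by rewrite /X big1// => v _; rewrite (negPf (connected_not_isolated v n1 c)).
  by rewrite mul1r sub0r sqrrN.
have var : \sum_s (X s - mu) ^+ 2 = (mu + (n%:R ^+ 2 - n%:R) * p2 - mu ^+ 2) * (N`!)%:R.
  under eq_bigr do rewrite sqrrB.
  rewrite big_split /= sumrB SX2.
  have -> : \sum_(s : {perm T}) mu ^+ 2 = mu ^+ 2 * (N`!)%:R.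
    by rewrite sumr_const card_perms -[LHS]mulr_natr.
  have -> : \sum_(s : {perm T}) X s * mu *+ 2 = 2 * mu * (mu * (N`!)%:R).
    by rewrite -SX mulr_sumr; apply: eq_bigr => s _; rewrite -mulr_natl; ring.
  ring.
rewrite var mulrAC ler_pM2r// in cheb.
have ratio := ffact_second_moment KN w0 (_ : 2 * w <= K)%N; rewrite -/p1 -/p2 in ratio.
have {}ratio : p2 <= p1 ^+ 2 * ((N - w.-1)%:R / (K - w.-1)%:R) by apply: ratio; lia.
have dK : 0 < (K - n)%:R :> R by rewrite ltr0n; lia.
have dK' : 0 < (K - w.-1)%:R :> R by rewrite ltr0n; lia.
have ratio2 : p2 <= p1 ^+ 2 * (1 + m%:R / (K - n)%:R).
  apply: le_trans ratio _; rewrite ler_pM2l ?exprn_gt0//.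
  have -> : (N - w.-1)%:R = (K - w.-1)%:R + m%:R :> R by rewrite -natrD; congr _%:R; rewrite /K; lia.
  rewrite mulrDl divff ?gt_eqF// lerD2l ler_wpM2l ?ler0n// lef_pV2 ?posrE// ler_nat; lia.
have p1l : expR (- (n%:R * (m%:R / (K - n)%:R))) <= p1.
  have wK : (w < K)%N by lia.
  apply: le_trans (ffact_ratio_ge KN wK).
  rewrite ler_expR lerN2; have -> : (N - K = m)%N by rewrite /K subKn.
  apply: ler_pM; rewrite ?ler0n ?divr_ge0 ?ler0n ?ler_nat//.
  by rewrite ler_wpM2l ?ler0n// lef_pV2 ?posrE ?ler_nat ?ltr0n//; lia.
have mu0 : 0 < mu by rewrite mulr_gt0.
apply: le_trans (_ : mu^-1 + m%:R / (K - n)%:R <= _); last first.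
  rewrite lerD2r /mu invfM mulrC ler_wpM2r ?invr_ge0 ?ler0n//.
  by rewrite -[leRHS]invrK -expRN lef_pV2 ?posrE ?expR_gt0.
rewrite -(ler_pM2r (exprn_gt0 2 mu0)); apply: le_trans cheb _.
rewrite [leRHS]mulrDl (_ : mu^-1 * mu ^+ 2 = mu); last by rewrite expr2 mulKf ?gt_eqF.
rewrite -addrA lerD2l lerBlDr.
have -> : mu ^+ 2 = n%:R ^+ 2 * p1 ^+ 2 by rewrite /mu exprMn.
apply: le_trans (_ : n%:R ^+ 2 * p2 <= _).
  by rewrite ler_wpM2r ?divr_ge0 ?ler0n// gerBl ler0n.
apply: le_trans (ler_wpM2l _ ratio2) _; first by rewrite exprn_ge0 ?ler0n.
by rewrite le_eqVlt; apply/orP; left; apply/eqP; ring.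
Qed.

End SecondMoment.

(** * First moment estimates *)

Section Estimates.
Variables (R : realType) (n h : nat).
Local Notation T := (Kedge n).
Local Notation N := #|{: Kedge n}|.
Local Notation Pr := (@Pr R T).
Hypothesis h_large : (5000 <= h)%N.
Hypothesis n_large : (1000 * h <= n)%N.

(** The edge density is about 0.8 h / n. This is low enough to leave about n^(1/5) isolated
    vertices, and high enough for two vertices with few neighbours in nine tenths of the graph to be
    jointly rarer than 1/n. *)
Definition m_low := ((2 * n * h) %/ 5)%N.
Definition m_high := (4 * n * h)%N.

Lemma est_n0 : 0 < n%:R :> R.
Proof. by rewrite ltr0n; lia. Qed.

Lemma est_n20 : (20 <= n)%N.
Proof. by lia. Qed.

Lemma est_N : N%:R = n%:R * (n%:R - 1) / 2 :> R.
Proof.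
have : (2 * N = n * n.-1)%N by rewrite card_Kedge -mul_bin_diag bin1.
move=> e; have : 2 * N%:R = n%:R * (n%:R - 1) :> R.
  by rewrite -natrM e natrM -subn1 natrB//; lia.
lra.
Qed.

Lemma est_low_le : m_low%:R <= 2 / 5 * (n%:R * h%:R) :> R.
Proof.
have : (5 * m_low <= 2 * n * h)%N by rewrite mulnC leq_trunc_div.
by rewrite -(ler_nat R) !natrM => ?; lra.
Qed.

Lemma est_low_ge : 2 / 5 * (n%:R * h%:R) - 1 <= m_low%:R :> R.
Proof.
have : (2 * n * h <= 5 * m_low + 5)%N by have := ltn_ceil (2 * n * h) (isT : 0 < 5)%N; rewrite -/m_low; lia.
by rewrite -(ler_nat R) natrD !natrM => ?; lra.
Qed.

Lemma est_h : 5000 <= h%:R :> R. Proof. by rewrite ler_nat. Qed.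

Lemma est_nh : 1000 * h%:R <= n%:R :> R.
Proof. by rewrite -natrM ler_nat. Qed.

Lemma est_N0 : 0 < N%:R :> R.
Proof. rewrite est_N; have := est_nh; have := est_h; nra. Qed.

Lemma est_low_N : (m_low <= N)%N.
Proof.
rewrite -(ler_nat R) est_N; have := est_low_le; have := est_nh; have := est_h; nra.
Qed.

Lemma est_high_N : (m_high <= N)%N.
Proof.
rewrite -(ler_nat R) est_N /m_high !natrM; have := est_nh; have := est_h; nra.
Qed.

Lemma est_density_ge : 79 / 100 * h%:R / n%:R <= m_low%:R / N%:R :> R.
Proof.
have n0 := est_n0; have N0 := est_N0.
rewrite ler_pdivlMr// mulrAC ler_pdivrMr// est_N.
have := est_low_ge; have := est_nh; have := est_h.
set x := n%:R in n0 *; set y := h%:R; set m := m_low%:R => y5 xy ml.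
have xx : 0 <= (m - (2 / 5 * (x * y) - 1)) * x by rewrite mulr_ge0 ?subr_ge0 ?ler0n.
have xy0 : 0 <= (x * y) * x by rewrite !mulr_ge0 ?ler0n.
have xy1 : 0 <= (x * (y - 5000)) * x by rewrite !mulr_ge0 ?subr_ge0 ?ler0n.
have x2 : 0 <= (x - 1000 * 5000) * x by rewrite mulr_ge0 ?ler0n// subr_ge0; lra.
nra.
Qed.

Lemma est_density_le : m_low%:R / N%:R <= h%:R / n%:R :> R.
Proof.
have n0 := est_n0; have N0 := est_N0.
rewrite ler_pdivrMr// mulrAC ler_pdivlMr// est_N.
have := est_low_le; have := est_nh; have := est_h.
set x := n%:R in n0 *; set y := h%:R; set m := m_low%:R => y5 xy ml.
have xx : 0 <= (2 / 5 * (x * y) - m) * x by rewrite mulr_ge0 ?subr_ge0 ?ler0n.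
have xy1 : 0 <= (x * y) * (x - 1000) by rewrite !mulr_ge0 ?ler0n// subr_ge0; lra.
nra.
Qed.

Lemma est_density_high : 8 * h%:R / n%:R <= m_high%:R / N%:R :> R.
Proof.
have n0 := est_n0; have N0 := est_N0.
rewrite ler_pdivlMr// mulrAC ler_pdivrMr// est_N /m_high !natrM.
have := est_nh; have := est_h.
set x := n%:R in n0 *; set y := h%:R => y5 xy.
have xy1 : 0 <= (x * y) * x by rewrite !mulr_ge0 ?ler0n.
nra.
Qed.

(** [21 * n] bounds the edges that a pattern involves: at most 20 present ones, and at most n for
    each of at most 20 low vertices. *)
Lemma est_c : (21 * n < N)%N.
Proof. rewrite -(ltr_nat R) est_N natrM; have := est_nh; have := est_h; nra. Qed.

Lemma est_Nc : 2 / 5 * n%:R ^+ 2 <= (N - 21 * n)%:R :> R.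
Proof.
rewrite natrB; last exact: ltnW est_c.
rewrite est_N natrM; have := est_nh; have := est_h; nra.
Qed.

Lemma est_Nc0 : 0 < (N - 21 * n)%:R :> R.
Proof. by rewrite ltr0n subn_gt0 est_c. Qed.

Lemma est_high_density_le : m_high%:R / (N - 21 * n)%:R <= 10 * h%:R / n%:R :> R.
Proof.
have n0 := est_n0; have c := est_Nc; have hh := est_h.
have c0 := est_Nc0.
rewrite ler_pdivrMr// mulrAC ler_pdivlMr// /m_high !natrM.
have : 0 <= h%:R * ((N - 21 * n)%:R - 2 / 5 * n%:R ^+ 2) :> R by rewrite mulr_ge0 ?subr_ge0//; lra.
nra.
Qed.

Lemma est_base_le :
  20^-1 * m_low%:R + (N - m_low)%:R <= (N - 21 * n)%:R - 375 / 1000 * (n%:R * h%:R) :> R.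
Proof.
have := est_low_N; have := est_c => c l; rewrite !natrB//; last exact: ltnW.
have := est_low_ge; have := est_nh; have := est_h; rewrite natrM.
set x := n%:R; set y := h%:R; set m := m_low%:R => y5 xy ml.
have : 0 <= x * (y - 5000) by rewrite mulr_ge0 ?subr_ge0 ?ler0n.
nra.
Qed.

Lemma est_base :
  (20^-1 * m_low%:R + (N - m_low)%:R) / (N - 21 * n)%:R <= expR (- (75 / 100 * (h%:R / n%:R))) :> R.
Proof.
have n0 := est_n0; have c := est_Nc; have hh := est_h.
have c0 := est_Nc0.
apply: le_trans (expR_ge1Dx _); rewrite ler_pdivrMr// mulrDl mul1r.
apply: le_trans est_base_le _; rewrite lerD2l mulNr lerN2.
have cN : (N - 21 * n)%:R <= n%:R ^+ 2 / 2 :> R.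
  by apply: le_trans (_ : N%:R <= _); [rewrite ler_nat leq_subr | rewrite est_N; nra].
apply: le_trans (ler_wpM2l _ cN) _; first by rewrite mulr_ge0 ?divr_ge0//; lra.
rewrite le_eqVlt; apply/orP; left; apply/eqP; field.
by rewrite gt_eqF.
Qed.

Definition tiny : R := expR 1 * (10 * h%:R) ^+ 20 * expR (- (9 / 100 * h%:R)).

Lemma exp20_le : 20 <= expR 5 :> R.
Proof.
have -> : 5 = 1 * 5%:R :> R by rewrite mul1r.
rewrite expRM_natr; apply: le_trans (_ : 2 ^+ 5 <= _).
  by rewrite -natrX ler_nat.
apply: lerXn2r; rewrite ?nnegrE ?expR_ge0 ?ler0n//.
by apply: le_trans (expR_ge1Dx 1); lra.
Qed.

(** Exponents in units of [h], with Markov parameter 1/20. The absent edges contribute 1.79 * 0.75 >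
    1.34. The few neighbours allowed cost 20^(s h / 400), at most e^(h/4) because 20 <= e^5 and s <=
    20. What remains, 1.09, exceeds 1. *)
Lemma Pr_pattern_le (U : {set T}) (Sp Q : {set 'I_n}) (f s : nat) :
  #|U| = f -> #|Sp| = s -> (f <= 20)%N -> (s <= 20)%N ->
  179 / 100 * n%:R + (f + s * s)%:R + 1 <= (s * #|Q|)%:R :> R ->
  Pr (fun p => (U \subset early p m_high) && (Sp \subset low_degree (gnm p m_low) (h %/ 400) Q)) <=
  (10 * h%:R / n%:R) ^+ f * expR (- (109 / 100 * h%:R)).
Proof.
move=> cU cS f20 s20 wQ.
have n0 := est_n0; have c := est_Nc; have hh := est_h.
have c0 := est_Nc0.
have Qn : (#|Q| <= n)%N by rewrite -[leqRHS]card_ord max_card.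
pose w := (s * #|Q| - (f + s * s))%N.
have fsQ : (f + s * s <= s * #|Q|)%N.
  by rewrite -(ler_nat R); have := ler0n R n; lra.
have wE : (w + (f + s * s) = s * #|Q|)%N by rewrite subnK.
have wl : 179 / 100 * n%:R <= w%:R :> R.
  by move: wQ; rewrite -wE natrD; lra.
have cN : (#|U| + #|Sp| * #|Q| <= 21 * n < N)%N.
  rewrite est_c andbT cU cS; have sQ : (s * #|Q| <= 20 * n)%N by apply: leq_mul.
  by apply: leq_trans (leq_add f20 sQ) _; rewrite (mulnDl 1 20 n) mul1n leq_add2r est_n20.
have base0 : 0 <= (20^-1 * m_low%:R + (N - m_low)%:R) / (N - 21 * n)%:R :> R.
  by rewrite divr_ge0 ?ler0n// addr_ge0 ?ler0n// mulr_ge0 ?invr_ge0 ?ler0n.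
apply: le_trans (Pr_low_pattern _ _ (z := 20^-1) (w := w) cN est_low_N _ _ _ _) _.
- by rewrite invr_gt0.
- by rewrite invf_le1// ler1n.
- by rewrite cU cS -addnA wE.
- by apply: le_trans est_base_le _; rewrite gerBl mulr_ge0 ?mulr_ge0 ?ler0n//; lra.
rewrite cU cS mulrCA; apply: ler_pM.
- by rewrite exprn_ge0// divr_ge0 ?ler0n.
- by rewrite mulr_ge0 ?exprn_ge0// invr_ge0 exprn_ge0// invr_ge0 ler0n.
- apply: lerXn2r; rewrite ?nnegrE ?est_high_density_le//.
    by rewrite divr_ge0 ?ler0n.
  by rewrite !mulr_ge0 ?invr_ge0 ?ler0n.
apply: le_trans (_ : expR (25 / 100 * h%:R) * expR (- (134 / 100 * h%:R)) <= _); last first.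
  by rewrite -expRD ler_expR; lra.
apply: ler_pM.
- by rewrite invr_ge0 exprn_ge0// invr_ge0 ler0n.
- exact: exprn_ge0.
- rewrite exprVn invrK; apply: le_trans (_ : expR 5 ^+ (s * (h %/ 400)) <= _).
    by apply: lerXn2r; rewrite ?nnegrE ?expR_ge0 ?ler0n ?exp20_le.
  rewrite -expRM_natr ler_expR.
  have : (s * (h %/ 400) * 20 <= h)%N.
    apply: leq_trans (_ : 20 * (h %/ 400) * 20 <= _)%N; first by rewrite !leq_mul2r s20 !orbT.
    by rewrite -mulnA mulnCA leq_trunc_div.
  by rewrite -(ler_nat R) natrM; move: (s * _)%N%:R => k; lra.
apply: le_trans (_ : expR (- (75 / 100 * (h%:R / n%:R))) ^+ w <= _).
  by apply: lerXn2r; rewrite ?nnegrE ?expR_ge0// est_base.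
rewrite -expRM_natr ler_expR mulNr lerN2.
have hn0 : 0 <= h%:R / n%:R :> R by rewrite divr_ge0 ?ler0n.
have -> : 134 / 100 * h%:R = 134 / 100 * ((h%:R / n%:R) * n%:R) :> R by rewrite divfK// gt_eqF.
have := ler_wpM2l hn0 wl; move: hn0 (mulr_ge0 hn0 (ler0n R n)).
move: (h%:R / n%:R) => a; move: n%:R => x; move: w%:R => y; clear; lra.
Qed.

Hypothesis nh : n%:R <= expR h.+1%:R :> R.

(** In the applications the patterns are trees with [f] edges: n^(f+1) choices against n^(-f) leave
    one factor n, at most e^(h+1), which the exponent 1.09 beats. *)
Lemma Pr_patterns_le (I : finType) (P : pred I) (U : I -> {set T}) (Sp : I -> {set 'I_n})
    (Q : {set 'I_n}) (f s : nat) (b : pred {perm T}) :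
  (#|P| <= n ^ f.+1)%N -> (f <= 20)%N -> (s <= 20)%N ->
  (forall i, P i -> #|U i| = f /\ #|Sp i| = s) ->
  179 / 100 * n%:R + (f + s * s)%:R + 1 <= (s * #|Q|)%:R :> R ->
  (forall p, b p -> exists2 i, P i &
     (U i \subset early p m_high) && (Sp i \subset low_degree (gnm p m_low) (h %/ 400) Q)) ->
  Pr b <= tiny.
Proof.
move=> cP f20 s20 cUS wQ bP; have n0 := est_n0; have hh := est_h.
apply: le_trans (Pr_sum R (P := P) (B := fun i p => (U i \subset early p m_high) &&
   (Sp i \subset low_degree (gnm p m_low) (h %/ 400) Q)) bP) _.
apply: le_trans (_ : \sum_(i | P i) (10 * h%:R / n%:R) ^+ f * expR (- (109 / 100 * h%:R)) <= _).
  by apply: ler_sum => i /cUS[cU cS]; apply: Pr_pattern_le cU cS f20 s20 wQ.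
rewrite sumr_const -[leLHS]mulr_natl.
apply: le_trans (_ : n%:R ^+ f.+1 * ((10 * h%:R / n%:R) ^+ f * expR (- (109 / 100 * h%:R))) <= _).
  rewrite ler_wpM2r ?mulr_ge0 ?exprn_ge0 ?expR_ge0 ?mulr_ge0 ?invr_ge0 ?ler0n//.
  by rewrite -natrX ler_nat.
have -> : n%:R ^+ f.+1 * ((10 * h%:R / n%:R) ^+ f * expR (- (109 / 100 * h%:R))) =
  n%:R * ((10 * h%:R) ^+ f * expR (- (109 / 100 * h%:R))) :> R.
  by rewrite exprS expr_div_n; field; rewrite expf_neq0 ?gt_eqF.
rewrite /tiny [leLHS]mulrCA (mulrC (expR 1)) -[leRHS]mulrA; apply: ler_pM.
- by rewrite exprn_ge0// mulr_ge0// ler0n.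
- by rewrite mulr_ge0 ?ler0n ?expR_ge0.
- by apply: ler_weXn2l => //; lra.
rewrite -expRD; apply: le_trans (ler_wpM2r (expR_ge0 _) nh) _.
by rewrite -expRD ler_expR -natr1; lra.
Qed.

End Estimates.

(** * The exceptional events, one by one *)

Section Events.
Variables (R : realType) (n h : nat).
Local Notation T := (Kedge n).
Local Notation N := #|{: Kedge n}|.
Local Notation Pr := (@Pr R T).
Hypothesis h_large : (5000 <= h)%N.
Hypothesis n_large : (1000 * h <= n)%N.
Hypothesis hn : expR h%:R <= n%:R :> R.
Hypothesis nh : n%:R <= expR h.+1%:R :> R.
Local Notation m0 := (m_low n h).
Local Notation m1 := (m_high n h).
Local Notation D := (h %/ 400)%N.
Local Notation tiny := (tiny R h).

Lemma n_gt1 : (1 < n)%N.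
Proof. by lia. Qed.

Lemma h_gt0 : (0 < h)%N.
Proof. by lia. Qed.

(** The relevant density stays below 0.9 h / n, so the inverse of the mean number of isolated
    vertices is at most e^(0.9 h) / n. *)
Lemma Pr_connected_low :
  Pr (fun s => Defs.connected (gnm s m0)) <= expR (- (10^-1 * h%:R)) + h%:R * expR (- h%:R).
Proof.
have n0 := est_n0 R h_large n_large; have hh := est_h R h_large; have hx := est_nh R n_large.
have m0le := est_low_le R n h; have NE := est_N R h_large n_large.
have m0N := est_low_N R h_large n_large.
have big : 45 / 100 * n%:R ^+ 2 <= N%:R - m0%:R - n%:R :> R.
  by rewrite NE; move: hh hx m0le; set x := n%:R; set y := h%:R; set m := m0%:R; nra.
have n2 : (2 * n <= N - m0)%N.
  by rewrite -(ler_nat R) natrM natrB//; move: big hh hx; set x := n%:R; set y := h%:R; nra.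
have dE : (N - m0 - n)%:R = N%:R - m0%:R - n%:R :> R by rewrite !natrB// (leq_trans _ n2)// leq_pmull.
have d0 : 0 < (N - m0 - n)%:R :> R by rewrite dE; apply: lt_le_trans big; nra.
apply: le_trans (Pr_connected_early R n_gt1 m0N n2) _.
have dle : m0%:R / (N - m0 - n)%:R <= 9 / 10 * (h%:R / n%:R) :> R.
  rewrite ler_pdivrMr// dE -(ler_pM2r n0).
  rewrite [leRHS](_ : _ = 9 / 10 * h%:R * (N%:R - m0%:R - n%:R)); last by field; rewrite gt_eqF.
  apply: le_trans (_ : 9 / 10 * h%:R * (45 / 100 * n%:R ^+ 2) <= _); last first.
    by rewrite ler_wpM2l//; lra.
  by have := ler_wpM2r (ltW n0) m0le; move: n0 hh; set x := n%:R; set y := h%:R; set m := m0%:R; nra.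
apply: lerD.
  apply: le_trans (_ : expR (9 / 10 * h%:R) * expR (- h%:R) <= _); last first.
    by rewrite -expRD ler_expR; lra.
  apply: ler_pM; rewrite ?expR_ge0 ?invr_ge0 ?ler0n//.
    rewrite ler_expR; apply: le_trans (ler_wpM2l (ltW n0) dle) _.
    by rewrite le_eqVlt; apply/orP; left; apply/eqP; field; rewrite gt_eqF.
  by rewrite expRN lef_pV2 ?posrE ?expR_gt0.
apply: le_trans dle _; apply: le_trans (_ : h%:R / n%:R <= _).
  by rewrite ler_piMl ?divr_ge0 ?ler0n//; lra.
by rewrite ler_wpM2l ?ler0n// expRN lef_pV2 ?posrE ?expR_gt0.
Qed.

Lemma expR_sub1_le (x : R) : 0 <= x -> x <= 2^-1 -> expR x - 1 <= 2 * x.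
Proof.
move=> x0 x2; have := expR_ge1Dx (- x); rewrite expRN => le.
have p : 0 < 1 - x by lra.
have : expR x <= (1 - x)^-1 by rewrite -[leLHS]invrK lef_pV2 ?posrE ?invr_gt0 ?expR_gt0.
have : (1 - x)^-1 <= 1 + 2 * x.
  by rewrite -[leLHS]mul1r ler_pdivrMr//; nra.
by lra.
Qed.

Lemma Pr_disconnected_high :
  Pr (fun s => ~~ Defs.connected (gnm s m1)) <= 2 * expR (- h%:R).
Proof.
have n0 := est_n0 R h_large n_large; have hh := est_h R h_large.
apply: le_trans (Pr_disconnected R (est_high_N R h_large n_large)) _.
set x := n%:R * _.
have xle : x <= expR (- h%:R).
  apply: le_trans (_ : expR h.+1%:R * expR (- (4 * h%:R)) <= _); last first.
    by rewrite -expRD ler_expR -natr1; lra.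
  apply: ler_pM; rewrite ?ler0n ?expR_ge0// ler_expR lerN2.
  apply: le_trans (ler_wpM2l _ (est_density_high R h_large n_large)); last by rewrite divr_ge0// ler0n.
  by rewrite le_eqVlt; apply/orP; left; apply/eqP; field; rewrite gt_eqF.
have eh : expR (- h%:R) <= 2^-1 :> R.
  rewrite expRN lef_pV2 ?posrE ?expR_gt0//.
  by apply: le_trans (expR_ge1Dx _); lra.
have x0 : 0 <= x by rewrite mulr_ge0 ?ler0n ?expR_ge0.
by apply: le_trans (expR_sub1_le x0 (le_trans xle eh)) _; lra.
Qed.

Lemma edges_of_sub_early (s : {perm T}) m (P : {set {set 'I_n}}) :
  (forall B, B \in P -> exists x y, B = [set x; y] /\ gnm s m x y) -> edges_of P \subset early s m.
Proof.
move=> H; apply/subsetP=> e; rewrite inE => /H[x [y [ee gxy]]].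
by rewrite (early_gnm _ _ ee).
Qed.

Definition low_edge (Q : {set 'I_n}) (s : {perm T}) : bool :=
  [exists x, exists y, [&& x \in low_degree (gnm s m0) D Q,
     y \in low_degree (gnm s m0) D Q & gnm s m1 x y]].

Lemma Pr_low_edge (Q : {set 'I_n}) : 9 / 10 * n%:R <= #|Q|%:R :> R -> Pr (low_edge Q) <= tiny.
Proof.
move=> cQ; have hh := est_h R h_large; have hx := est_nh R n_large.
apply: (@Pr_patterns_le R n h h_large n_large nh ('I_n * 'I_n)%type (fun p => p.1 != p.2)
  (fun p => edges_of [set [set p.1; p.2]]) (fun p => [set p.1; p.2]) Q 1 2) => //.
- by apply: leq_trans (max_card _) _; rewrite card_prod card_ord.
- move=> [x y] /= xy; split; last by rewrite cards2 xy.
  by rewrite card_edges_of ?cards1// => B; rewrite inE => /eqP ->; rewrite cards2 xy.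
- by rewrite natrM; lra.
move=> s /existsP[x /existsP[y /and3P[xL yL gxy]]].
have xy : x != y by apply: contraTneq gxy => ->; rewrite gnm_irr.
exists (x, y) => //=; apply/andP; split; last by rewrite subUset !sub1set xL yL.
apply: edges_of_sub_early => B; rewrite inE => /eqP ->; by exists x, y.
Qed.

Definition low_star (Q : {set 'I_n}) (s : {perm T}) : bool :=
  [exists v, 20 <= #|nbrs (gnm s m0) [set v] :&: low_degree (gnm s m0) D Q|]%N.

Lemma card_sets20 : (#|[pred p : 'I_n * {set 'I_n} | (#|p.2| == 20) && (p.1 \notin p.2)]| <= n ^ 21)%N.
Proof.
apply: leq_trans (_ : #|setX [set: 'I_n] [set S : {set 'I_n} | #|S| == 20]| <= _)%N.
  apply/subset_leq_card/subsetP => -[v S]; rewrite !inE /= => /andP[-> _] //.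
rewrite cardsX cardsT card_ord card_draws card_ord expnS leq_mul2l; apply/orP; right.
apply: leq_trans (ffact_le_exp n 20); rewrite -bin_ffact leq_pmulr// fact_gt0//.
Qed.

Lemma m0_le_m1 : (m0 <= m1)%N.
Proof. rewrite /m_low /m_high; have := leq_trunc_div (2 * n * h) 5; nia. Qed.

(** The number 20 is dictated by the minority: twenty vertices, each with about n/10 possible
    neighbours there, give about 2n edges, above the 1.79 n required. *)
Lemma Pr_low_star (Q : {set 'I_n}) : (n <= 10 * #|Q|.+1)%N -> Pr (low_star Q) <= tiny.
Proof.
move=> cQ; have hh := est_h R h_large; have hx := est_nh R n_large.
apply: (@Pr_patterns_le R n h h_large n_large nh ('I_n * {set 'I_n})%type
  (fun p => (#|p.2| == 20) && (p.1 \notin p.2))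
  (fun p => edges_of [set [set p.1; u] | u in p.2]) (fun p => p.2) Q 20 20) => //.
- exact: card_sets20.
- move=> [v S] /= /andP[/eqP cS vS]; split=> //.
  have ne u : u \in S -> v != u by apply: contraTneq => <-.
  rewrite card_edges_of => [|B /imsetP[u uS ->]]; last by rewrite cards2 ne.
  rewrite card_in_imset// => u u' uS u'S e.
  have : u \in [set v; u'] by rewrite -e !inE eqxx orbT.
  by rewrite !inE eq_sym (negPf (ne _ uS)) => /eqP.
- have : n%:R <= 10 * #|Q|%:R + 10 :> R by rewrite -natrM -natrD ler_nat addnC -mulnS.
  by rewrite natrM; lra.
move=> s /existsP[v big].
have [S [_ SL cS]] : exists S : {set 'I_n}, [/\ set0 \subset S,
    S \subset nbrs (gnm s m0) [set v] :&: low_degree (gnm s m0) D Q & #|S| = 20].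
  by apply: subset_between; rewrite ?sub0set ?cards0.
have gS u : u \in S -> gnm s m0 v u.
  by move=> /(subsetP SL); rewrite inE => /andP[/nbrsP[w]]; rewrite inE => /eqP ->.
exists (v, S).
  by rewrite /= cS eqxx; apply/negP=> /gS; rewrite gnm_irr.
apply/andP; split; last by apply: subset_trans SL (subsetIr _ _).
apply: edges_of_sub_early => B /imsetP[u uS ->]; exists v, u; split=> //.
exact: (gnm_mono m0_le_m1 (gS _ uS)).
Qed.

Definition low_path (Q : {set 'I_n}) (s : {perm T}) : bool :=
  [exists p : 'I_n * 'I_n * 'I_n * 'I_n * 'I_n, let: (a, b, v, c, d) := p in
     [&& uniq [:: a; b; v; c; d], a \in low_degree (gnm s m0) D Q,
         d \in low_degree (gnm s m0) D Q, gnm s m1 a b, gnm s m1 b v, gnm s m1 v c & gnm s m1 c d]].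

Lemma pair_neq (a b x y : 'I_n) : a != x -> a != y -> [set a; b] != [set x; y].
Proof.
move=> ax ay; apply/eqP=> e; have : a \in [set x; y] by rewrite -e !inE eqxx.
by rewrite !inE (negPf ax) (negPf ay).
Qed.

Lemma Pr_low_path (Q : {set 'I_n}) : 9 / 10 * n%:R <= #|Q|%:R :> R -> Pr (low_path Q) <= tiny.
Proof.
move=> cQ; have hh := est_h R h_large; have hx := est_nh R n_large.
pose E (p : 'I_n * 'I_n * 'I_n * 'I_n * 'I_n) : seq {set 'I_n} :=
  let: (a, b, v, c, d) := p in [:: [set a; b]; [set b; v]; [set v; c]; [set c; d]].
apply: (@Pr_patterns_le R n h h_large n_large nh ('I_n * 'I_n * 'I_n * 'I_n * 'I_n)%type
  (fun p => let: (a, b, v, c, d) := p in uniq [:: a; b; v; c; d])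
  (fun p => edges_of [set B in E p]) (fun p => let: (a, b, v, c, d) := p in [set a; d]) Q 4 2) => //.
- apply: leq_trans (max_card _) _; by rewrite !card_prod card_ord !expnSr expn0 mul1n.
- move=> [[[[a b] v] c] d]; rewrite /= !inE !negb_or.
  move=> /and5P[/and4P[ab av ac ad] /and3P[bv bc bd] /andP[vc vd] cd _].
  split; last by rewrite cards2 ad.
  rewrite card_edges_of; last first.
    by move=> B; rewrite !inE => /or4P[] /eqP ->; rewrite cards2 ?ab ?bv ?vc ?cd.
  rewrite cardsE (card_uniqP _) //= !inE !negb_or.
  by rewrite !pair_neq// eq_sym.
- by rewrite natrM; lra.
move=> s /existsP[[[[[a b] v] c] d] /and5P[up aL dL gab /and3P[gbv gvc gcd]]].
exists (a, b, v, c, d) => //; apply/andP; split; last by rewrite subUset !sub1set aL dL.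
apply: edges_of_sub_early => B; rewrite !inE.
by case/or4P=> /eqP ->; [exists a, b|exists b, v|exists v, c|exists c, d].
Qed.

Lemma Pr_dense_small :
  Pr (fun s => [exists S : {set 'I_n}, (0 < #|S| <= n %/ h ^ 2)%N &&
        (2 * (4 * #|S|) < volume (gnm s m0) S)%N]) <= 2 * (h%:R ^- 2).
Proof.
have n0 := est_n0 R h_large n_large; have hh := est_h R h_large.
have h0 : 0 < h%:R :> R by lra.
apply: (Pr_dense_set (a := h%:R)) => //.
- exact (est_density_le R h_large n_large).
- exact: ltnW n_gt1.
- move=> k /andP[k0 kn].
  have k0' : 0 < k%:R :> R by rewrite ltr0n.
  have kh : k%:R * h%:R ^+ 2 <= n%:R :> R.
    by rewrite -natrX -natrM ler_nat; apply: leq_trans (leq_trunc_div n (h ^ 2)); rewrite leq_mul2r kn orbT.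
  set x := k%:R / n%:R : R.
  have xh : x <= h%:R ^- 2 by rewrite ler_pdivrMr// mulrC ler_pdivlMr ?exprn_gt0.
  have x0 : 0 <= x by rewrite divr_ge0 ?ler0n.
  (* With four edges per vertex, the fourth power of the density outweighs the factor 4 / x from the
     choice of the set, and [x] is at most 1 / h^2. *)
  rewrite [leLHS](_ : _ = x ^+ 3 * h%:R ^+ 4 / 4); last first.
    by rewrite /x; field; rewrite !gt_eqF.
  have x3 : x ^+ 3 <= h%:R ^- 2 ^+ 3 by apply: lerXn2r; rewrite ?nnegrE ?invr_ge0 ?exprn_ge0// ltW.
  apply: le_trans (_ : x ^+ 3 * h%:R ^+ 4 <= _).
    have : 0 <= x ^+ 3 * h%:R ^+ 4 by rewrite mulr_ge0 ?exprn_ge0 ?(ltW h0).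
    by move: (x ^+ 3 * h%:R ^+ 4) => z; lra.
  apply: le_trans (ler_wpM2r _ x3) _; first by rewrite exprn_ge0 ?ltW.
  by rewrite le_eqVlt; apply/orP; left; apply/eqP; field; rewrite gt_eqF.
- by rewrite invr_ge0 exprn_ge0 ?ltW.
- by rewrite lef_pV2 ?posrE ?exprn_gt0//; nra.
Qed.

Lemma half_pow_le (t : nat) : (2^-1 : R) ^+ t <= t.+1%:R^-1.
Proof.
rewrite exprVn lef_pV2 ?posrE ?exprn_gt0 ?ltr0n//.
by rewrite -natrX ler_nat ltn_expl.
Qed.

Lemma Pr_dense_mid (t : nat) : (512 <= t)%N -> (h < t.+1 ^ 4)%N ->
  Pr (fun s => [exists S : {set 'I_n}, (0 < #|S| <= (4 * n) %/ t ^ 2)%N &&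
        (2 * (t ^ 3 * #|S|) < volume (gnm s m0) S)%N]) <= 2 * (128 / t%:R).
Proof.
move=> t_large ht.
have n0 := est_n0 R h_large n_large; have hh := est_h R h_large.
have tl : 512 <= t%:R :> R by rewrite ler_nat.
have t0 : 0 < t%:R :> R by lra.
have tp : (0 < t)%N by apply: leq_trans t_large.
have h16 : h%:R <= 16 * t%:R ^+ 4 :> R.
  rewrite -natrX -natrM ler_nat; apply: leq_trans (ltnW ht) _.
  by rewrite -[16%N]/(2 ^ 4)%N -expnMn leq_exp2r// mul2n -addnn -addn1 leq_add2l.
apply: (Pr_dense_set (a := h%:R)) => //.
- by rewrite expn_gt0 tp.
- exact (est_density_le R h_large n_large).
- exact: ltnW n_gt1.
- move=> k /andP[k0 kn].
  have k0' : 0 < k%:R :> R by rewrite ltr0n.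
  have kt : k%:R * t%:R ^+ 2 <= 4 * n%:R :> R.
    rewrite -natrX -!natrM ler_nat.
    by apply: leq_trans (leq_trunc_div (4 * n) (t ^ 2)); rewrite leq_mul2r kn orbT.
  set x := k%:R / n%:R : R.
  have x0 : 0 < x by rewrite divr_gt0.
  have xt : x * t%:R ^+ 2 <= 4 by rewrite mulrAC ler_pdivrMr.
  (* [u] bounds the base 2 x h / t^3, through h <= 16 t^4; and x <= 4 / t^2 makes it at most 128 /
     t. *)
  set u := 32 * x * t%:R.
  have xt0 : 0 <= x * t%:R by apply: mulr_ge0; apply: ltW.
  have u0 : 0 <= u by rewrite /u -mulrA mulr_ge0.
  have u2 : u <= 2^-1.
    have tl0 : 0 <= t%:R - 512 :> R by rewrite subr_ge0.
    have := mulr_ge0 xt0 tl0; rewrite mulrBr -mulrA -expr2 /u -mulrA.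
    by move: xt; move: (x * t%:R ^+ 2) (x * t%:R) => y z; lra.
  apply: le_trans (_ : (4 / x) * u ^+ (t ^ 3) <= _).
    have -> : 4 * n%:R / k%:R = 4 / x by rewrite /x; field; rewrite !gt_eqF.
    apply: ler_wpM2l; first by rewrite divr_ge0 ?(ltW x0).
    apply: lerXn2r; rewrite ?nnegrE//.
      by rewrite !mulr_ge0 ?invr_ge0 ?mulr_ge0 ?ler0n.
    rewrite [leLHS](_ : _ = 2 * x / t%:R ^+ 3 * h%:R); last first.
      by rewrite natrX /x; field; rewrite !gt_eqF.
    rewrite [leRHS](_ : _ = 2 * x / t%:R ^+ 3 * (16 * t%:R ^+ 4)); last first.
      by rewrite /u; field; rewrite gt_eqF.
    apply: (ler_wpM2l _ h16); apply: divr_ge0; last by rewrite exprn_ge0// ltW.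
    by apply: mulr_ge0 => //; apply: ltW.
  (* One factor [u] is split off to cancel the [x] in the denominator. *)
  have -> : (t ^ 3)%N = (t ^ 3).-1.+1 by rewrite prednK// expn_gt0 tp.
  rewrite exprS mulrA [X in X * _](_ : _ = 128 * t%:R); last by rewrite /u; field; rewrite gt_eqF.
  apply: le_trans (_ : 128 * t%:R * (2^-1) ^+ (t + t) <= _).
    rewrite ler_wpM2l ?mulr_ge0 ?ler0n//; apply: le_trans (_ : (2^-1) ^+ (t ^ 3).-1 <= _).
      by apply: lerXn2r; rewrite ?nnegrE ?invr_ge0.
    apply: ler_wiXn2l; rewrite ?invr_ge0 ?invf_le1//; [lra|].
    rewrite -ltnS prednK ?expn_gt0 ?tp//; apply: leq_trans (_ : t * 3 <= _)%N.
      by move: tp; clear; lia.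
    rewrite (expnS t 2) leq_mul2l; apply/orP; right.
    apply: leq_trans (_ : t ^ 1 <= _)%N; last by rewrite leq_pexp2l.
    by rewrite expn1; apply: leq_trans t_large.
  have := half_pow_le t; rewrite exprD; set p := 2^-1 ^+ t => pt.
  have p0 : 0 <= p by rewrite exprn_ge0// invr_ge0 ler0n.
  have pt' : p <= t%:R^-1.
    by apply: le_trans pt _; rewrite lef_pV2 ?posrE ?ltr0n// ler_nat.
  have : p * p <= t%:R^-1 * t%:R^-1 by apply: ler_pM.
  move=> /(ler_wpM2l (_ : 0 <= 128 * t%:R)) le; apply: le_trans (le _) _.
    by rewrite mulr_ge0// ltW.
  by rewrite le_eqVlt; apply/orP; left; apply/eqP; field; rewrite gt_eqF.
- by rewrite divr_ge0// ltW.
- by rewrite ler_pdivrMr//; lra.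
Qed.

(** About 10 n^2 / h absent edges at density 0.79 h / n give an exponent beyond 7n, against 4^n <=
    e^(2n) pairs of sets. *)
Lemma Pr_unjoined_low :
  Pr (fun s => [exists X : {set 'I_n}, [exists Z : {set 'I_n},
     [&& [disjoint X & Z], ((10 * n ^ 2) %/ h <= #|X| * #|Z|)%N & [disjoint between X Z & early s m0]]]]) <=
  expR (- h%:R).
Proof.
have n0 := est_n0 R h_large n_large; have hh := est_h R h_large; have hx := est_nh R n_large.
have h0 : 0 < h%:R :> R by lra.
apply: le_trans (Pr_unjoined R _ (est_low_N R h_large n_large)) _.
set L := (_ %/ _)%N.
have Ll : 10 * n%:R ^+ 2 <= (L%:R + 1) * h%:R :> R.
  rewrite -natrX -natrM natr1 -natrM ler_nat; apply: ltnW.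
  by apply: ltn_ceil; apply: h_gt0.
have LL : 7 * n%:R <= L%:R * (m0%:R / N%:R) :> R.
  apply: le_trans (ler_wpM2l _ (est_density_ge R h_large n_large)); last by rewrite ler0n.
  rewrite mulrA ler_pdivlMr// .
  have := ler0n R L; move: Ll n0 hx hh; set x := n%:R; set y := h%:R; set l := L%:R => Ll n0 hx hh l0.
  nra.
have e4 : 4 <= expR 2 :> R.
  have -> : 2 = 1 * 2%:R :> R by rewrite mul1r.
  rewrite expRM_natr -[4]/(4%:R) (_ : 4 = (2 ^ 2))%N// natrX; apply: lerXn2r; rewrite ?nnegrE ?expR_ge0 ?ler0n//.
  by apply: le_trans (expR_ge1Dx 1); lra.
apply: le_trans (_ : expR 2 ^+ n * expR (- (7 * n%:R)) <= _).
  apply: ler_pM; rewrite ?exprn_ge0 ?expR_ge0// ?ler_expR ?lerN2//.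
  by apply: lerXn2r; rewrite ?nnegrE ?expR_ge0 ?ler0n.
by rewrite -expRM_natr -expRD ler_expR; lra.
Qed.

End Events.

(** * Elementary estimates for the limit *)

Lemma exp_decay (R : realType) (k : nat) (c eps : R) : 0 < c -> 0 < eps ->
  exists H : nat, forall h, (H <= h)%N -> h%:R ^+ k * expR (- (c * h%:R)) <= eps.
Proof.
move=> c0 e0; pose b := (k.+1)`!%:R / (c ^+ k.+1 * eps).
exists (Num.truncn b).+1 => h hH.
have bh : b <= h%:R.
  by apply: le_trans (ltW (truncnS_gt b)) _; rewrite ler_nat.
have h0 : 0 < h%:R :> R by rewrite ltr0n; apply: leq_trans hH.
have ch : 0 < c * h%:R by apply: mulr_gt0.
have := expR_ge1Dxn k (ltW ch) => le1.
have le : (c * h%:R) ^+ k.+1 / (k.+1)`!%:R <= expR (c * h%:R) by lra.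
have f0 : 0 < (k.+1)`!%:R :> R by rewrite ltr0n fact_gt0.
rewrite expRN ler_pdivrMr ?expR_gt0//.
apply: le_trans (ler_wpM2l (ltW e0) le).
rewrite mulrA ler_pdivlMr// exprMn [h%:R ^+ k.+1]exprSr.
have : (k.+1)`!%:R <= h%:R * (c ^+ k.+1 * eps).
  by rewrite -ler_pdivrMr// mulr_gt0// exprn_gt0.
move=> /(ler_wpM2l (exprn_ge0 k (ltW h0))) le2.
rewrite [leRHS](_ : _ = h%:R ^+ k * (h%:R * (c ^+ k.+1 * eps)))//.
by move: (c ^+ k.+1) (h%:R ^+ k) => u v; ring.
Qed.

Lemma expR1_le4 (R : realType) : expR 1 <= 4 :> R.
Proof.
have := expR_ge1Dx (- (2^-1) : R); rewrite expRN => le.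
have h2 : expR 2^-1 <= 2 :> R.
  rewrite -[leLHS]invrK -[leRHS]invrK lef_pV2 ?posrE ?invr_gt0 ?expR_gt0//.
  by apply: le_trans le; lra.
have -> : 1 = 2^-1 + 2^-1 :> R by lra.
rewrite expRD; have := expR_ge0 (2^-1 : R); nra.
Qed.

Lemma expR1_ge2 (R : realType) : 2 <= expR 1 :> R.
Proof. by apply: le_trans (expR_ge1Dx 1); lra. Qed.

Lemma expR_ge_linear (R : realType) (x : R) : 5000 <= x -> 1000 * x <= expR x.
Proof.
move=> x5; have x0 : 0 <= x by lra.
apply: le_trans (expR_ge1Dxn 1 x0).
by rewrite (_ : 2`!%:R = 2)//; nra.
Qed.

Lemma inv_sqr_le (R : realFieldType) (x : R) : 1 <= x -> 2 * x ^- 2 <= 256 / x.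
Proof.
move=> x1; have x0 : 0 < x by lra.
rewrite ler_pdivlMr// (_ : 2 * x ^- 2 * x = 2 / x); last by field; rewrite gt_eqF.
by rewrite ler_pdivrMr//; lra.
Qed.

Lemma volume0 (V : finType) (g : rel V) : volume g set0 = 0%N.
Proof. by rewrite /volume big_set0. Qed.

(** * Union bound and transfer to the hitting time *)

Section Assembly.
Variables (R : realType) (n h t : nat).
Local Notation T := (Kedge n).
Local Notation m0 := (m_low n h).
Local Notation m1 := (m_high n h).

Definition majority : {set 'I_n} := [set i : 'I_n | (n %/ 10 <= i)%N].

(** [low_edge] and [low_path] combine low degree in the early graph with adjacency in the late one.
    Excluding them thus covers every graph in between, whatever the value of the hitting time. *)
Definition exceptional_order (s : {perm T}) : bool :=
  [|| Defs.connected (gnm s m0), ~~ Defs.connected (gnm s m1),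
      low_edge h majority s, low_star h majority s, low_star h (~: majority) s,
      low_path h majority s,
      [exists S : {set 'I_n}, (0 < #|S| <= n %/ h ^ 2)%N &&
        (2 * (4 * #|S|) < volume (gnm s m0) S)%N],
      [exists S : {set 'I_n}, (0 < #|S| <= (4 * n) %/ t ^ 2)%N &&
        (2 * (t ^ 3 * #|S|) < volume (gnm s m0) S)%N] |
      [exists X : {set 'I_n}, [exists Z : {set 'I_n},
        [&& [disjoint X & Z], ((10 * n ^ 2) %/ h <= #|X| * #|Z|)%N & [disjoint between X Z & early s m0]]]] ].

Lemma card_minority : #|~: majority| = (n %/ 10)%N.
Proof.
have le : (n %/ 10 <= n)%N by apply: leq_div.
rewrite -[RHS]card_ord; pose e (i : 'I_(n %/ 10)) : 'I_n := widen_ord le i.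
have ei : injective e by move=> i j /(congr1 val) /= /val_inj.
rewrite -[in RHS]cardsT -(card_imset _ ei); apply: eq_card => i; rewrite !inE -ltnNge.
apply/idP/imsetP => [lt|[j _ ->]]; last by rewrite /= ltn_ord.
by exists (Ordinal lt); rewrite ?inE//; apply: val_inj.
Qed.

Lemma card_majority : (#|majority| + n %/ 10)%N = n.
Proof. by rewrite -card_minority cardsC card_ord. Qed.

Hypothesis h_large : (5000 <= h)%N.
Hypothesis n_large : (1000 * h <= n)%N.
Hypothesis hn : expR h%:R <= n%:R :> R.
Hypothesis nh : n%:R <= expR h.+1%:R :> R.
Hypothesis t_large : (512 <= t)%N.
Hypothesis ht : (h < t.+1 ^ 4)%N.

(** The factor 10 comes from nine events, the first of which has a bound with two terms. *)
Lemma Pr_exceptional_order (e : R) :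
  expR (- (10^-1 * h%:R)) <= e -> h%:R * expR (- h%:R) <= e -> tiny R h <= e ->
  2 * (h%:R ^- 2) <= e -> 2 * (128 / t%:R) <= e ->
  Pr R exceptional_order <= 10 * e.
Proof.
move=> e1 e2 e3 e4 e5.
have cM : 9 / 10 * n%:R <= #|majority|%:R :> R.
  have := card_majority; have : (n %/ 10 * 10 <= n)%N by apply: leq_trunc_div.
  by rewrite -(ler_nat R) natrM => le /(congr1 (fun k => k%:R : R)); rewrite natrD; lra.
have cM1 : (n <= 10 * #|majority|.+1)%N.
  have := card_majority; have := leq_trunc_div n 10; clear; lia.
have cM2 : (n <= 10 * #|~: majority|.+1)%N.
  by rewrite card_minority mulnC; apply/ltnW/ltn_ceil.
have hh : 5000 <= h%:R :> R by rewrite ler_nat.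
have e6 : expR (- h%:R) <= e.
  by apply: le_trans e2; rewrite ler_peMl ?expR_ge0//; lra.
have e7 : 2 * expR (- h%:R) <= e.
  by apply: le_trans e2; rewrite ler_wpM2r ?expR_ge0//; lra.
have V1 := Pr_connected_low h_large n_large hn nh.
have V2 := Pr_disconnected_high h_large n_large nh.
have V3 := Pr_low_edge h_large n_large nh cM.
have V4 := Pr_low_star h_large n_large hn nh cM1.
have V5 := Pr_low_star h_large n_large hn nh cM2.
have V6 := Pr_low_path h_large n_large nh cM.
have V7 := Pr_dense_small h_large n_large hn nh.
have V8 := Pr_dense_mid h_large n_large hn nh t_large ht.
have V9 := Pr_unjoined_low h_large n_large hn nh.
have or_le b1 b2 (x y : R) : Pr R b1 <= x -> Pr R b2 <= y -> Pr R (fun s : {perm T} => b1 s || b2 s) <= x + y.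
  by move=> b1x b2y; apply: le_trans (Pr_or R b1 b2) (lerD b1x b2y).
apply: le_trans (or_le _ _ _ _ V1 (or_le _ _ _ _ V2 (or_le _ _ _ _ V3 (or_le _ _ _ _ V4 (or_le _ _ _ _ V5
  (or_le _ _ _ _ V6 (or_le _ _ _ _ V7 (or_le _ _ _ _ V8 V9)))))))) _.
lra.
Qed.

Lemma typical_order_acquisition (T0 : nat) (s : {perm T}) :
  acquisition_threshold T0 ->
  (T0 <= t)%N -> (t ^ 4 <= h)%N -> (2 ^ h <= n)%N -> (n < 4 ^ h.+1)%N ->
  ~~ exceptional_order s ->
  frac_acq_number R (gnm s (hitting_time s)) 1 /\ unit_acq_number (gnm s (hitting_time s)) 1.
Proof.
move=> acq tT th h2 h4; rewrite /exceptional_order !negb_or negbK.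
move=> /and5P[nc0 c1 nE nS1 /and5P[nS2 nP nD1 nD2 nJ]].
set M := hitting_time s.
have h0 : (0 < h)%N by apply: leq_trans h_large.
have t0 : (0 < t)%N by apply: leq_trans t_large.
have M1 : (M <= m1)%N by apply: hitting_time_le => //; apply: est_high_N R _ _ h_large n_large.
have M0 : (m0 <= M)%N.
  rewrite leqNgt; apply: contra nc0 => /ltnW Mm; apply: connected_mono Mm _.
  exact: connected_hitting_time.
have gM x y : gnm s M x y -> gnm s m1 x y by apply: gnm_mono.
apply: (acq R 'I_n (gnm s m0) (gnm s M) majority h t n) => //.
- by rewrite card_ord.
- by rewrite card_minority mulnC; apply/ltnW/ltn_ceil.
- exact: gnm_sym.
- exact: gnm_irr.
- exact: connected_hitting_time.
- exact: gnm_sym.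
- exact: gnm_mono.
- move=> l l' lL l'L; apply: contra nE => gll.
  by apply/existsP; exists l; apply/existsP; exists l'; rewrite lL l'L gM.
- move=> Q v; rewrite !inE => /orP[]/eqP ->; rewrite ltnNge.
    by apply: contra nS1 => le; apply/existsP; exists v.
  by apply: contra nS2 => le; apply/existsP; exists v.
- move=> l1 x1 v x2 l2 up L1 L2 g1 g2 g3 g4; move/negP: nP; apply.
  by apply/existsP; exists (l1, x1, v, x2, l2); rewrite up L1 L2 !gM.
- move=> S cS; have [S0|S0] := posnP #|S|.
    by move/eqP: S0; rewrite cards_eq0 => /eqP ->; rewrite volume0.
  rewrite leqNgt; apply: contra nD1 => big; apply/existsP; exists S.
  by rewrite S0 leq_divRL ?expn_gt0 ?h0// cS mulnA.
- move=> S cS; have [S0|S0] := posnP #|S|.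
    by move/eqP: S0; rewrite cards_eq0 => /eqP ->; rewrite volume0.
  rewrite leqNgt; apply: contra nD2 => big; apply/existsP; exists S.
  by rewrite S0 leq_divRL ?expn_gt0 ?t0// cS mulnA.
move=> X Z dXZ cXZ.
have : ~~ [disjoint between X Z & early s m0].
  apply: contra nJ => dis; apply/existsP; exists X; apply/existsP; exists Z.
  by rewrite dXZ dis andbT /=; apply: leq_trans (leq_div2r h cXZ) _; rewrite mulnK.
case/pred0Pn=> e /andP[/mem_between[x [z [xX zZ ee]]] em].
by exists x => //; exists z => //; apply/gnmP; exists e.
Qed.

End Assembly.

(* a.a.s.: the probability tends to 1 as n -> oo *)
Theorem theorem1p1 (R : realType) :
  forall eps : R, 0 < eps -> exists n0 : nat, forall n : nat, (n0 <= n)%N ->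
    1 - eps <= prob_perm R (fun s : {perm Kedge n} =>
                 frac_acq_number R (gnm s (hitting_time s)) 1 /\
                 unit_acq_number (gnm s (hitting_time s)) 1).
Proof.
move=> eps eps0; have [T0 acq] := sparse_graph_acquisition.
pose e := eps / 10; have e0 : 0 < e by rewrite divr_gt0.
have c1 : 0 < 10^-1 :> R by rewrite invr_gt0.
have c3 : 0 < 9 / 100 :> R by rewrite divr_gt0.
have [H1 decay1] := exp_decay 0 c1 e0.
have [H2 decay2] := exp_decay 1 (ltr01 : 0 < 1 :> R) e0.
have C0 : 0 < expR 1 * 10 ^+ 20 :> R by rewrite mulr_gt0 ?expR_gt0 ?exprn_gt0.
have [H3 decay3] := exp_decay 20 c3 (divr_gt0 e0 C0).
pose B := (Num.truncn (256 / e)).+1.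
pose t1 := (T0 + 512 + B)%N.
(* [H] collects every lower bound on [h]; the summand [t1 ^ 4] forces [t1 <= t] for the fourth root
   [t] chosen below. *)
pose H := (5000 + H1 + H2 + H3 + B + t1 ^ 4)%N.
exists (Num.truncn (expR H%:R : R)).+1 => n nn0.
have nH : expR H%:R <= n%:R :> R.
  by apply: le_trans (ltW (truncnS_gt _)) _; rewrite ler_nat.
have n0 : 0 < n%:R :> R by apply: lt_le_trans nH; rewrite expR_gt0.
have lnn : expR (ln n%:R) = n%:R :> R by rewrite lnK// posrE.
have lnH : H%:R <= ln n%:R :> R by rewrite -ler_expR lnn.
have ln0 : 0 <= ln n%:R :> R by apply: le_trans lnH; rewrite ler0n.
pose h := Num.truncn (ln n%:R : R).
have /andP[hl hu] := truncn_itv ln0; rewrite -/h in hl hu.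
have hn : expR h%:R <= n%:R :> R by rewrite -lnn ler_expR.
have nh : n%:R < expR h.+1%:R :> R by rewrite -lnn ltr_expR.
have Hh : (H <= h)%N by rewrite truncn_ge_nat.
have [[h5 hH1 hH2] [hH3 hB ht1]] :
    [/\ 5000 <= h, H1 <= h & H2 <= h]%N /\ [/\ H3 <= h, B <= h & t1 ^ 4 <= h]%N.
  by move: Hh; rewrite /H; move: (t1 ^ 4)%N => k Hk; clear -Hk; split; split; lia.
have hR : 5000 <= h%:R :> R by rewrite ler_nat.
have n_large : (1000 * h <= n)%N.
  by rewrite -(ler_nat R) natrM; apply: le_trans hn; apply: expR_ge_linear.
(* [t] is the integer part of the fourth root of [h]. *)
have [t [tt1 th ht]] : exists t, [/\ t1 <= t, t ^ 4 <= h & h < t.+1 ^ 4]%N.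
  have ub t : (t ^ 4 <= h -> t <= h)%N.
    by apply: leq_trans; case: t => // t; rewrite -{1}(expn1 t.+1) leq_pexp2l.
  have ex : exists t, (t ^ 4 <= h)%N by exists t1.
  case: (ex_maxnP ex ub) => t th tmax; exists t; split=> //; first exact: tmax.
  by rewrite ltnNge; apply/negP=> /tmax; rewrite ltnn.
have [tT t5 tB] : [/\ T0 <= t, 512 <= t & B <= t]%N.
  by move: tt1; rewrite /t1 => le; clear -le; split; lia.
have h2n : (2 ^ h <= n)%N.
  rewrite -(ler_nat R); apply: le_trans hn; rewrite natrX -[h%:R]mul1r expRM_natr.
  apply: lerXn2r; rewrite ?nnegrE ?expR_ge0//.
  exact: expR1_ge2.
have nh4 : (n < 4 ^ h.+1)%N.
  rewrite -(ltr_nat R); apply: lt_le_trans nh _; rewrite natrX -[h.+1%:R]mul1r expRM_natr.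
  by apply: lerXn2r; rewrite ?nnegrE ?expR_ge0 ?expR1_le4.
have inv_le (k : nat) : (B <= k)%N -> 256 / k%:R <= e.
  move=> Bk; have k0 : 0 < k%:R :> R by rewrite ltr0n; apply: leq_trans Bk.
  rewrite ler_pdivrMr// -ler_pdivrMl// mulrC.
  by apply: le_trans (ltW (truncnS_gt _)) _; rewrite ler_nat.
apply: le_trans (_ : 1 - Pr R (@exceptional_order n h t) <= _).
  have -> : eps = 10 * e by rewrite /e; field.
  rewrite lerB//; apply: Pr_exceptional_order => //; first exact: ltW.
  - by have := decay1 _ hH1; rewrite expr0 mul1r.
  - by have := decay2 _ hH2; rewrite expr1 mul1r.
  - have := decay3 _ hH3; rewrite ler_pdivlMr// /tiny exprMn.
    by rewrite (_ : expR 1 * _ * _ = h%:R ^+ 20 * expR (- (9 / 100 * h%:R)) * (expR 1 * 10 ^+ 20))//; ring.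
  - apply: le_trans (inv_le _ hB); apply: inv_sqr_le.
    by rewrite ler1n; apply: leq_trans h5.
  - by apply: le_trans (inv_le _ tB); rewrite mulrA -natrM.
have -> : 1 - Pr R (@exceptional_order n h t) =
    Pr R (fun s : {perm Kedge n} => ~~ exceptional_order h t s).
  by rewrite [RHS]Pr_compl; congr (_ - Pr _ _); apply/funext=> s; rewrite negbK.
rewrite /prob_perm card_perms.
have imp (s : {perm Kedge n}) : ~~ exceptional_order h t s ->
    `[< frac_acq_number R (gnm s (hitting_time s)) 1 /\
        unit_acq_number (gnm s (hitting_time s)) 1 >].
  by move=> nb; apply/asboolP; exact (typical_order_acquisition R h5 n_large t5 ht acq tT th h2n nh4 nb).
exact: (Pr_le R imp).
Qed.
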